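(* Let $G=N\rtimes H$ be a semidirect product of discrete groups with identity $e$, let $M$ be a normal subgroup of $N$, and let $P=\{a\in H: aMa^{-1}\subset M\}$. Assume that $H=PP^{-1}=P^{-1}P$, that $aMa^{-1}$ has finite index in $M$ for every $a\in P$, and that $\bigcap_{a\in P}aMa^{-1}=\{e\}$. Let $T\subset\mathfrak{A}[N\rtimes H,M]$ be the inverse semigroup of partial isometries $$T=\{s_a^*u(m)fu(m')s_{a'}: m,m'\in M,\ a,a'\in P,\ f\in F\},$$ and let $\mathcal{G}_{tight}$ be the tight groupoid associated to $T$. Then $\mathfrak{A}[N\rtimes H,M]$ is isomorphic to $C^*(\mathcal{G}_{tight})$.
   Context: For $a\in P$ write $M_a=aMa^{-1}$. $\mathfrak{A}[N\rtimes H,M]$ is the universal (unital) $C^*$-algebra generated by isometries $\{s_a:a\in P\}$ and unitaries $\{u(m):m\in M\}$ subject to: $s_as_b=s_{ab}$; $u(m)u(n)=u(mn)$; $s_au(m)=u(ama^{-1})s_a$; and, for every $a\in P$, $\sum_{k\in M/M_a}u(k)e_au(k)^{-1}=1$, where $e_a=s_as_a^*$. $F$ is the set of projections in the linear span of $\{u(k)e_bu(k)^{-1}:b\in P,k\in M\}$; $T$ is an inverse semigroup (with involution $*$) containing $0$ whose set of projections is $F$. Tight groupoid of an inverse semigroup $S$ with $0$: let $E$ be the set of projections (idempotents) of $S$. A character of $E$ is a nonzero map $x:E\to\{0,1\}$ that is a semigroup homomorphism with $x(0)=0$; $\widehat{E_0}$ is the set of characters with the topology inherited from $\{0,1\}^E$.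 A character $x$ is maximal if its support $\{e\in E:x(e)=1\}$ is maximal under inclusion among supports of characters; $\widehat{E_\infty}$ is the set of maximal characters and $\widehat{E_{tight}}$ its closure in $\widehat{E_0}$. For $s\in S$ put $D_s=\{x\in\widehat{E_0}:x(ss^* )=1\}$, and for $x\in D_s$ define $(x.s)(e)=x(ses^* )$. Let $\Sigma=\{(x,s):s\in S, x\in D_s\}$ with $(x,s)(y,t)=(x,st)$ when $y=x.s$ and $(x,s)^{-1}=(x.s,s^* )$. Put $(x,s)\sim(y,t)$ if $x=y$ and there is $e\in E$ with $x(e)=1$ and $es=et$. Then $\mathcal{G}=\Sigma/\!\sim$ is a groupoid with unit space $\widehat{E_0}$, topologized by the basis of sets $\theta(s,U)=\{[(x,s)]:x\in U\}$, $s\in S$, $U\subset D_s$ open. $\mathcal{G}_{tight}$ is the reduction of $\mathcal{G}$ to the invariant closed set $\widehat{E_{tight}}$. $C^*(\mathcal{G}_{tight})$ is the full groupoid $C^*$-algebra of this étale groupoid. *)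

(* Defs.v *)
From HB Require Import structures.
From mathcomp Require Import all_boot all_order all_algebra.
From mathcomp Require Import complex.
From mathcomp Require Import all_classical all_reals all_analysis.

Set Implicit Arguments.
Unset Strict Implicit.
Unset Printing Implicit Defensive.

Import Order.TTheory GRing.Theory Num.Theory.
Import numFieldNormedType.Exports.

Local Open Scope classical_set_scope.
Local Open Scope quotient_scope.
Local Open Scope ring_scope.

(* R[i] packed as a numClosedFieldType, which is what makes the norm and
   topology instances of numFieldNormedType apply to it. *)
Definition Cplx (R : realType) : numClosedFieldType := R[i].

HB.mixin Record isCStarAlgebra (R : realType) A
    of CompleteNormedModule (Cplx R) A := {
  cmul : A -> A -> A;
  adj : A -> A;
  cmulA : associative cmul;
  cmulDl : left_distributive cmul +%R;
  cmulDr : right_distributive cmul +%R;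
  cmulZl : forall (c : Cplx R) (x y : A), cmul (c *: x) y = c *: cmul x y;
  cmulZr : forall (c : Cplx R) (x y : A), cmul x (c *: y) = c *: cmul x y;
  adjK : involutive adj;
  adjD : {morph adj : x y / x + y};
  adjZ : forall (c : Cplx R) (x : A), adj (c *: x) = c^* *: adj x;
  adjM : forall x y : A, adj (cmul x y) = cmul (adj y) (adj x);
  norm_cmul : forall x y : A, `|cmul x y| <= `|x| * `|y|;
  cstar_identity : forall x : A, `|cmul (adj x) x| = `|x| ^+ 2
}.

#[short(type="cstarAlgType")]
HB.structure Definition CStarAlgebra (R : realType) :=
  {A of isCStarAlgebra R A & CompleteNormedModule (Cplx R) A}.

HB.mixin Record isUnitalCStar (R : realType) A of CStarAlgebra R A := {
  cone : A;
  cmul1x : left_id cone cmul;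
  cmulx1 : right_id cone cmul
}.

#[short(type="unitalCStarAlgType")]
HB.structure Definition UnitalCStarAlgebra (R : realType) :=
  {A of isUnitalCStar R A & CStarAlgebra R A}.

Declare Scope cstar_scope.
Delimit Scope cstar_scope with C.
Notation "x ** y" := (cmul x y)
  (at level 40, left associativity) : cstar_scope.
Notation "x ^*" := (adj x) : cstar_scope.

Local Open Scope cstar_scope.

Definition star_hom (R : realType) (A B : cstarAlgType R) (f : A -> B) : Prop :=
  [/\ linear f, {morph f : x y / x ** y} & {morph f : x / x^*}].

Definition cstar_isomorphic (R : realType) (A B : cstarAlgType R) : Prop :=
  exists2 f : A -> B, star_hom f & bijective f.

Definition lspan (K : pzRingType) (V : lmodType K) (X : set V) : set V :=
  [set v | exists n (c : 'I_n -> K) (w : 'I_n -> V),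
     (forall i, X (w i)) /\ v = \sum_(i < n) c i *: w i].

(* The equational presentation of inverse semigroups (here with a zero):
   regular *-semigroups in which the elements s s^* commute. By idem_star, the
   idempotents are then the projections. *)

Record inverse_semigroup := InverseSemigroup {
  isg_sort :> choiceType;
  imul : isg_sort -> isg_sort -> isg_sort;
  istar : isg_sort -> isg_sort;
  izero : isg_sort;
  imulA : associative imul;
  istarK : involutive istar;
  istarM : forall s t, istar (imul s t) = imul (istar t) (istar s);
  imul_regular : forall s, imul (imul s (istar s)) s = s;
  imul_projC : forall s t,
    imul (imul s (istar s)) (imul t (istar t)) =
    imul (imul t (istar t)) (imul s (istar s));
  imul0 : forall s, imul izero s = izero;
  imul_0 : forall s, imul s izero = izero
}.

Declare Scope isg_scope.
Delimit Scope isg_scope with I.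
Local Notation "s * t" := (imul s t) : isg_scope.
Local Notation "s ^*" := (istar s) : isg_scope.

Section InverseSemigroup.
Variable S : inverse_semigroup.
Implicit Types s t : S.
Local Open Scope isg_scope.

Lemma idem_star (e : S) : e * e = e -> e^* = e.
Proof.
move=> ee.
have h1 : (e^* * e) * (e * e^*) = e^*.
  rewrite imulA -(imulA _ e e) ee.
  by have := imul_regular (e^*); rewrite istarK.
have h2 : (e * e^*) * (e^* * e) = e.
  have ss : e^* * e^* = e^* by rewrite -istarM ee.
  by rewrite imulA -(imulA e) ss imul_regular.
by have := imul_projC (e^*) e; rewrite istarK h1 h2.
Qed.

Lemma idemC (e f : S) : e * e = e -> f * f = f -> e * f = f * e.
Proof.
move=> ee ff; have := imul_projC e f.
by rewrite (idem_star ee) (idem_star ff) ee ff.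
Qed.

Lemma idem_mul (e f : S) : e * e = e -> f * f = f -> (e * f) * (e * f) = e * f.
Proof.
move=> ee ff; rewrite -imulA (imulA f e) -(idemC ee ff) imulA imulA ee.
by rewrite -imulA ff.
Qed.

Lemma idem_proj s : (s * s^*) * (s * s^*) = s * s^*.
Proof. by rewrite imulA imul_regular. Qed.

Lemma idem_conj s (e : S) : e * e = e -> (s * e * s^*) * (s * e * s^*) = s * e * s^*.
Proof.
move=> ee; have := idem_proj (s * e).
suff -> : (s * e) * (s * e)^* = s * e * s^* by [].
by rewrite istarM (idem_star ee) imulA -(imulA s e e) ee.
Qed.

Lemma idem_zero : izero S * izero S = izero S.
Proof. exact: imul0. Qed.

Definition idempotents : set S := [set e | e * e = e].

Definition Idem (e : S) (ee : e * e = e) : idempotents := exist _ e (mem_set ee).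

Lemma idemP (e : idempotents) : sval e * sval e = sval e.
Proof. exact: set_mem (valP e). Qed.

Definition Emul (e f : idempotents) : idempotents :=
  Idem (idem_mul (idemP e) (idemP f)).
Definition Ezero : idempotents := Idem idem_zero.
Definition Eproj s : idempotents := Idem (idem_proj s).
Definition Econj s (e : idempotents) : idempotents := Idem (idem_conj s (idemP e)).

Definition is_character : set {ptws idempotents -> bool} :=
  [set x | [/\ exists e : idempotents, x e = true,
              forall e f : idempotents, x (Emul e f) = x e && x f & x Ezero = false]].

Definition character : Type := set_type is_character.
HB.instance Definition _ := Topological.copy character (set_type is_character).
Definition char_val (x : character) : idempotents -> bool := sval x.
Coercion char_val : character >-> Funclass.

Lemma charP (x : character) : is_character (x : idempotents -> bool).
Proof. exact: set_mem (valP x). Qed.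

Definition char_support (x : character) : set idempotents := [set e | x e].

Definition maximal_character : set character :=
  [set x | forall y : character,
     char_support x `<=` char_support y -> char_support x = char_support y].

Definition tight_character : set character := closure maximal_character.

Definition dom s : set character := [set x | x (Eproj s) = true].

Definition germ_pair : set (character * S) := [set p | dom p.2 p.1].

Lemma EqP (e f : idempotents) : sval e = sval f -> e = f.
Proof. by move=> ef; apply: val_inj. Qed.

Lemma act_subproof s (x : character) :
  dom s x -> is_character (fun e => x (Econj s e)).
Proof.
rewrite /dom /= => xs; have [_ xM x0] := charP x.
split.
- exists (Eproj s^*); rewrite -[RHS]xs; congr (x _); apply: EqP => /=.
  by rewrite istarK !imulA imul_regular.
- move=> e f; rewrite -xM; congr (x _); apply: EqP => /=.
  have h : s^* * s * sval f = sval f * (s^* * s).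
    by apply: idemC (idemP f); have := idem_proj s^*; rewrite istarK.
  have r : s^* * s * s^* = s^* by have := imul_regular s^*; rewrite istarK.
  have q : sval f * s^* = s^* * (s * (sval f * s^*)).
    by rewrite !imulA h -(imulA (sval f)) r.
  by rewrite -!imulA -q.
- rewrite -x0; congr (x _); apply: EqP => /=.
  by rewrite imul_0 imul0.
Qed.

(* x.s *)
Definition act s (x : character) (xs : dom s x) : character :=
  exist _ (fun e => x (Econj s e)) (mem_set (act_subproof xs)).

Definition germ_char (p : germ_pair) : character := (sval p).1.
Definition germ_elt (p : germ_pair) : S := (sval p).2.

Lemma germ_domP (p : germ_pair) : dom (germ_elt p) (germ_char p).
Proof. exact: set_mem (valP p). Qed.

Definition GermPair s x (xs : dom s x) : germ_pair :=
  exist _ (x, s) (mem_set (xs : germ_pair (x, s))).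

Definition germ_rel (p q : germ_pair) : bool :=
  `[< germ_char p = germ_char q /\
      exists2 e : idempotents, germ_char p e = true &
        sval e * germ_elt p = sval e * germ_elt q >].

Lemma germ_rel_refl : reflexive germ_rel.
Proof.
move=> p; apply/asboolP; split=> //.
by have [[e xe] _ _] := charP (germ_char p); exists e.
Qed.

Lemma germ_rel_sym : symmetric germ_rel.
Proof.
by move=> p q; apply/asboolP/asboolP => -[pq [e xe ee]]; split=> //;
   exists e; rewrite -?pq ?pq // -pq.
Qed.

Lemma germ_rel_trans : transitive germ_rel.
Proof.
move=> q p r /asboolP[pq [e xe ee]] /asboolP[qr [f xf ff]].
apply/asboolP; split; first by rewrite pq.
have [_ xM _] := charP (germ_char p).
exists (Emul e f); first by rewrite xM xe pq xf.
rewrite /= (idemC (idemP e) (idemP f)) -imulA ee imulA.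
by rewrite -(idemC (idemP e) (idemP f)) -imulA ff imulA.
Qed.

Canonical germ_equiv := EquivRel germ_rel germ_rel_refl germ_rel_sym germ_rel_trans.

Definition germ := {eq_quot germ_equiv}.
HB.instance Definition _ := Choice.on germ.
HB.instance Definition _ := EqQuotient.on germ.

Lemma germ_eqP (p q : germ_pair) : \pi_germ p = \pi_germ q <-> germ_rel p q.
Proof. by split=> [/eqmodP|] //; move=> ?; apply/eqmodP. Qed.

Definition theta s (U : set character) : set germ :=
  [set \pi_germ p | p in [set p : germ_pair | germ_elt p = s /\ U (germ_char p)]].

Definition germ_base : set (set germ) :=
  [set B | exists s U, [/\ open U, U `<=` dom s & B = theta s U]].

Lemma dom_open s : open (dom s).
Proof.
have -> : dom s = (fun x : character => sval x (Eproj s)) @^-1` [set true] by [].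
apply: open_comp; last exact: discrete_open.
move=> x _; apply: (@continuous_comp _ {ptws idempotents -> bool} _
  (fun x : character => sval x)
  (fun f : {ptws idempotents -> bool} => f (Eproj s))).
  exact: initial_continuous.
exact: proj_continuous.
Qed.

Lemma germ_base_cover : \bigcup_(B in germ_base) B = setT.
Proof.
apply/seteqP; split=> // g _; pose s := germ_elt (repr g).
exists (theta s (dom s)); first by exists s, (dom s); split=> //; exact: dom_open.
by exists (repr g); [split=> //; exact: germ_domP | rewrite reprK].
Qed.

Lemma Emul_true (x : character) e f : x (Emul e f) = x e && x f.
Proof. by have [_ ->] := charP x. Qed.

Lemma germ_base_join (A B : set germ) g : germ_base A -> germ_base B -> A g -> B g ->
  exists C, [/\ germ_base C, C g & C `<=` A `&` B].
Proof.
move=> [s [U [oU Us ->]]] [t [V [oV Vt ->]]] [p [ps Up] <-] [q [qt Vq]].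
move=> /germ_eqP/asboolP[qp [e xe es]].
have domE : forall x : character, x e = true -> dom s x -> dom (sval e * s) x.
  move=> x xe' xs; rewrite /dom /=.
  have -> : Eproj (sval e * s) = Emul e (Emul (Eproj s) e).
    by apply: EqP; rewrite /= istarM (idem_star (idemP e)) !imulA.
  by rewrite !Emul_true xe' xs.
have es' : sval e * s = sval e * t by rewrite -ps -qt es.
pose W := U `&` V `&` [set x : character | x e = true].
have Ws : W `<=` dom (sval e * s) by move=> x [[/Us ? _] ?]; exact: domE.
have Wp : W (germ_char p).
  by rewrite /W /= -{2 3}qp; split.
exists (theta (sval e * s) W); split.
- exists (sval e * s), W; split=> //; apply: openI; first exact: openI.
  have -> : [set x : character | x e = true] = dom (sval e).
    rewrite /dom; suff -> : Eproj (sval e) = e by [].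
    by apply: EqP; rewrite /= (idem_star (idemP e)) idemP.
  exact: dom_open.
- exists (GermPair (Ws _ Wp)) => //.
  apply/germ_eqP/asboolP; split=> //; exists e.
    by move: xe; rewrite qp.
  by rewrite /germ_elt/= -/(germ_elt p) imulA idemP ps.
- move=> _ [r [rs Wr] <-]; have [[Ur Vr] re] := Wr; split.
    exists (GermPair (Us _ Ur)) => //.
    apply/germ_eqP/asboolP; split=> //; exists e => //.
    by rewrite rs imulA idemP.
  exists (GermPair (Vt _ Vr)) => //.
  apply/germ_eqP/asboolP; split=> //; exists e => //.
  by rewrite rs imulA idemP es'.
Qed.

HB.instance Definition _ :=
  isBaseTopological.Build germ germ_base_cover germ_base_join.

Definition germ_act (p : germ_pair) : character := act (germ_domP p).

Definition pair_comp (p q : germ_pair) : Prop := germ_char q = germ_act p.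

(* (x, s)(y, t) = (x, st) when y = x.s; the default value p of insubd is only
   met on non-composable pairs. *)
Definition pair_mul (p q : germ_pair) : germ_pair :=
  insubd p (germ_char p, germ_elt p * germ_elt q).

Lemma pair_inv_subproof (p : germ_pair) : dom (germ_elt p)^* (germ_act p).
Proof.
have := germ_domP p; rewrite /dom /= => <-; congr (germ_char p _).
by apply: EqP; rewrite /= istarK !imulA imul_regular.
Qed.

Definition pair_inv (p : germ_pair) : germ_pair :=
  GermPair (pair_inv_subproof p).

Lemma pair_mulE (p q : germ_pair) : pair_comp p q ->
  germ_char (pair_mul p q) = germ_char p /\
  germ_elt (pair_mul p q) = germ_elt p * germ_elt q.
Proof.
move=> pq; rewrite /pair_mul.
have E : val (insubd p (germ_char p, germ_elt p * germ_elt q)) =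
    (germ_char p, germ_elt p * germ_elt q).
  apply: insubdK; apply: mem_set; rewrite /germ_pair /dom /=.
  rewrite -(germ_domP q) pq; congr (germ_char p _).
  by apply: EqP; rewrite /= istarM !imulA.
by rewrite /germ_char /germ_elt (congr1 fst E) (congr1 snd E).
Qed.

Lemma char_ext (x y : character) : (forall e, x e = y e) -> x = y.
Proof. by move=> xy; apply: val_inj; apply/funext. Qed.

Lemma pair_ext (p q : germ_pair) :
  germ_char p = germ_char q -> germ_elt p = germ_elt q -> p = q.
Proof.
case: p q => [[x s] xs] [[y t] yt]; rewrite /germ_char /germ_elt /= => xy st.
by apply: val_inj; rewrite /= xy st.
Qed.

Lemma germ_actE (p : germ_pair) e :
  germ_act p e = germ_char p (Econj (germ_elt p) e).
Proof. by []. Qed.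

Lemma act_mul (p q : germ_pair) : pair_comp p q ->
  germ_act (pair_mul p q) = germ_act q.
Proof.
move=> pq; have [cE eE] := pair_mulE pq.
apply: char_ext => e; rewrite !germ_actE cE pq germ_actE.
by congr (germ_char p _); apply: EqP; rewrite /= eE istarM !imulA.
Qed.

Lemma act_inv (p : germ_pair) : germ_act (pair_inv p) = germ_char p.
Proof.
apply: char_ext => e; rewrite germ_actE -[germ_char (pair_inv p)]/(germ_act p).
rewrite germ_actE -[germ_elt (pair_inv p)]/((germ_elt p)^*).
have -> : Econj (germ_elt p) (Econj (germ_elt p)^* e) =
    Emul (Eproj (germ_elt p)) (Emul e (Eproj (germ_elt p))).
  by apply: EqP; rewrite /= istarK !imulA.
by rewrite !Emul_true (germ_domP p) andbT.
Qed.

Lemma pair_invK (p : germ_pair) : pair_inv (pair_inv p) = p.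
Proof. by apply: pair_ext; [exact: act_inv | exact: istarK]. Qed.

Lemma act_rel (p q : germ_pair) : germ_rel p q -> germ_act p = germ_act q.
Proof.
move=> /asboolP[pq [e xe es]]; apply: char_ext => f.
have h (r : germ_pair) : germ_char r e = true ->
    germ_act r f = germ_char r (Econj (sval e * germ_elt r) f).
  move=> re; have -> : Econj (sval e * germ_elt r) f =
      Emul e (Emul (Econj (germ_elt r) f) e).
    by apply: EqP; rewrite /= istarM (idem_star (idemP e)) !imulA.
  by rewrite !Emul_true re andbT.
by rewrite !h -?pq // es.
Qed.

Lemma char_rel (p q : germ_pair) : germ_rel p q -> germ_char p = germ_char q.
Proof. by move=> /asboolP[]. Qed.

Lemma pair_mul_rel (p p' q q' : germ_pair) : pair_comp p q ->
  germ_rel p p' -> germ_rel q q' -> germ_rel (pair_mul p q) (pair_mul p' q').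
Proof.
move=> pq pp' qq'.
have pq' : pair_comp p' q'.
  by rewrite /pair_comp -(char_rel qq') -(act_rel pp').
have [c1 e1] := pair_mulE pq; have [c2 e2] := pair_mulE pq'.
have /asboolP[xx [e xe es]] := pp'; have /asboolP[yy [f yf ft]] := qq'.
apply/asboolP; rewrite c1 c2; split=> //.
exists (Emul e (Econj (germ_elt p) f)).
  by rewrite Emul_true xe; move: yf; rewrite pq.
rewrite e1 e2 /=; set s := germ_elt p in es *; set s' := germ_elt p' in es *.
set t := germ_elt q in ft *; set t' := germ_elt q' in ft *.
have hf : s * sval f * s^* * s = s * sval f.
  have ss : s^* * s * sval f = sval f * (s^* * s).
    by apply: idemC (idemP f); have := idem_proj s^*; rewrite istarK.
  by rewrite -!imulA -ss !imulA imul_regular.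
have eC := idemC (idemP e) (idem_conj s (idemP f)).
have -> : sval e * (s * sval f * s^*) * (s' * t') =
    sval e * (s * sval f * s^*) * (s * t').
  by rewrite eC -!imulA (imulA (sval e) s') -es !imulA.
have h r : sval e * (s * sval f * s^*) * (s * r) = sval e * s * (sval f * r).
  by rewrite -(imulA (sval e)) (imulA _ s r) hf !imulA.
by rewrite !h ft.
Qed.

Lemma pair_inv_rel (p q : germ_pair) :
  germ_rel p q -> germ_rel (pair_inv p) (pair_inv q).
Proof.
move=> pq; have /asboolP[xx [e xe es]] := pq.
apply/asboolP; split; first exact: act_rel.
rewrite -[germ_char (pair_inv p)]/(germ_act p).
rewrite -[germ_elt (pair_inv p)]/((germ_elt p)^*).
rewrite -[germ_elt (pair_inv q)]/((germ_elt q)^*).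
have sP := idem_proj (germ_elt p).
exists (Econj (germ_elt p)^* e).
  rewrite germ_actE; have -> : Econj (germ_elt p) (Econj (germ_elt p)^* e) =
      Emul (Eproj (germ_elt p)) (Emul e (Eproj (germ_elt p))).
    by apply: EqP; rewrite /= istarK !imulA.
  by rewrite !Emul_true xe (germ_domP p).
rewrite /= istarK; set s := germ_elt p in es sP *; set t := germ_elt q in es *.
have ts : s^* * sval e = t^* * sval e.
  by rewrite -{1}(idem_star (idemP e)) -istarM es istarM (idem_star (idemP e)).
have h r : r^* * sval e * r * r^* = r^* * sval e.
  rewrite -!imulA (idemC (idemP e) (idem_proj r)) imulA.
  by rewrite [r^* * _]imulA; have := imul_regular r^*; rewrite istarK => ->.
by rewrite h ts -(imulA (t^*)) es imulA h.
Qed.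

End InverseSemigroup.

(* Renault's axioms, on a topological space of arrows; the units are the
   arrows a a^-1. Continuity of the operations plays no part in the definition
   of C*(G) and is not recorded. *)

Record groupoid := Groupoid {
  arrow :> topologicalType;
  composable : arrow -> arrow -> Prop;
  gmul : arrow -> arrow -> arrow;
  ginv : arrow -> arrow;
  ginvK : involutive ginv;
  gmulA : forall a b c, composable a b -> composable b c ->
    [/\ composable (gmul a b) c, composable a (gmul b c) &
        gmul (gmul a b) c = gmul a (gmul b c)];
  gcompV : forall a, composable (ginv a) a;
  gmulKl : forall a b, composable a b -> gmul (ginv a) (gmul a b) = b;
  gmulKr : forall a b, composable b a -> gmul (gmul b a) (ginv a) = b
}.

Section Germs.
Variable S : inverse_semigroup.
Local Open Scope isg_scope.
Implicit Types a b c : germ S.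

Definition germ_comp a b : Prop := pair_comp (repr a) (repr b).
Definition germ_mul a b : germ S := \pi_(germ S) (pair_mul (repr a) (repr b)).
Definition germ_inv a : germ S := \pi_(germ S) (pair_inv (repr a)).

Lemma germ_repr (p : germ_pair (S := S)) : germ_rel (repr (\pi_(germ S) p)) p.
Proof. by apply/germ_eqP; rewrite reprK. Qed.

Lemma germ_compE (p q : germ_pair (S := S)) :
  germ_comp (\pi_(germ S) p) (\pi_(germ S) q) <-> pair_comp p q.
Proof.
by rewrite /germ_comp /pair_comp (char_rel (germ_repr q)) (act_rel (germ_repr p)).
Qed.

Lemma germ_mulE (p q : germ_pair (S := S)) : pair_comp p q ->
  germ_mul (\pi_(germ S) p) (\pi_(germ S) q) = \pi_(germ S) (pair_mul p q).
Proof.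
move=> pq; apply/germ_eqP; apply: pair_mul_rel (germ_repr p) (germ_repr q).
exact/germ_compE.
Qed.

Lemma germ_invE (p : germ_pair (S := S)) :
  germ_inv (\pi_(germ S) p) = \pi_(germ S) (pair_inv p).
Proof. by apply/germ_eqP/pair_inv_rel/germ_repr. Qed.

Lemma germ_invK : involutive germ_inv.
Proof.
move=> a; have h p : germ_inv (germ_inv (\pi_(germ S) p)) = \pi_(germ S) p.
  by rewrite !germ_invE pair_invK.
by have := h (repr a); rewrite reprK.
Qed.

Lemma pair_compM (p q : germ_pair (S := S)) r :
  pair_comp p q -> pair_comp q r -> pair_comp (pair_mul p q) r.
Proof. by rewrite /pair_comp => pq qr; rewrite (act_mul pq). Qed.

Lemma pair_comp_mul (p q : germ_pair (S := S)) r :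
  pair_comp p q -> pair_comp q r -> pair_comp p (pair_mul q r).
Proof. by rewrite /pair_comp => pq qr; rewrite (pair_mulE qr).1. Qed.

Lemma germ_mulA a b c : germ_comp a b -> germ_comp b c ->
  [/\ germ_comp (germ_mul a b) c, germ_comp a (germ_mul b c) &
      germ_mul (germ_mul a b) c = germ_mul a (germ_mul b c)].
Proof.
rewrite -(reprK a) -(reprK b) -(reprK c).
move: (repr a) (repr b) (repr c) => p q r /germ_compE pq /germ_compE qr.
have h1 := pair_compM pq qr; have h2 := pair_comp_mul pq qr.
rewrite (germ_mulE pq) (germ_mulE qr); split; [exact/germ_compE|exact/germ_compE|].
rewrite (germ_mulE h1) (germ_mulE h2); congr (\pi_(germ S) _).
have [c1 e1] := pair_mulE h1; have [c2 e2] := pair_mulE h2.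
have [c3 e3] := pair_mulE pq; have [c4 e4] := pair_mulE qr.
by apply: pair_ext; rewrite ?c1 ?c2 ?c3 ?e1 ?e2 ?e3 ?e4 ?imulA.
Qed.

Lemma pair_compV (p : germ_pair (S := S)) : pair_comp (pair_inv p) p.
Proof. by rewrite /pair_comp act_inv. Qed.

Lemma germ_compV a : germ_comp (germ_inv a) a.
Proof.
rewrite -(reprK a) germ_invE; apply/germ_compE; exact: pair_compV.
Qed.

Lemma germ_mulKl a b : germ_comp a b -> germ_mul (germ_inv a) (germ_mul a b) = b.
Proof.
rewrite -(reprK a) -(reprK b); move: (repr a) (repr b) => p q /germ_compE pq.
rewrite germ_invE (germ_mulE pq).
have h := pair_comp_mul (pair_compV p) pq.
rewrite (germ_mulE h); apply/germ_eqP/asboolP.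
have [-> ->] := pair_mulE h; have [_ ->] := pair_mulE pq.
split; first by rewrite pq.
exists (Eproj (germ_elt p)^*); first exact: (pair_inv_subproof p).
rewrite /= istarK -[germ_elt (pair_inv p)]/((germ_elt p)^*).
rewrite [_^* * (_ * _)]imulA imulA; congr (_ * _).
by have := idem_proj (germ_elt p)^*; rewrite istarK.
Qed.

Lemma germ_mulKr a b : germ_comp b a -> germ_mul (germ_mul b a) (germ_inv a) = b.
Proof.
rewrite -(reprK a) -(reprK b); move: (repr a) (repr b) => p q /germ_compE qp.
rewrite germ_invE (germ_mulE qp).
have h : pair_comp (pair_mul q p) (pair_inv p).
  by apply: pair_compM qp _; rewrite /pair_comp.
rewrite (germ_mulE h); apply/germ_eqP/asboolP.
have [-> ->] := pair_mulE h; have [-> ->] := pair_mulE qp.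
split=> //; rewrite -[germ_elt (pair_inv p)]/((germ_elt p)^*).
exists (Eproj (germ_elt q * germ_elt p)).
  rewrite -(germ_domP p) qp germ_actE; congr (germ_char q _).
  by apply: EqP; rewrite /= istarM !imulA.
rewrite /=; set s := germ_elt p; set t := germ_elt q.
have ts : t^* * t * (s * s^*) = s * s^* * (t^* * t).
  by apply: idemC (idem_proj s); have := idem_proj t^*; rewrite istarK.
have -> : t * s * (t * s)^* * (t * s * s^*) = t * (s * s^* * (t^* * t * (s * s^*))).
  by rewrite istarM !imulA.
by rewrite ts [X in t * X]imulA idem_proj istarM !imulA.
Qed.

Definition germ_groupoid : groupoid :=
  Groupoid germ_invK germ_mulA germ_compV germ_mulKl germ_mulKr.

(* A character x, as a unit, is the germ [(x, e)] for any idempotent e with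
   x(e) = 1. *)
Definition tight_units : set germ_groupoid :=
  [set \pi_(germ S) p | p in [set p : germ_pair (S := S) |
     idempotents (germ_elt p) /\ tight_character (germ_char p)]].

End Germs.

Section Reduction.
Variable G : groupoid.
Implicit Types a b c : G.

Definition grange a : G := gmul a (ginv a).
Definition gsource a : G := gmul (ginv a) a.

Lemma gcompVr a : composable a (ginv a).
Proof. by have := gcompV (ginv a); rewrite ginvK. Qed.

Lemma gsource_grange a b : composable a b -> gsource a = grange b.
Proof.
move=> ab; have [uab _ E] := gmulA (gcompV a) ab.
have [_ _ E'] := gmulA uab (gcompVr b).
have [_ _ F] := gmulA ab (gcompVr b).
have Er := gmulKr uab.
have abV : composable a (grange b) by have [] := gmulA ab (gcompVr b).
have El := gmulKl abV.
have [_ _ H] := gmulA (gcompV a) abV.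
by rewrite /gsource /grange -{1}Er E' H El.
Qed.

Lemma grangeM a b : composable a b -> grange (gmul a b) = grange a.
Proof.
move=> ab; have [_ h _] := gmulA (gcompV a) ab.
by rewrite -(gsource_grange h) /gsource ginvK.
Qed.

Lemma gsourceM a b : composable a b -> gsource (gmul a b) = gsource b.
Proof.
move=> ab; have [h _ _] := gmulA ab (gcompVr b).
by rewrite (gsource_grange h) /grange ginvK.
Qed.

Variable Y : set G.

Definition red_arrow : set G := [set a | Y (grange a) /\ Y (gsource a)].

Definition red_comp (a b : red_arrow) : Prop := composable (val a) (val b).
Definition red_mul (a b : red_arrow) : red_arrow :=
  insubd a (gmul (val a) (val b)).

Lemma red_inv_subproof (a : red_arrow) : red_arrow (ginv (val a)).
Proof.
have [Ya Yb] : red_arrow (val a) := set_mem (valP a).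
by split; rewrite /grange /gsource ginvK.
Qed.

Definition red_inv (a : red_arrow) : red_arrow :=
  exist _ (ginv (val a)) (mem_set (red_inv_subproof a)).

Lemma red_mulE (a b : red_arrow) : red_comp a b ->
  val (red_mul a b) = gmul (val a) (val b).
Proof.
move=> ab; apply: insubdK; apply: mem_set.
have [Ya _] : red_arrow (val a) := set_mem (valP a).
have [_ Yb] : red_arrow (val b) := set_mem (valP b).
by split; rewrite ?grangeM ?gsourceM.
Qed.

Lemma red_invK : involutive red_inv.
Proof. by move=> a; apply: val_inj; rewrite /= ginvK. Qed.

Lemma red_mulA (a b c : red_arrow) : red_comp a b -> red_comp b c ->
  [/\ red_comp (red_mul a b) c, red_comp a (red_mul b c) &
      red_mul (red_mul a b) c = red_mul a (red_mul b c)].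
Proof.
move=> ab bc; have [h1 h2 E] := gmulA ab bc.
have h1' : red_comp (red_mul a b) c by rewrite /red_comp red_mulE.
have h2' : red_comp a (red_mul b c) by rewrite /red_comp red_mulE.
by split=> //; apply: val_inj; rewrite !red_mulE.
Qed.

Lemma red_compV (a : red_arrow) : red_comp (red_inv a) a.
Proof. exact: gcompV. Qed.

Lemma red_mulKl (a b : red_arrow) :
  red_comp a b -> red_mul (red_inv a) (red_mul a b) = b.
Proof.
move=> ab; have [_ h _] := red_mulA (red_compV a) ab.
by apply: val_inj; rewrite red_mulE // red_mulE // gmulKl.
Qed.

Lemma red_mulKr (a b : red_arrow) :
  red_comp b a -> red_mul (red_mul b a) (red_inv a) = b.
Proof.
move=> ba; have aV : red_comp a (red_inv a) by exact: gcompVr.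
have [h _ _] := red_mulA ba aV.
by apply: val_inj; rewrite red_mulE // red_mulE // gmulKr.
Qed.

Definition reduction : groupoid :=
  Groupoid red_invK red_mulA red_compV red_mulKl red_mulKr.

End Reduction.

Definition tight_groupoid (S : inverse_semigroup) : groupoid :=
  reduction (@tight_units S).

Section GroupoidAlgebra.
Variables (R : realType) (G : groupoid).
Implicit Types f g : G -> Cplx R.

Definition bisection (U : set G) : Prop :=
  set_inj U (@grange G) /\ set_inj U (@gsource G).

Definition bisection_fun : set (G -> Cplx R) :=
  [set f | exists U K : set G,
     [/\ open U, bisection U, compact K, K `<=` U &
         {within U, continuous f} /\ forall x, ~ K x -> f x = 0]].

(* G need not be Hausdorff, so C_c(G) is the linear span of the C_c(U), U an
   open bisection; when G is Hausdorff this is the usual space. *)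
Definition Cc : set (G -> Cplx R) := lspan bisection_fun.

(* For f, g in C_c(G) the sum has finite support. *)
Definition convolution f g : G -> Cplx R := fun x =>
  \sum_(p \in [set p : G * G | composable p.1 p.2 /\ gmul p.1 p.2 = x])
    f p.1 * g p.2.

Definition involution f : G -> Cplx R := fun x => ((f (ginv x))^*)%R.

(* Only the values of pi on C_c(G) matter. *)
Definition Cc_star_hom (D : cstarAlgType R) (pi : (G -> Cplx R) -> D) : Prop :=
  [/\ forall c f g, Cc f -> Cc g -> pi (c *: f + g) = c *: pi f + pi g,
      forall f g, Cc f -> Cc g -> pi (convolution f g) = pi f ** pi g &
      forall f, Cc f -> pi (involution f) = (pi f)^*].

(* Representations take values in arbitrary C*-algebras D rather than in the
   algebras of bounded operators on Hilbert spaces; by Gelfand-Naimark the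
   supremum is the same. *)
Definition representation_norms f : set (Cplx R) :=
  [set r | exists (D : cstarAlgType R) (pi : (G -> Cplx R) -> D),
     Cc_star_hom pi /\ r = `|pi f|].

(* B is the completion of C_c(G) for the full norm, the supremum of the norms
   |pi(f)| over all representations pi *)
Definition is_groupoid_cstar (B : cstarAlgType R) : Prop :=
  exists iota : (G -> Cplx R) -> B,
    [/\ Cc_star_hom iota,
        closure (iota @` Cc) = setT &
        forall f, Cc f -> supremums (representation_norms f) `|iota f|].

End GroupoidAlgebra.

Section Groups.
Variable G : groupType.
Implicit Types K L M N H : set G.
Local Open Scope group_scope.

Definition subgroup K : Prop :=
  [/\ K 1, forall x y, K x -> K y -> K (x * y) & forall x, K x -> K x^-1].

Definition normal_in K L : Prop :=
  [/\ subgroup K, K `<=` L & forall l k, L l -> K k -> K (l * k * l^-1)].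

Definition semidirect_product N H : Prop :=
  [/\ normal_in N setT, subgroup H, N `&` H = [set 1] &
      [set n * h | n in N & h in H] = setT].

Definition conj_set (a : G) M : set G := [set a * m * a^-1 | m in M].

Definition lcosets M K : set (set G) := [set [set k * x | x in K] | k in M].

Definition finite_index K M : Prop := K `<=` M /\ finite_set (lcosets M K).

Definition Pmonoid H M : set G := [set a | H a /\ conj_set a M `<=` M].

End Groups.

Section Algebra.
Variables (R : realType) (G : groupType) (H M : set G).
Local Notation P := (Pmonoid H M).

Section Family.
Variables (A : unitalCStarAlgType R) (s u : G -> A).

Definition range_proj (a : G) : A := s a ** (s a)^*.

(* The last sum is over M/M_a with M_a = a M a^-1; xget 1 C is some k in the
   coset C, and the other relations make the summand independent of k. *)
Record relations : Prop := Relations {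
  rel_isometry : forall a, P a -> (s a)^* ** s a = cone;
  rel_unitary : forall m, M m ->
    (u m)^* ** u m = cone /\ u m ** (u m)^* = cone;
  rel_ss : forall a b, P a -> P b -> s a ** s b = s (a * b)%g;
  rel_uu : forall m n, M m -> M n -> u m ** u n = u (m * n)%g;
  rel_su : forall a m, P a -> M m -> s a ** u m = u (a * m * a^-1)%g ** s a;
  rel_sum : forall a, P a ->
    \sum_(C \in lcosets M (conj_set a M))
      (u (xget 1%g C) ** range_proj a ** (u (xget 1%g C))^*) = cone
}.

Definition is_projection (f : A) : Prop := f^* = f /\ f ** f = f.

(* u(k)^-1 = u(k)^* as u(k) is unitary *)
Definition Fset : set A :=
  [set f | is_projection f /\
           lspan [set u k ** range_proj b ** (u k)^* | k in M & b in P] f].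

Definition Tset : set A :=
  [set t | exists m m' a a' f, [/\ M m, M m', P a, P a' & Fset f /\
     t = (s a)^* ** u m ** f ** u m' ** s a']].

End Family.

(* s and u are only constrained on P and M; their other values are
   irrelevant. *)
Definition is_universal (A : unitalCStarAlgType R) (s u : G -> A) : Prop :=
  relations s u /\
  forall (B : unitalCStarAlgType R) (s' u' : G -> B), relations s' u' ->
    let induced (phi : A -> B) := [/\ star_hom phi, phi cone = cone,
      forall a, P a -> phi (s a) = s' a & forall m, M m -> phi (u m) = u' m] in
    exists! phi : A -> B, induced phi.

End Algebra.

Section PartialIsometries.
Variables (R : realType) (A : cstarAlgType R) (T : set A).

Record inverse_subsemigroup : Prop := InverseSubsemigroup {
  isub0 : T 0;
  isubM : forall x y, T x -> T y -> T (x ** y);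
  isubV : forall x, T x -> T x^*;
  isub_pisom : forall x, T x -> x ** x^* ** x = x;
  isub_projC : forall x y, T x -> T y ->
    x ** x^* ** (y ** y^*) = y ** y^* ** (x ** x^*)
}.

Hypothesis hT : inverse_subsemigroup.

Lemma memT (x : T) : T (val x).
Proof. exact: set_mem (valP x). Qed.

Definition Tmul (x y : T) : T :=
  exist _ (val x ** val y) (mem_set (isubM hT (memT x) (memT y))).
Definition Tstar (x : T) : T := exist _ (val x)^* (mem_set (isubV hT (memT x))).
Definition Tzero : T := exist _ 0 (mem_set (isub0 hT)).

Lemma TmulA : associative Tmul.
Proof. by move=> x y z; apply: val_inj; rewrite /= cmulA. Qed.
Lemma TstarK : involutive Tstar.
Proof. by move=> x; apply: val_inj; rewrite /= adjK. Qed.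
Lemma TstarM x y : Tstar (Tmul x y) = Tmul (Tstar y) (Tstar x).
Proof. by apply: val_inj; rewrite /= adjM. Qed.
Lemma Tregular x : Tmul (Tmul x (Tstar x)) x = x.
Proof. by apply: val_inj; rewrite /= (isub_pisom hT (memT x)). Qed.
Lemma TprojC x y : Tmul (Tmul x (Tstar x)) (Tmul y (Tstar y)) =
  Tmul (Tmul y (Tstar y)) (Tmul x (Tstar x)).
Proof. by apply: val_inj; exact: (isub_projC hT (memT x) (memT y)). Qed.
Lemma Tmul0 x : Tmul Tzero x = Tzero.
Proof.
apply: val_inj => /=; apply: (@addrI _ (0 ** val x)).
by rewrite -cmulDl !addr0.
Qed.
Lemma Tmul_0 x : Tmul x Tzero = Tzero.
Proof.
apply: val_inj => /=; apply: (@addrI _ (val x ** 0)).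
by rewrite -cmulDr !addr0.
Qed.

Definition isg_of : inverse_semigroup :=
  InverseSemigroup TmulA TstarK TstarM Tregular TprojC Tmul0 Tmul_0.

End PartialIsometries.

(* Main.v *)
(* The isomorphism is the identity: A itself is the completion of C_c(G_tight).

   The projections of T form a Boolean algebra, so a tight character is an
   ultrafilter, and the tight groupoid is covered by the compact open bisections
   theta(t), t in T. Every function in C_c is a finite sum of functions
   xi(r(g)) 1_{theta(t)}(g), and 1_{theta(t)} |-> t extends to a star
   homomorphism iota : C_c -> A: a relation between the functions 1_{theta(t)}
   holds, near each unit, between the corresponding elements of T, and finitely
   many neighbourhoods of units partition 1. No Hausdorff property is needed.
   The image of iota is dense because the closed subalgebra that it generates
   has the universal property of A.

   Given a representation pi of C_c in D, the elements pi(1_{theta(s_a)}) and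
   pi(1_{theta(u(m))}) satisfy the defining relations in the corner of D cut by
   pi(1), so there is a star homomorphism phi on A with phi o iota = pi. It is
   contractive, hence |pi(f)| <= |iota(f)|. *)
From HB Require Import structures.
From mathcomp Require Import all_boot all_order all_algebra.
From mathcomp Require Import finmap complex.
From mathcomp Require Import all_classical all_reals all_analysis.
From mathcomp Require Import ring lra.
Require Import Defs.

Set Implicit Arguments.
Unset Strict Implicit.
Unset Printing Implicit Defensive.

Import Order.TTheory GRing.Theory Num.Theory.
Import numFieldNormedType.Exports.

Local Open Scope classical_set_scope.
Local Open Scope ring_scope.
Local Open Scope cstar_scope.

Local Notation "r %:K" := (real_complex _ r) (at level 1, format "r %:K").
(* The adjoint; the notation of Defs is shadowed by complex conjugation in
   ring_scope. *)
Local Notation "x ^!" := (adj x) (format "x ^!").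

(** The only functional calculus is a square root of [1 - x] for self-adjoint [x] of norm below 1,
    found by iteration; completing self-adjoint contractions to unitaries yields contractivity and
    orthogonality. A first obstacle is that the relations give projections with sum 1 but not their
    orthogonality, on which all computations in F rest: it is recovered from norm estimates. The two
    conditions on H then supply common right multiples, which bring two projections to one level,
    and common left multiples, which make products in T possible. The study of germs uses only that
    T is an inverse semigroup of partial isometries that contains 1 and the complements of its
    idempotents. A second obstacle is to extend 1_{theta(t)} |-> t beyond the linear span of these
    functions. Functions in C_c are measured by the infimum of the total sup norm over their
    decompositions on sets theta(t). Every representation is bounded by this quantity, so [iota] is
    obtained by approximation, and representations are compared on the functions 1_{theta(t)} alone.
    The corner cut by pi(1) appears because a representation may be degenerate. *)

Section RealNorm.
Variable R : realType.

(* Norms live in the partially ordered field Cplx R; nrm and cabs are their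
   values in the totally ordered field R. *)
Definition nrm (V : normedModType (Cplx R)) (x : V) : R := complex.Re (`|x| : R[i]).

Lemma nrmE (V : normedModType (Cplx R)) (x : V) : `|x| = ((nrm x)%:K).
Proof. by rewrite /nrm RRe_real // normr_real. Qed.

Lemma lecR (x y : R) : ((x%:K) <= (y%:K) :> Cplx R) = (x <= y).
Proof. by rewrite lecE /= eqxx. Qed.

Lemma ltcR (x y : R) : ((x%:K) < (y%:K) :> Cplx R) = (x < y).
Proof. by rewrite ltcE /= eqxx. Qed.

Lemma gt0_real_complex (e : Cplx R) : 0 < e -> exists2 d : R, 0 < d & e = (d%:K).
Proof.
move=> e0; exists (complex.Re (e : R[i])); last by rewrite RRe_real // gtr0_real.
by move: e0; rewrite ltcE => /andP[].
Qed.

Section Normed.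
Variable V : normedModType (Cplx R).
Implicit Types x y : V.

Lemma nrm_ge0 x : 0 <= nrm x.
Proof. by rewrite -lecR -nrmE normr_ge0. Qed.

Lemma nrmD x y : nrm (x + y) <= nrm x + nrm y.
Proof. by rewrite -lecR rmorphD /= -!nrmE ler_normD. Qed.

Lemma nrmN x : nrm (- x) = nrm x.
Proof. by rewrite /nrm normrN. Qed.

Lemma nrmB x y : nrm (x - y) <= nrm x + nrm y.
Proof. by rewrite -(nrmN y) nrmD. Qed.

Lemma nrm0 : nrm (0 : V) = 0.
Proof. by rewrite /nrm normr0. Qed.

Lemma nrm0_eq0 x : nrm x = 0 -> x = 0.
Proof. by move=> x0; apply/normr0_eq0; rewrite nrmE x0. Qed.

Lemma nrm_distC x y : nrm (x - y) = nrm (y - x).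
Proof. by rewrite /nrm distrC. Qed.

Lemma nrm_sum (I : Type) (r : seq I) (P : pred I) (F : I -> V) :
  nrm (\sum_(i <- r | P i) F i) <= \sum_(i <- r | P i) nrm (F i).
Proof.
elim/big_ind2: _ => [|x a y b xa yb|//]; first by rewrite nrm0.
by apply: le_trans (nrmD _ _) _; apply: lerD.
Qed.

Lemma nrm_small_eq0 x : (forall e : R, 0 < e -> nrm x <= e) -> x = 0.
Proof.
move=> h; apply: nrm0_eq0; apply/eqP; rewrite eq_le nrm_ge0 andbT.
by apply/ler_addgt0Pr => e e0; rewrite add0r; exact: h.
Qed.

End Normed.

Definition cabs (c : Cplx R) : R := complex.Re (`|c| : R[i]).

Lemma cabsE (c : Cplx R) : `|c| = ((cabs c)%:K).
Proof. by rewrite /cabs RRe_real // normr_real. Qed.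

Lemma cabs_ge0 c : 0 <= cabs c.
Proof. by rewrite -lecR -cabsE normr_ge0. Qed.

Lemma cabsM c d : cabs (c * d) = cabs c * cabs d.
Proof. by apply: (@complexI R); rewrite rmorphM /= -!cabsE normrM. Qed.

Lemma cabsD c d : cabs (c + d) <= cabs c + cabs d.
Proof. by rewrite -lecR rmorphD /= -!cabsE ler_normD. Qed.

Lemma cabs_real (r : R) : cabs ((r%:K)) = `|r|.
Proof. by rewrite /cabs normc_def /= expr0n addr0 sqrtr_sqr. Qed.

Lemma cabs_real_ge0 (r : R) : 0 <= r -> cabs ((r%:K)) = r.
Proof. by move=> r0; rewrite cabs_real ger0_norm. Qed.

Lemma cabsC c : cabs (c^*)%R = cabs c.
Proof. by rewrite /cabs norm_conjC. Qed.

Lemma cabs0 : cabs 0 = 0. Proof. by rewrite /cabs normr0. Qed.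
Lemma cabs1 : cabs 1 = 1. Proof. by rewrite /cabs normr1. Qed.
Lemma cabsN c : cabs (- c) = cabs c. Proof. by rewrite /cabs normrN. Qed.

Lemma cabs_distC c d : cabs (c - d) = cabs (d - c).
Proof. by rewrite -cabsN opprB. Qed.

Lemma conj_mul_cabs c : (c^*)%R * c = (((cabs c) ^+ 2)%:K).
Proof. by rewrite mulrC -normCK cabsE rmorphXn. Qed.

Lemma nrmZ (V : normedModType (Cplx R)) (c : Cplx R) (x : V) :
  nrm (c *: x) = cabs c * nrm x.
Proof.
apply: (@complexI R); rewrite -nrmE rmorphM /= -nrmE -cabsE.
by rewrite normrZ.
Qed.

Lemma complete_seq (V : completeNormedModType (Cplx R)) (y : nat -> V) :
  (forall e : R, 0 < e -> exists N, forall n, (N <= n)%N -> nrm (y N - y n) <= e) ->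
  exists l, forall e : R, 0 < e -> exists N, forall n, (N <= n)%N -> nrm (y n - l) <= e.
Proof.
move=> Y; have /cauchy_cvg/cvg_ex[l yl] : cauchy (y @ \oo).
  apply: cauchy_exP => e /gt0_real_complex[d d0 ->].
  have [N NY] := Y (d / 2) ltac:(by rewrite divr_gt0).
  exists (y N), N => //= n /NY h.
  rewrite -ball_normE /ball_ /= nrmE ltcR.
  by apply: le_lt_trans h _; lra.
exists l => e e0; have /cvgrPdist_le/(_ (e%:K)) := yl.
rewrite ltcR => /(_ e0)[N _ h]; exists N => n /h /=.
by rewrite nrmE lecR nrm_distC.
Qed.

Lemma closureP_nrm (V : normedModType (Cplx R)) (X : set V) (x : V) :
  closure X x <-> forall e : R, 0 < e -> exists2 y, X y & nrm (x - y) <= e.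
Proof.
split=> [cX e e0|h B].
  have /cX[y [Xy By]] : nbhs x (ball x ((e%:K) : Cplx R)).
    by apply: nbhsx_ballx; rewrite ltcR.
  exists y => //; move: By; rewrite -ball_normE /ball_ /= nrmE ltcR; exact: ltW.
rewrite -nbhs_ballE => -[d /= /gt0_real_complex[e e0 ->] eB].
have [y Xy ye] := h (e / 2) ltac:(by rewrite divr_gt0).
exists y; split=> //; apply: eB; rewrite -ball_normE /ball_ /= nrmE ltcR.
by apply: le_lt_trans ye _; lra.
Qed.

End RealNorm.

(** * Elementary theory of C*-algebras *)

Section CStarBasics.
Variables (R : realType) (A : cstarAlgType R).
Implicit Types x y z e f p q : A.

Lemma cmul0x x : 0 ** x = 0.
Proof. by apply: (@addrI _ (0 ** x)); rewrite -cmulDl !addr0. Qed.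

Lemma cmulx0 x : x ** 0 = 0.
Proof. by apply: (@addrI _ (x ** 0)); rewrite -cmulDr !addr0. Qed.

Lemma cmulNl x y : (- x) ** y = - (x ** y).
Proof. by apply: (@addrI _ (x ** y)); rewrite -cmulDl !subrr cmul0x. Qed.

Lemma cmulNr x y : x ** (- y) = - (x ** y).
Proof. by apply: (@addrI _ (x ** y)); rewrite -cmulDr !subrr cmulx0. Qed.

Lemma cmulBl x y z : (x - y) ** z = x ** z - y ** z.
Proof. by rewrite cmulDl cmulNl. Qed.

Lemma cmulBr x y z : x ** (y - z) = x ** y - x ** z.
Proof. by rewrite cmulDr cmulNr. Qed.

Lemma cmul_suml (I : Type) (r : seq I) (P : pred I) (F : I -> A) y :
  (\sum_(i <- r | P i) F i) ** y = \sum_(i <- r | P i) F i ** y.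
Proof.
by apply: (big_morph (fun z => z ** y)) => [a b|]; rewrite ?cmulDl ?cmul0x.
Qed.

Lemma cmul_sumr (I : Type) (r : seq I) (P : pred I) (F : I -> A) y :
  y ** (\sum_(i <- r | P i) F i) = \sum_(i <- r | P i) y ** F i.
Proof.
by apply: (big_morph (fun z => y ** z)) => [a b|]; rewrite ?cmulDr ?cmulx0.
Qed.

Lemma adj0 : (0 : A)^! = 0.
Proof. by apply: (@addrI _ (0 : A)^!); rewrite -adjD !addr0. Qed.

Lemma adjN x : (- x)^! = - x^!.
Proof. by apply: (@addrI _ x^!); rewrite -adjD !subrr adj0. Qed.

Lemma adjB x y : (x - y)^! = x^! - y^!.
Proof. by rewrite adjD adjN. Qed.

Lemma adj_sum (I : Type) (r : seq I) (P : pred I) (F : I -> A) :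
  (\sum_(i <- r | P i) F i)^! = \sum_(i <- r | P i) (F i)^!.
Proof. by apply: (big_morph (@adj R A)) => [a b|]; rewrite ?adjD ?adj0. Qed.

Lemma nrmM x y : nrm (x ** y) <= nrm x * nrm y.
Proof. by rewrite -lecR rmorphM /= -!nrmE norm_cmul. Qed.

Lemma nrm_cstar x : nrm (x^! ** x) = nrm x ^+ 2.
Proof. by apply: (@complexI R); rewrite rmorphXn /= -!nrmE cstar_identity. Qed.

Lemma nrm_adj x : nrm x^! = nrm x.
Proof.
suff h (y : A) : nrm y <= nrm y^!.
  by apply/eqP; rewrite eq_le h andbT; have := h x^!; rewrite adjK.
have [->|y0] := eqVneq (nrm y) 0; first exact: nrm_ge0.
have y_gt0 : 0 < nrm y by rewrite lt_def y0 nrm_ge0.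
by rewrite -(ler_pM2r y_gt0) -expr2 -nrm_cstar nrmM.
Qed.

Lemma nrm_cstarV x : nrm (x ** x^!) = nrm x ^+ 2.
Proof. by rewrite -{1}(adjK x) nrm_cstar nrm_adj. Qed.

Lemma cstar_eq0 x : x^! ** x = 0 -> x = 0.
Proof.
move=> x0; apply: nrm0_eq0; apply/eqP; rewrite -sqrf_eq0 -nrm_cstar x0.
by rewrite nrm0.
Qed.

Definition isproj p : Prop := p^! = p /\ p ** p = p.

Lemma nrm_proj_le1 p : isproj p -> nrm p <= 1.
Proof.
move=> [pa pp]; have := nrm_cstar p; rewrite pa pp => E.
have [->//|p0] := eqVneq (nrm p) 0.
suff -> : nrm p = 1 by [].
by apply: (mulIf p0); rewrite mul1r -expr2.
Qed.

Lemma nrm_isom_le1 x p : x^! ** x = p -> isproj p -> nrm x <= 1.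
Proof.
move=> xx /nrm_proj_le1; rewrite -xx nrm_cstar.
by rewrite -[X in _ <= X](expr1n _ 2) ler_sqr ?nnegrE ?nrm_ge0.
Qed.

Lemma pisom_proj x : isproj (x ** x^!) -> x ** x^! ** x = x.
Proof.
(* With p the projection [x ** x^!], the product [w^! ** w] is p^3 - 2p^2 + p = 0; taking the
   adjoint first is what makes it a polynomial in p. *)
move=> [_ pp]; apply/subr0_eq; rewrite -(adjK (_ - _)); set w := (_ - _)^!.
suff -> : w = 0 by rewrite adj0.
apply: cstar_eq0; rewrite /w adjK adjB !adjM !adjK cmulBl !cmulBr.
by rewrite !cmulA in pp *; rewrite !pp !subrr.
Qed.

End CStarBasics.

(** * Geometric convergence and the square root of 1 - x *)

Section GeometricBounds.
Variable R : realType.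

Lemma geometric_small (q e : R) : 0 <= q -> q < 1 -> 0 < e -> exists n, q ^+ n <= e.
Proof.
move=> q0 q1 e0; have /cvgrPdist_le/(_ e e0)[N _ h] : q ^+ n @[n --> \oo] --> (0 : R).
  by apply: cvg_expr; rewrite ger0_norm.
exists N; have := h N (leqnn N).
by rewrite sub0r normrN normrX ger0_norm.
Qed.

Lemma geometric_seq_cvg (V : completeNormedModType (Cplx R)) (y : nat -> V) (q : R) :
  0 <= q -> q < 1 -> (forall n, nrm (y n.+1 - y n) <= q ^+ n) ->
  exists l, forall e : R, 0 < e -> exists N, forall n, (N <= n)%N -> nrm (y n - l) <= e.
Proof.
move=> q0 q1 Y; apply: complete_seq => e e0.
have q1' : 0 < 1 - q by rewrite subr_gt0.
have [N Ne] := geometric_small q0 q1 (mulr_gt0 e0 q1').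
exists N => n /subnKC <-; elim: (n - N)%N => [|k _]; first by rewrite addn0 subrr nrm0 ltW.
(* The partial geometric sum q^N + ... + q^(N+m-1), multiplied by 1 - q to keep the induction free
   of division. *)
suff h m : nrm (y N - y (N + m)%N) * (1 - q) <= q ^+ N * (1 - q ^+ m).
  rewrite -(ler_pM2r q1').
  apply: le_trans (h _) (le_trans _ Ne).
  by rewrite ler_piMr ?exprn_ge0 // gerBl exprn_ge0.
elim: m => [|m IH]; first by rewrite addn0 subrr nrm0 mul0r expr0 subrr mulr0.
have -> : y N - y (N + m.+1)%N = (y N - y (N + m)%N) + (y (N + m)%N - y (N + m).+1).
  by rewrite addrA subrK addnS.
have := nrmD (y N - y (N + m)%N) (y (N + m)%N - y (N + m).+1).
have := Y (N + m)%N; rewrite nrm_distC exprD exprS.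
move: IH; set a := nrm (_ - _); set b := nrm (_ - _); set c := nrm (_ + _).
move: a b c (q ^+ N) (q ^+ m) => a b c u v; nra.
Qed.

End GeometricBounds.

Section SquareRoot.
Variables (R : realType) (A : cstarAlgType R).
Implicit Types x y z e : A.

(** A continuity argument in the form of an estimate: the defect [g y0] of an identity at a limit
    point is bounded by a multiple of the distance to the points [w] where the identity is exact. *)
Lemma lim_bounded_eq0 (y0 : A) (g : A -> A) (C : R) :
  (forall e : R, 0 < e -> exists2 w : A, nrm (w - y0) <= e & nrm (g y0) <= C * nrm (w - y0)) ->
  g y0 = 0.
Proof.
move=> h; apply: nrm_small_eq0 => e e0.
have C1 : 0 < `|C| + 1 by rewrite ltr_wpDl.
have [w we gw] := h (e / (`|C| + 1)) (divr_gt0 e0 C1).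
apply: le_trans gw _; have w0 := nrm_ge0 (w - y0).
apply: le_trans (ler_wpM2r w0 (ler_norm C)) _.
apply: (@le_trans _ _ ((`|C| + 1) * nrm (w - y0))).
  by rewrite ler_wpM2r // lerDl.
by rewrite mulrC -ler_pdivlMr.
Qed.

(* With b = 1 - y the equation 2 y = x + y^2 reads b^2 = 1 - x, but it makes
   sense without a unit. *)
Lemma sqrt_one_minus x : x^! = x -> nrm x < 1 ->
  exists y, [/\ y^! = y, y + y = x + y ** y,
    forall z, z ** x = x ** z -> z ** y = y ** z & forall z, x ** z = x -> y ** z = y].
Proof.
move=> xa x1; set q := nrm x; have q0 : 0 <= q := nrm_ge0 x.
pose h : Cplx R := 2^-1.
have hh : h + h = 1 by rewrite /h -mulr2n -(mulr_natr 2^-1 2) mulVf // pnatr_eq0.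
have ch : cabs h = 2^-1.
  have -> : h = ((2^-1 : R)%:K) by rewrite /h fmorphV rmorphD rmorph1.
  by rewrite cabs_real_ge0 // invr_ge0.
(* The fixed-point form of the equation. [F] preserves the ball of radius q and contracts it with
   ratio q, so its iterates from 0 converge. *)
pose F y := h *: (x + y ** y).
pose y n := iter n F 0.
have yS n : y n.+1 = F (y n) by [].
have ya n : (y n)^! = y n.
  elim: n => [|n IH]; first exact: adj0.
  rewrite yS /F adjZ adjD adjM IH xa; congr (_ *: _).
  by rewrite /h fmorphV /= rmorph_nat.
have yq n : nrm (y n) <= q.
  elim: n => [|n IH]; first by rewrite nrm0.
  rewrite yS nrmZ ch.
  have := nrmD x (y n ** y n); have := nrmM (y n) (y n); rewrite -/q.
  have := nrm_ge0 (y n); move: IH; rewrite -/q in x1 *; nra.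
have dy n : nrm (y n.+1 - y n) <= q ^+ n.
  elim: n => [|n IH].
    rewrite /= /F subr0 cmul0x addr0 nrmZ ch expr0 -/q; rewrite -/q in x1; lra.
  (* Difference of squares without commutativity: a^2 - b^2 = a(a - b) + (a - b)b. *)
  have -> : y n.+2 - y n.+1 = h *: (y n.+1 ** (y n.+1 - y n) + (y n.+1 - y n) ** y n).
    rewrite (yS n.+1) {2}(yS n) /F -scalerBr; congr (_ *: _).
    by rewrite cmulBr cmulBl addrA subrK opprD addrACA subrr add0r.
  rewrite nrmZ ch exprS; apply: le_trans (ler_wpM2l _ (nrmD _ _)) _; first by rewrite invr_ge0.
  have := nrmM (y n.+1) (y n.+1 - y n); have := nrmM (y n.+1 - y n) (y n).
  have := yq n; have := yq n.+1.
  have := nrm_ge0 (y n.+1 - y n).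
  move: (nrm (_ - _)) IH (nrm (_ ** _)) (nrm (_ ** _)) (nrm (y n)) (nrm (y n.+1)) => d dn a b c c'.
  nra.
have [l yl] := geometric_seq_cvg q0 x1 dy.
have {}yl (e : R) : 0 < e -> exists2 n, nrm (y n - l) <= e & nrm (y n.+1 - l) <= e.
  by move=> /yl[N hN]; exists N; apply: hN.
(* Self-adjointness, commutation with [z] and absorption of [z] hold exactly for all iterates; [g]
   is the failure of such a property, bounded at [l] by the distance to the iterates. *)
have lim (g : A -> A) (C : R) : (forall n, nrm (g l) <= C * nrm (y n - l)) -> g l = 0.
  move=> gC; apply: (lim_bounded_eq0 (C := C)) => e /yl[n ne _].
  by exists (y n).
have la : l^! = l.
  apply/subr0_eq; apply: (lim (fun l => l^! - l) 2) => n.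
  have -> : l^! - l = (l^! - (y n)^!) + (y n - l) by rewrite ya addrA subrK.
  by apply: le_trans (nrmD _ _) _; rewrite -adjB nrm_adj nrm_distC mulr2n mulrDl mul1r.
have lq : nrm l <= q.
  apply/ler_addgt0Pr => e /yl[n ne _].
  have -> : l = y n - (y n - l) by rewrite opprB addrC subrK.
  by apply: le_trans (nrmB _ _) _; apply: lerD.
exists l; split=> //.
- have -> : x + l ** l = F l + F l by rewrite /F -scalerDl hh scale1r.
  suff lF : l - F l = 0 by rewrite -(subr0_eq lF).
  apply/nrm_small_eq0 => e e0.
  have [n ne nSe] := yl (e / 2) ltac:(by rewrite divr_gt0).
  have -> : l - F l = (l - y n.+1) + h *: (y n ** (y n - l) + (y n - l) ** l).
    rewrite yS /F cmulBr cmulBl addrA subrK -addrA; congr (_ + _).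
    rewrite addrC -scalerBr -scalerN; congr (_ *: _).
    rewrite (addrC x (y n ** _)) [X in _ = _ + X]opprD [RHS]addrA.
    by rewrite [X in _ = X - x]addrAC subrr add0r opprD addrC.
  apply: le_trans (nrmD _ _) _; rewrite nrmZ ch.
  have := nrmD (y n ** (y n - l)) ((y n - l) ** l).
  have := nrmM (y n) (y n - l); have := nrmM (y n - l) l; have := yq n.
  have := nrm_ge0 (y n - l); move: ne nSe lq; rewrite (nrm_distC (y n.+1)) -/q.
  set a := nrm (y n - l); set b := nrm (l - _); set c := nrm (_ + _).
  set d := nrm (_ ** _); set d' := nrm (_ ** _); move: (nrm l) (nrm (y n)) => m m'.
  move: a b c d d' => a b c d d'; rewrite -/q in x1 *; nra.
- move=> z zx; have zy n : z ** y n = y n ** z.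
    elim: n => [|n IH]; first by rewrite cmulx0 cmul0x.
    by rewrite yS /F cmulZr cmulZl cmulDl cmulDr zx cmulA IH -!cmulA IH.
  apply/subr0_eq; apply: (lim (fun l => z ** l - l ** z) (2 * nrm z)) => n.
  have -> : z ** l - l ** z = (y n - l) ** z - z ** (y n - l).
    by rewrite cmulBl cmulBr zy opprB [RHS]addrC addrA subrK.
  apply: le_trans (nrmB _ _) _.
  have := nrmM z (y n - l); have := nrmM (y n - l) z; lra.
- move=> z xz; have yz n : y n ** z = y n.
    elim: n => [|n IH]; first by rewrite cmul0x.
    by rewrite yS /F cmulZl cmulDl xz -cmulA IH.
  apply/subr0_eq; apply: (lim (fun l => l ** z - l) (nrm z + 1)) => n.
  have -> : l ** z - l = (y n - l) - (y n - l) ** z.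
    by rewrite cmulBl yz opprB [RHS]addrC addrA subrK.
  apply: le_trans (nrmB _ _) _; have := nrmM (y n - l) z; lra.
Qed.

End SquareRoot.

Lemma adj_cone (R : realType) (D : unitalCStarAlgType R) : (cone : D)^! = cone.
Proof. by rewrite -[LHS]cmul1x -{1}(adjK cone) -adjM cmul1x adjK. Qed.

(** * Star homomorphisms and their contractivity *)

Section StarHom.
Variables (R : realType) (A B : cstarAlgType R) (f : A -> B).
Hypothesis fS : star_hom f.

Lemma star_homD x y : f (x + y) = f x + f y.
Proof. by case: fS => fl _ _; have := fl 1 x y; rewrite !scale1r. Qed.

Lemma star_hom0 : f 0 = 0.
Proof. by apply: (@addrI _ (f 0)); rewrite -star_homD !addr0. Qed.

Lemma star_homZ c x : f (c *: x) = c *: f x.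
Proof. by case: fS => fl _ _; have := fl c x 0; rewrite star_hom0 !addr0. Qed.

Lemma star_homB x y : f (x - y) = f x - f y.
Proof. by rewrite star_homD -scaleN1r star_homZ scaleN1r. Qed.

Lemma star_hom_sum (I : Type) (r : seq I) (P : pred I) (F : I -> A) :
  f (\sum_(i <- r | P i) F i) = \sum_(i <- r | P i) f (F i).
Proof. by apply: (big_morph f) => [a b|]; rewrite ?star_homD ?star_hom0. Qed.

Lemma star_homM x y : f (x ** y) = f x ** f y.
Proof. by case: fS. Qed.

Lemma star_homV x : f x^! = (f x)^!.
Proof. by case: fS. Qed.

End StarHom.

Section Contractive.
Variable R : realType.

Lemma half_scale (V : lmodType (Cplx R)) (x y z : V) :
  x + y = z + z -> z = 2^-1 *: (x + y).
Proof. by move=> ->; rewrite -mulr2n -(scaler_nat 2 z) scalerA mulVf ?scale1r // pnatr_eq0. Qed.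

(** With w = y^2 and [e] acting as a unit on [y], the left side is (e - y)^2: the fixed-point
    equation says that e - y is a square root of e - x. *)
Lemma sub_sub_sqr (V : zmodType) (e y w x : V) :
  y + y = x + w -> e - y - (y - w) = e - x.
Proof.
move=> E; have -> : x = y + y - w by rewrite E addrK.
by rewrite !opprB opprD (AC (2*2)%AC (1*(3*(2*4)))%AC).
Qed.

Lemma cabs_half : cabs (2^-1 : Cplx R) = 2^-1.
Proof.
have -> : (2^-1 : Cplx R) = (2^-1 : R)%:K by rewrite fmorphV rmorphD rmorph1.
by rewrite cabs_real_ge0 // invr_ge0.
Qed.

Lemma cabs_i : cabs ('i : Cplx R) = 1.
Proof. by rewrite /cabs normCi. Qed.

(** [h] is the real part of [w]. *)
Lemma nrm_half_le (A : cstarAlgType R) (w h : A) (b : R) :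
  w + w^! = h + h -> nrm w <= b -> nrm h <= b.
Proof.
move=> /half_scale -> wb; rewrite nrmZ cabs_half.
have := nrmD w w^!; rewrite nrm_adj; lra.
Qed.

Lemma cartesian_mul (A : cstarAlgType R) (a c : A) :
  a^! = a -> c^! = c -> a ** c = c ** a ->
  (a + 'i *: c)^! ** (a + 'i *: c) = a ** a + c ** c.
Proof.
move=> aa cc ac; rewrite adjD Defs.adjZ conjCi aa cc scaleNr cmulBl !cmulDr !cmulZl !cmulZr ac.
rewrite scalerA -expr2 sqrCi scaleN1r opprD opprK.
by rewrite (AC (2*2)%AC (1*4*2*3)%AC) /= addrK.
Qed.

Lemma cartesian_add (A : cstarAlgType R) (a c : A) :
  a^! = a -> c^! = c -> (a + 'i *: c) + (a + 'i *: c)^! = a + a.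
Proof.
by move=> aa cc; rewrite adjD Defs.adjZ conjCi aa cc scaleNr addrACA subrr addr0.
Qed.

Lemma cartesian_sub (A : cstarAlgType R) (a c : A) :
  a^! = a -> c^! = c -> (a + 'i *: c) - (a + 'i *: c)^! = 'i *: (c + c).
Proof.
move=> aa cc; rewrite adjD Defs.adjZ conjCi aa cc scaleNr opprD opprK addrACA subrr.
by rewrite add0r scalerDr.
Qed.

(* A self-adjoint a with |a| < 1 is the real part of a unitary a + i c,
   c^2 = 1 - a^2, and a unital star homomorphism preserves unitaries. *)
Lemma star_hom_contractive (A B : unitalCStarAlgType R) (f : A -> B) :
  star_hom f -> f cone = cone -> forall x, nrm (f x) <= nrm x.
Proof.
move=> fS f1.
have unit_ball a : a^! = a -> nrm a < 1 -> nrm (f a) <= 1.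
  move=> aa a1; have xa : (a ** a)^! = a ** a by rewrite adjM aa.
  have x1 : nrm (a ** a) < 1.
    by rewrite -{1}aa nrm_cstar expr_lt1 ?nrm_ge0.
  have [y [ya yx yC _]] := sqrt_one_minus xa x1.
  pose c := cone - y; have cc : c^! = c by rewrite adjB adj_cone ya.
  have ac : a ** c = c ** a.
    by rewrite cmulBl cmulBr cmul1x cmulx1 yC // cmulA.
  have c2 : c ** c = cone - a ** a.
    by rewrite cmulBl !cmulBr !cmul1x cmulx1; apply: sub_sub_sqr.
  have := cartesian_mul aa cc ac; rewrite c2 (addrC (a ** a)) subrK => w1.
  have := congr1 f w1; rewrite (star_homM fS) (star_homV fS) f1 => fw.
  have fa : f (a + 'i *: c) + (f (a + 'i *: c))^! = f a + f a.
    by rewrite -(star_homV fS) -!(star_homD fS) cartesian_add.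
  apply: nrm_half_le fa _.
  by apply: nrm_isom_le1 fw _; split; rewrite ?adj_cone ?cmul1x.
have sa a : a^! = a -> nrm (f a) <= nrm a.
  move=> aa; apply/ler_addgt0Pr => e e0.
  (* The slack [e] puts a/t strictly inside the unit ball, where the square root exists. *)
  set t := nrm a + e; have t0 : 0 < t by rewrite ltr_wpDl ?nrm_ge0.
  have ct : cabs (t^-1)%:K = t^-1 by rewrite cabs_real_ge0 // invr_ge0 ltW.
  have : nrm (f ((t^-1)%:K *: a)) <= 1.
    apply: unit_ball.
      by rewrite Defs.adjZ aa; congr (_ *: _); rewrite /= conj_Creal // complex_real.
    by rewrite nrmZ ct mulrC ltr_pdivrMr // mul1r ltrDl.
  by rewrite (star_homZ fS) nrmZ ct mulrC ler_pdivrMr // mul1r.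
move=> x; rewrite -ler_sqr ?nnegrE ?nrm_ge0 // -!nrm_cstar -(star_homV fS) -(star_homM fS).
by apply: sa; rewrite adjM adjK.
Qed.

End Contractive.

(** * Finite families of projections: orthogonality and norms *)

Section Orthogonality.
Variable R : realType.

(** A projection is an extreme point of the unit ball of its corner. Averaging the squares of e + j
    and e - j gives |e + j^2| <= 1, which is impossible for a nonzero self-adjoint j; a square root
    of e - t^2 (e + j^2), with t < 1, makes this quantitative. *)
Lemma antipodal_eq0 (A : cstarAlgType R) (e j : A) :
  isproj e -> j^! = j -> e ** j = j -> nrm (e + j) <= 1 -> nrm (e - j) <= 1 -> j = 0.
Proof.
move=> [ea ee] ja ej h1 h2; have je : j ** e = j by rewrite -{1}ja -{1}ea -adjM ej.
have h3 : nrm (e + j ** j) <= 1.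
  have E : (e + j) ** (e + j) + (e - j) ** (e - j) = (e + j ** j) + (e + j ** j).
    rewrite !cmulDl !cmulDr !cmulNl !cmulNr ee ej je opprK.
    by rewrite [LHS](AC ((2*2)*(2*2))%AC (((1*4)*(5*8))*((2*6)*(3*7)))%AC) /= !subrr !addr0.
  rewrite (half_scale E) nrmZ cabs_half.
  have := nrmD ((e + j) ** (e + j)) ((e - j) ** (e - j)).
  have := nrmM (e + j) (e + j); have := nrmM (e - j) (e - j).
  have := nrm_ge0 (e + j); have := nrm_ge0 (e - j); nra.
apply: nrm0_eq0; apply/eqP; apply: contraT => j0; set n := nrm j in j0 *.
have n0 : 0 < n by rewrite lt_def j0 nrm_ge0.
(* The bound fails for t close to 1: with d = n^2 / (4(1 + n^2)) and t = 1 - d, one has t^2 (1 +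
   n^2) > (1 - 2d)(1 + n^2) = 1 + n^2/2. *)
suff key (t : R) : 0 < t -> t < 1 -> t ^+ 2 * n ^+ 2 <= 1 - t ^+ 2.
  have d0 : 0 < n ^+ 2 / (4 * (1 + n ^+ 2)) by apply: divr_gt0; nra.
  have d1 : n ^+ 2 / (4 * (1 + n ^+ 2)) * (4 * (1 + n ^+ 2)) = n ^+ 2.
    by rewrite divfK // gt_eqF //; nra.
  move: d0 d1; set d := _ / _ => d0 d1.
  have := key (1 - d); nra.
move=> t0 t1; set x := (t ^+ 2)%:K *: (e + j ** j).
have rC (r : R) : ((r%:K : Cplx R)^*)%R = r%:K by rewrite conj_Creal // complex_real.
have xa : x^! = x by rewrite Defs.adjZ rC adjD adjM ja ea.
have ct : cabs (t ^+ 2)%:K = t ^+ 2 by rewrite cabs_real_ge0 // exprn_ge0 // ltW.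
have x1 : nrm x < 1 by rewrite nrmZ ct; nra.
have [y [ya yx yC ye]] := sqrt_one_minus xa x1.
have {}ye : y ** e = y by apply: ye; rewrite cmulZl cmulDl ee -cmulA je.
have ey : e ** y = y by rewrite -{1}ya -{1}ea -adjM ye ya.
have jy : j ** y = y ** j.
  by apply: yC; rewrite cmulZl cmulZr cmulDl cmulDr ej je cmulA.
(* c^2 = e - x and d^2 = t^2 j^2 add up to (1 - t^2) e. Hence c + i d has norm at most sqrt(1 -
   t^2), and so has its imaginary part d. *)
pose c := e - y; pose d := t%:K *: j.
have cc : c^! = c by rewrite adjB ea ya.
have dd : d^! = d by rewrite Defs.adjZ rC ja.
have cd : c ** d = d ** c by rewrite cmulZl cmulZr cmulBl cmulBr ej je jy.
have c2 : c ** c = e - x.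
  by rewrite cmulBl !cmulBr ee ye ey; apply: sub_sub_sqr.
have d2 : d ** d = (t ^+ 2)%:K *: (j ** j) by rewrite cmulZl cmulZr scalerA -rmorphM -expr2.
have := cartesian_mul cc dd cd.
rewrite c2 d2 /x scalerDr opprD addrA subrK -{1}[e]scale1r -scalerBl => w2.
have wn : nrm (c + 'i *: d) ^+ 2 <= 1 - t ^+ 2.
  rewrite -nrm_cstar w2 nrmZ.
  have -> : (1 - (t ^+ 2)%:K : Cplx R) = (1 - t ^+ 2)%:K by rewrite rmorphB rmorph1.
  have t2 : 0 <= 1 - t ^+ 2 by nra.
  by rewrite cabs_real_ge0 // ler_piMr // (nrm_proj_le1 (conj ea ee)).
have nd : nrm d = t * n by rewrite nrmZ cabs_real_ge0 // ltW.
have : nrm d <= nrm (c + 'i *: d).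
  have := cartesian_sub cc dd => /(congr1 (@nrm R _)).
  rewrite nrmZ cabs_i mul1r -mulr2n -(scaler_nat 2 d) nrmZ.
  have -> : (2%:R : Cplx R) = (2 : R)%:K by rewrite rmorphD rmorph1.
  rewrite cabs_real_ge0 // => E.
  have := nrmB (c + 'i *: d) (c + 'i *: d)^!; rewrite nrm_adj E; lra.
rewrite nd; move: wn; move: (nrm (c + _)) => w.
have := mulr_gt0 t0 n0; nra.
Qed.

(** Compression by e = p_i leaves elements e p_l e, l different from i, of sum 0, and positivity
    would make each vanish. Norms replace positivity: with m further indices, e + h_j/(m+1) and e -
    h_j/(m+1) lie in the unit ball, so [antipodal_eq0] gives h_j = 0, that is p_j e = 0 by the
    C*-identity. *)
Lemma proj_sum_orth (A : unitalCStarAlgType R) (I : eqType) (r : seq I) (p : I -> A) :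
  uniq r -> (forall i, i \in r -> isproj (p i)) -> \sum_(i <- r) p i = cone ->
  forall i j, i \in r -> j \in r -> i != j -> p i ** p j = 0.
Proof.
move=> ur pP p1 i j ir jr ij; set e := p i; have [ea ee] := pP i ir.
pose h l := e ** p l ** e.
have ha l : l \in r -> (h l)^! = h l.
  by move=> /pP[la ll]; rewrite /h !adjM la ea cmulA.
have h1 l : l \in r -> nrm (e - h l) <= 1.
  move=> /pP[la ll]; have -> : e - h l = e ** (cone - p l) ** e.
    by rewrite cmulBr cmulBl cmulx1 ee.
  have q1 : nrm (cone - p l) <= 1.
    apply: nrm_proj_le1; split; first by rewrite adjB la adj_cone.
    by rewrite cmulBl !cmulBr !cmul1x cmulx1 ll subrr subr0.
  have e1 : nrm e <= 1 by apply: nrm_proj_le1.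
  have := nrmM (e ** (cone - p l)) e; have := nrmM e (cone - p l).
  have := nrm_ge0 e; have := nrm_ge0 (cone - p l); have := nrm_ge0 (e ** (cone - p l)); nra.
have ir' : perm_eq r (i :: j :: rem j (rem i r)).
  apply: perm_trans (perm_to_rem ir) _; rewrite perm_cons; apply: perm_to_rem.
  by rewrite mem_rem_uniq // inE eq_sym ij.
set r' := rem j _ in ir'.
have hs : h j + \sum_(l <- r') h l = 0.
  have : \sum_(l <- r) h l = e.
    by rewrite -cmul_suml -cmul_sumr p1 cmulx1 ee.
  rewrite (perm_big _ ir') /= !big_cons /h !ee => E.
  by apply: (@addrI _ e); rewrite addr0.
have r'r l : l \in r' -> l \in r by move=> lr; rewrite (perm_mem ir') !inE lr !orbT.
set m := size r'.
(* By [hs], h_j is minus a sum of m terms h_l, and each e - h_l is the compression of a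
   projection. *)
have b1 : nrm (e *+ m + h j) <= m%:R.
  have -> : e *+ m + h j = \sum_(l <- r') (e - h l).
    have -> : h j = - \sum_(l <- r') h l by apply/eqP; rewrite -addr_eq0 hs.
    by rewrite sumrB big_const_seq count_predT iter_addr addr0.
  apply: le_trans (nrm_sum _ _ _) _; rewrite big_seq.
  apply: le_trans (ler_sum _ (fun l lr => h1 l (r'r l lr))) _.
  by rewrite -big_seq big_const_seq count_predT iter_addr addr0.
have e1 : nrm e <= 1 by apply: nrm_proj_le1.
pose t : Cplx R := (m.+1%:R^-1 : R)%:K.
have tm : t *: (e *+ m.+1) = e.
  rewrite -scaler_nat scalerA /t fmorphV /= rmorph_nat mulVf ?scale1r //.
have ct : cabs t = m.+1%:R^-1 by rewrite cabs_real_ge0 // invr_ge0.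
have m0 : 0 < m.+1%:R :> R by rewrite ltr0n.
have ee' : isproj e by [].
have th0 : t *: h j = 0.
  apply: (antipodal_eq0 ee').
  - by rewrite Defs.adjZ ha //; congr (_ *: _); rewrite conj_Creal // complex_real.
  - by rewrite cmulZr /h !cmulA ee.
  - rewrite -{1}tm -scalerDr nrmZ ct mulrC ler_pdivrMr // mul1r mulrSr addrAC.
    by apply: le_trans (nrmD _ _) _; rewrite -natr1 lerD.
  - rewrite -{1}tm -scalerBr nrmZ ct mulrC ler_pdivrMr // mul1r mulrSr -addrA.
    apply: le_trans (nrmD _ _) _; rewrite -natr1 lerD ?h1 //.
    elim: (m) => [|k IH]; first by rewrite nrm0.
    by rewrite mulrSr -natr1; apply: le_trans (nrmD _ _) _; exact: lerD.
have h0 : h j = 0.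
  by apply: nrm0_eq0; have := congr1 (@nrm R A) th0; rewrite nrmZ ct nrm0 => /eqP;
     rewrite mulf_eq0 invr_eq0 pnatr_eq0 /= => /eqP.
have [ja jj] := pP j jr.
have pe0 : p j ** e = 0.
  by apply: cstar_eq0; rewrite adjM ja ea !cmulA -(cmulA e) jj.
by rewrite -(adjK (e ** _)) adjM ja ea pe0 adj0.
Qed.

(** The C*-identity replaces the coefficients by their squared moduli. Divided by t^2 these lie in
    [0, 1], so they are real parts of numbers of modulus 1, which are the coefficients of a partial
    isometry [w]. Working with t = b + eps admits b = 0. *)
Lemma nrm_orth_sum (A : cstarAlgType R) (I : finType) (e : I -> A) (c : I -> Cplx R) (b : R) :
  (forall i, isproj (e i)) -> (forall i j, i != j -> e i ** e j = 0) ->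
  (forall i, cabs (c i) <= b) -> 0 <= b -> nrm (\sum_i c i *: e i) <= b.
Proof.
move=> eP eO cb b0; apply/ler_addgt0Pr => eps eps0; set t := b + eps.
have t0 : 0 < t by rewrite ltr_wpDl.
have mulE (d d' : I -> Cplx R) :
    (\sum_i d i *: e i) ** (\sum_i d' i *: e i) = \sum_i (d i * d' i) *: e i.
  rewrite cmul_suml; apply: eq_bigr => i _; rewrite cmul_sumr (bigD1 i) //= big1 ?addr0.
    by rewrite cmulZl cmulZr (eP i).2 scalerA.
  by move=> j ji; rewrite cmulZl cmulZr eO ?scaler0 // eq_sym.
have adjE (d : I -> Cplx R) : (\sum_i d i *: e i)^! = \sum_i (d i)^*%R *: e i.
  by rewrite adj_sum; apply: eq_bigr => i _; rewrite Defs.adjZ (eP i).1.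
pose q i := (cabs (c i) / t) ^+ 2.
have q01 i : 0 <= q i <= 1.
  rewrite /q sqr_ge0 expr_le1 //= ?divr_ge0 ?cabs_ge0 ?(ltW t0) //.
  by rewrite ler_pdivrMr // mul1r; apply: le_trans (cb i) _; rewrite lerDl ltW.
pose w := \sum_i ((q i)%:K + 'i * (Num.sqrt (1 - q i ^+ 2))%:K) *: e i.
have conjE (x y : R) : (((x%:K : Cplx R) + 'i * y%:K)^*)%R = x%:K - 'i * y%:K.
  by rewrite rmorphD rmorphM /= conjCi !conj_Creal ?complex_real // mulNr.
have w1 : w^! ** w = \sum_i 1 *: e i.
  rewrite adjE mulE; apply: eq_bigr => i _; congr (_ *: _); rewrite conjE.
  have /andP[q0 q1] := q01 i.
  rewrite -subr_sqr exprMn sqrCi mulN1r opprK -!rmorphXn /= -rmorphD sqr_sqrtr.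
    by rewrite addrC subrK rmorph1.
  by rewrite subr_ge0 expr_le1.
have nw : nrm w <= 1.
  apply: nrm_isom_le1 w1 _; split.
    by rewrite adjE; apply: eq_bigr => i _; rewrite rmorph1.
  by rewrite mulE; apply: eq_bigr => i _; rewrite mulr1.
have h : nrm (\sum_i (q i)%:K *: e i) <= 1.
  apply: (nrm_half_le (w := w)) nw; rewrite /w adjE -!big_split /=; apply: eq_bigr => i _.
  by rewrite -!scalerDl conjE addrACA subrr addr0.
rewrite -ler_sqr ?nnegrE ?nrm_ge0 ?(ltW t0) // -nrm_cstar adjE mulE.
have -> : \sum_i ((c i)^*%R * c i) *: e i = (t ^+ 2)%:K *: \sum_i (q i)%:K *: e i.
  rewrite scaler_sumr; apply: eq_bigr => i _; rewrite scalerA conj_mul_cabs -rmorphM /=.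
  by rewrite /q exprMn exprVn mulrCA mulfV ?mulr1 // gt_eqF // exprn_gt0.
rewrite nrmZ cabs_real_ge0 ?sqr_ge0 // -[leRHS]mulr1 ler_wpM2l ?sqr_ge0 //.
Qed.

End Orthogonality.

(** * Closed star subalgebras *)

Record closed_starsubalg (R : realType) (A : cstarAlgType R) (X : set A) : Prop := {
  csub_linear : forall c x y, X x -> X y -> X (c *: x + y);
  csub_mul : forall x y, X x -> X y -> X (x ** y);
  csub_adj : forall x, X x -> X x^!;
  csub_closed : closed X;
  csub_zero : X 0
}.

Section Subalgebra.
Variables (R : realType) (A : cstarAlgType R) (X : set A).
Hypothesis hX : closed_starsubalg X.

(** The proof is an argument of the predicate so that the structures attached to the subtype can be
    inferred from its type. *)
Definition subalg_pred of closed_starsubalg X : {pred A} := mem X.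
Local Notation XP := (subalg_pred hX).

Lemma subalg_submod_closed : submod_closed XP.
Proof.
split; first by rewrite inE; exact: csub_zero hX.
by move=> c x y; rewrite !inE => Xx Xy; apply: (csub_linear hX).
Qed.
HB.instance Definition _ := GRing.isSubmodClosed.Build (Cplx R) A XP subalg_submod_closed.

Definition subalg : Type := {x : A | XP x}.
HB.instance Definition _ := [isSub of subalg for @sval A XP].
HB.instance Definition _ := [Choice of subalg by <:].
HB.instance Definition _ := [SubChoice_isSubLmodule of subalg by <:].

Definition subalg_norm (x : subalg) : Cplx R := `|val x|.
Lemma subalg_normD (x y : subalg) : subalg_norm (x + y) <= subalg_norm x + subalg_norm y.
Proof. exact: ler_normD. Qed.
Lemma subalg_normZ (c : Cplx R) (x : subalg) : subalg_norm (c *: x) = `|c| * subalg_norm x.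
Proof. exact: normrZ. Qed.
Lemma subalg_norm0_eq0 (x : subalg) : subalg_norm x = 0 -> x = 0.
Proof. by move/normr0_eq0 => x0; apply: val_inj; rewrite x0. Qed.

HB.instance Definition _ :=
  Lmodule_isNormed.Build (Cplx R) subalg subalg_normD subalg_normZ subalg_norm0_eq0.

Lemma subalg_complete (F : set_system subalg) : ProperFilter F -> cauchy F -> cvg F.
Proof.
move=> FF /cauchyP Fc.
have /cauchy_cvg/cvg_ex[l Fl] : cauchy (val @ F : set_system A).
  apply: cauchy_exP => e e0; have [x Fx] := Fc e e0.
  exists (val x); have FB : F (ball x e) := Fx.
  have sub : ball x e `<=` val @^-1` ball (val x) e by move=> y; rewrite -!ball_normE.
  exact: filterS sub FB.
have Xl : X l.
  apply: (csub_closed hX) => B /Fl FB; have {}FB : F (val @^-1` B) := FB.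
  have [x Bx] := filter_ex FB.
  by exists (val x); split=> //; have := valP x; rewrite inE.
apply/cvg_ex; exists (exist _ l (mem_set Xl) : subalg).
move/cvgrPdist_lt: Fl => Fl; apply/cvgrPdist_lt => e /Fl.
apply: filterS => x; exact.
Qed.

HB.instance Definition _ := Uniform_isComplete.Build subalg subalg_complete.

Lemma subalgP (x : subalg) : X (val x).
Proof. by have := valP x; rewrite inE. Qed.

Definition subalg_mul (x y : subalg) : subalg :=
  exist _ (val x ** val y) (mem_set (csub_mul hX (subalgP x) (subalgP y))).
Definition subalg_adj (x : subalg) : subalg :=
  exist _ (val x)^! (mem_set (csub_adj hX (subalgP x))).

Lemma subalg_mulA : associative subalg_mul.
Proof. by move=> x y z; apply: val_inj; rewrite /= cmulA. Qed.
Lemma subalg_mulDl : left_distributive subalg_mul +%R.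
Proof. by move=> x y z; apply: val_inj; rewrite /= cmulDl. Qed.
Lemma subalg_mulDr : right_distributive subalg_mul +%R.
Proof. by move=> x y z; apply: val_inj; rewrite /= cmulDr. Qed.
Lemma subalg_mulZl (c : Cplx R) x y : subalg_mul (c *: x) y = c *: subalg_mul x y.
Proof. by apply: val_inj; rewrite /= cmulZl. Qed.
Lemma subalg_mulZr (c : Cplx R) x y : subalg_mul x (c *: y) = c *: subalg_mul x y.
Proof. by apply: val_inj; rewrite /= cmulZr. Qed.
Lemma subalg_adjK : involutive subalg_adj.
Proof. by move=> x; apply: val_inj; rewrite /= adjK. Qed.
Lemma subalg_adjD : {morph subalg_adj : x y / x + y}.
Proof. by move=> x y; apply: val_inj; rewrite /= adjD. Qed.
Lemma subalg_adjZ (c : Cplx R) x : subalg_adj (c *: x) = (c^*)%R *: subalg_adj x.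
Proof. by apply: val_inj; rewrite /= Defs.adjZ. Qed.
Lemma subalg_adjM x y : subalg_adj (subalg_mul x y) = subalg_mul (subalg_adj y) (subalg_adj x).
Proof. by apply: val_inj; rewrite /= adjM. Qed.
Lemma subalg_norm_mul (x y : subalg) : `|subalg_mul x y| <= `|x| * `|y|.
Proof. exact: norm_cmul. Qed.
Lemma subalg_cstar (x : subalg) : `|subalg_mul (subalg_adj x) x| = `|x| ^+ 2.
Proof. exact: cstar_identity. Qed.

HB.instance Definition _ := isCStarAlgebra.Build R subalg subalg_mulA subalg_mulDl
  subalg_mulDr subalg_mulZl subalg_mulZr subalg_adjK subalg_adjD subalg_adjZ
  subalg_adjM subalg_norm_mul subalg_cstar.

End Subalgebra.

(** * Closed subalgebras with a unit of their own *)

Section UnitalSubalgebra.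
Variables (R : realType) (A : cstarAlgType R) (X : set A) (p : A).
Hypothesis hX : closed_starsubalg X.
Hypothesis hp : [/\ X p, forall x, X x -> p ** x = x & forall x, X x -> x ** p = x].

(** An alias whose type carries the unit [p], which need not be a unit of the ambient algebra. *)
Definition usubalg of [/\ X p, forall x, X x -> p ** x = x & forall x, X x -> x ** p = x] : Type :=
  subalg hX.
HB.instance Definition _ := CStarAlgebra.on (usubalg hp).

Definition usubalg_one : usubalg hp :=
  let: And3 Xp _ _ := hp in exist _ p (mem_set Xp).

Lemma usubalg_mul1x : left_id usubalg_one (@cmul R (usubalg hp)).
Proof.
move=> x; apply: val_inj; rewrite /usubalg_one /=; case: hp => Xp px _ /=.
exact: px (subalgP x).
Qed.
Lemma usubalg_mulx1 : right_id usubalg_one (@cmul R (usubalg hp)).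
Proof.
move=> x; apply: val_inj; rewrite /usubalg_one /=; case: hp => Xp _ px /=.
exact: px (subalgP x).
Qed.
HB.instance Definition _ := isUnitalCStar.Build R (usubalg hp) usubalg_mul1x usubalg_mulx1.

Definition usubalg_val (x : usubalg hp) : A := val (x : subalg hX).

Lemma usubalg_val_hom : star_hom usubalg_val.
Proof. by split. Qed.

Lemma usubalg_val_inj : injective usubalg_val.
Proof. exact: val_inj. Qed.

Lemma usubalg_val_one : usubalg_val cone = p.
Proof. by rewrite /cone /= /usubalg_one; case: hp. Qed.

Lemma usubalg_nrm (x : usubalg hp) : nrm (usubalg_val x) = nrm x.
Proof. by []. Qed.

Lemma usubalg_valP (x : usubalg hp) : X (usubalg_val x).
Proof. exact: subalgP. Qed.

(** Made total because the generating families are functions on the whole group; outside [X] the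
    value is a dummy. *)
Definition usubalg_in (a : A) : usubalg hp :=
  if pselect (X a) is left Xa then exist _ a (mem_set Xa) else usubalg_one.

Lemma usubalg_inK a : X a -> usubalg_val (usubalg_in a) = a.
Proof. by rewrite /usubalg_in; case: pselect. Qed.

End UnitalSubalgebra.

(** * The inverse semigroup T *)

Section LinearSpan.
Variables (K : pzRingType) (V : lmodType K) (X : set V).

Lemma lspan_gen v : X v -> lspan X v.
Proof.
move=> Xv; exists 1%N, (fun _ => 1), (fun _ => v).
by split=> //; rewrite big_ord1 scale1r.
Qed.

Lemma lspan0 : lspan X 0.
Proof. by exists 0%N, (fun _ => 0), (fun _ => 0); split=> [[]|] //; rewrite big_ord0. Qed.

Lemma lspanD v w : lspan X v -> lspan X w -> lspan X (v + w).
Proof.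
move=> [n [c [x [Xx ->]]]] [m [d [y [Xy ->]]]].
exists (n + m)%N, (fun i => match fintype.split i with inl j => c j | inr k => d k end),
  (fun i => match fintype.split i with inl j => x j | inr k => y k end); split.
  by move=> i; case: fintype.split.
rewrite big_split_ord; congr (_ + _); apply: eq_bigr => i _.
  by rewrite (unsplitK (inl i)).
by rewrite (unsplitK (inr i)).
Qed.

Lemma lspanZ a v : lspan X v -> lspan X (a *: v).
Proof.
move=> [n [c [x [Xx ->]]]]; exists n, (fun i => a * c i), x; split=> //.
by rewrite scaler_sumr; apply: eq_bigr => i _; rewrite scalerA.
Qed.

Lemma lspan_sum (I : Type) (r : seq I) (P : pred I) (F : I -> V) :
  (forall i, P i -> lspan X (F i)) -> lspan X (\sum_(i <- r | P i) F i).
Proof. by move=> h; apply: big_ind => //; [exact: lspan0 | exact: lspanD]. Qed.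

Lemma lspan_ind (Q : V -> Prop) : Q 0 -> (forall v w, Q v -> Q w -> Q (v + w)) ->
  (forall a v, Q v -> Q (a *: v)) -> (forall v, X v -> Q v) -> forall v, lspan X v -> Q v.
Proof.
move=> Q0 QD QZ QX v [n [c [x [Xx ->]]]].
by apply: big_ind => // i _; apply: QZ; exact: QX.
Qed.

End LinearSpan.

Section Relations.
Variables (R : realType) (G : groupType) (H M : set G).
Variables (A : unitalCStarAlgType R) (s u : G -> A).
Hypothesis subH : subgroup H.
Hypothesis subM : subgroup M.
Hypothesis HPPV : H = [set (a * b^-1)%g | a in Pmonoid H M & b in Pmonoid H M].
Hypothesis HPVP : H = [set (a^-1 * b)%g | a in Pmonoid H M & b in Pmonoid H M].
Hypothesis Mindex : forall a : G, Pmonoid H M a -> finite_index (conj_set a M) M.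
Hypothesis rel : relations H M s u.

Local Notation P := (Pmonoid H M).
Local Notation er := (range_proj s).
Local Notation F := (Fset H M s u).
Local Notation T := (Tset H M s u).

Definition translate_proj (k b : G) : A := u k ** er b ** (u k)^!.
Local Notation pj := translate_proj.
Local Notation D := (lspan [set u k ** er b ** (u k)^! | k in M & b in P]).

Lemma M_one : M 1%g. Proof. by case: subM. Qed.
Lemma M_mul x y : M x -> M y -> M (x * y)%g. Proof. by case: subM => _ h _; apply: h. Qed.
Lemma M_inv x : M x -> M x^-1%g. Proof. by case: subM => _ _; apply. Qed.

Lemma P_conj a m : P a -> M m -> M (a * m * a^-1)%g.
Proof. by move=> [_ h] Mm; apply: h; exists m. Qed.

Lemma P_one : P 1%g.
Proof.
split; first by case: subH.
by move=> _ [m Mm <-]; rewrite invg1 mulg1 mul1g.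
Qed.

Lemma P_mul a b : P a -> P b -> P (a * b)%g.
Proof.
move=> Pa Pb; split.
  by case: subH => _ h _; apply: h; [case: Pa | case: Pb].
move=> _ [m Mm <-].
have -> : (a * b * m * (a * b)^-1 = a * (b * m * b^-1) * a^-1)%g by rewrite invgM !mulgA.
by do 2 apply: P_conj => //.
Qed.

Lemma s_isom a : P a -> (s a)^! ** s a = cone. Proof. exact: (rel_isometry rel). Qed.

Lemma s_mul a b : P a -> P b -> s (a * b)%g = s a ** s b.
Proof. by move=> Pa Pb; rewrite (rel_ss rel). Qed.

Lemma s_one : s 1%g = cone.
Proof.
have := rel_ss rel P_one P_one; rewrite mulg1 => ss.
by rewrite -[LHS]cmul1x -(s_isom P_one) -cmulA ss.
Qed.

Lemma u_mul m n : M m -> M n -> u (m * n)%g = u m ** u n.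
Proof. by move=> Mm Mn; rewrite (rel_uu rel). Qed.

Lemma u_isom m : M m -> (u m)^! ** u m = cone. Proof. by case/(rel_unitary rel). Qed.
Lemma u_coisom m : M m -> u m ** (u m)^! = cone. Proof. by case/(rel_unitary rel). Qed.

Lemma u_one : u 1%g = cone.
Proof.
have := rel_uu rel M_one M_one; rewrite mulg1 => uu.
by rewrite -[LHS]cmul1x -(u_isom M_one) -cmulA uu.
Qed.

Lemma u_inv m : M m -> (u m)^! = u m^-1%g.
Proof.
by move=> Mm; rewrite -[RHS]cmulx1 -(u_coisom Mm) cmulA -u_mul ?mulVg ?u_one ?cmul1x //; exact: M_inv.
Qed.

Lemma s_u a m : P a -> M m -> s a ** u m = u (a * m * a^-1)%g ** s a.
Proof. exact: (rel_su rel). Qed.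

Lemma s_adj_u a m : P a -> M m -> (s a)^! ** u (a * m * a^-1)%g = u m ** (s a)^!.
Proof.
move=> Pa Mm; apply: (can_inj (@adjK R A)); rewrite !adjM adjK !u_inv //; last exact: P_conj.
rewrite (_ : ((a * m * a^-1)^-1 = a * m^-1 * a^-1)%g) -?s_u //; first exact: M_inv.
by rewrite !invgM invgK mulgA.
Qed.

Lemma range_proj_isproj a : P a -> isproj (er a).
Proof.
move=> Pa; rewrite /range_proj; split; first by rewrite adjM adjK.
by rewrite cmulA -(cmulA (s a)) s_isom // cmulx1.
Qed.

Lemma conj_u_proj m f : M m -> isproj f -> isproj (u m ** f ** (u m)^!).
Proof.
move=> Mm [fa ff]; split; first by rewrite !adjM adjK fa cmulA.
by rewrite !cmulA -(cmulA _ _ (u m)) u_isom // cmulx1 -(cmulA _ f f) ff.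
Qed.

Lemma conj_s_proj a f : P a -> isproj f -> isproj (s a ** f ** (s a)^!).
Proof.
move=> Mm [fa ff]; split; first by rewrite !adjM adjK fa cmulA.
by rewrite !cmulA -(cmulA _ _ (s a)) s_isom // cmulx1 -(cmulA _ f f) ff.
Qed.

Lemma translate_isproj k b : M k -> P b -> isproj (pj k b).
Proof. by move=> Mk Pb; apply: conj_u_proj (range_proj_isproj Pb). Qed.

Lemma translateE k b : pj k b = (u k ** s b) ** (u k ** s b)^!.
Proof. by rewrite /pj /range_proj adjM !cmulA. Qed.

(** [u (b * m * b^-1)] passes through [s b] and becomes [u m], which cancels against its adjoint. *)
Lemma translate_coset k k' b : P b -> M k -> conj_set b M (k^-1 * k')%g -> pj k' b = pj k b.
Proof.
move=> Pb Mk [m Mm kE]; have -> : k' = (k * (b * m * b^-1))%g by rewrite kE mulVKg.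
rewrite !translateE u_mul //; last exact: P_conj.
rewrite -(cmulA (u k)) -s_u // !cmulA !adjM -!cmulA; congr (_ ** (_ ** _)).
by rewrite !cmulA u_coisom // cmul1x.
Qed.

Lemma coset_rep b C : P b -> lcosets M (conj_set b M) C ->
  [/\ M (xget 1%g C), C (xget 1%g C) &
      forall k, C k -> M k /\ pj k b = pj (xget 1%g C) b].
Proof.
move=> Pb [k Mk CE].
have Ck x : C x -> M x /\ conj_set b M (k^-1 * x)%g.
  rewrite -CE => -[y yb <-]; rewrite mulKg; split=> //.
  by apply: M_mul => //; case: yb => m Mm <-; apply: P_conj.
have xC : C (xget 1%g C).
  apply: (xgetPex 1%g); exists k; rewrite -CE; exists 1%g; last by rewrite mulg1.
  by exists 1%g; rewrite ?mulg1 ?mulgV //; exact: M_one.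
have [Mx kx] := Ck _ xC; split=> // k' /Ck[Mk' kk']; split=> //.
by rewrite (translate_coset Pb Mk kk') (translate_coset Pb Mk kx).
Qed.

(** Both projections are summands of the relation for [b], up to the choice of representatives: they
    belong to one coset, or they are distinct summands and [proj_sum_orth] applies. *)
Lemma translate_mul k k' b : P b -> M k -> M k' ->
  pj k b ** pj k' b = 0 \/ conj_set b M (k^-1 * k')%g.
Proof.
move=> Pb Mk Mk'; pose C x := [set (x * y)%g | y in conj_set b M].
have LC x : M x -> lcosets M (conj_set b M) (C x) by move=> Mx; exists x.
have CC x : M x -> C x x.
  move=> Mx; exists 1%g; last by rewrite mulg1.
  by exists 1%g; rewrite ?mulg1 ?mulgV //; exact: M_one.
have [_ _ /(_ _ (CC k Mk))[_ Ek]] := coset_rep Pb (LC k Mk).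
have [_ _ /(_ _ (CC k' Mk'))[_ Ek']] := coset_rep Pb (LC k' Mk').
have [CE|CkCk'] := eqVneq (C k) (C k'); first right.
  by have := CC k' Mk'; rewrite -CE => -[y yb <-]; rewrite mulKg.
left; rewrite Ek Ek'.
have fin : finite_set (lcosets M (conj_set b M)) by case: (Mindex Pb).
have := rel_sum rel Pb; rewrite fsbig_finite //= => S1.
apply: (proj_sum_orth _ _ S1 _ _ CkCk').
- exact: fset_uniq.
- move=> X; rewrite in_fset_set // inE => /(coset_rep Pb)[MX _ _]; exact: translate_isproj.
- by rewrite in_fset_set // inE; exact: LC.
- by rewrite in_fset_set // inE; exact: LC.
Qed.

(** The relation for [c], inserted between [s b] and its adjoint, splits e_b into translates of
    e_{bc}; [s_u] moves the representative x to b x b^-1. *)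
Lemma translate_refine k b c : M k -> P b -> P c ->
  exists2 ks : seq G, {in ks, forall x, M x} & pj k b = \sum_(x <- ks) pj x (b * c)%g.
Proof.
move=> Mk Pb Pc; have fin : finite_set (lcosets M (conj_set c M)) by case: (Mindex Pc).
have := rel_sum rel Pc; rewrite fsbig_finite //= => S1.
exists [seq (k * (b * xget 1%g C * b^-1))%g | C <- fset_set (lcosets M (conj_set c M))].
  move=> _ /mapP[C CL ->]; move: CL; rewrite in_fset_set // inE => /(coset_rep Pc)[MC _ _].
  by apply: M_mul => //; exact: P_conj.
rewrite big_map translateE -[X in X ** _]cmulx1 -S1 cmul_sumr cmul_suml.
rewrite [RHS]big_seq [LHS]big_seq; apply: eq_bigr => C; rewrite in_fset_set // inE.
move=> /(coset_rep Pc)[MC _ _]; rewrite translateE s_mul // u_mul //; last exact: P_conj.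
have -> : u k ** u (b * xget 1%g C * b^-1)%g ** (s b ** s c) =
    u k ** s b ** u (xget 1%g C) ** s c.
  by rewrite cmulA -(cmulA (u k)) -s_u // !cmulA.
by rewrite /range_proj !adjM !cmulA.
Qed.

(** The element a^-1 b of P^-1 P = H = P P^-1 is rewritten as c d^-1. *)
Lemma common_right_multiple a b : P a -> P b ->
  exists c d, [/\ P c, P d & (a * c = b * d)%g].
Proof.
move=> Pa Pb; have Hab : H (a^-1 * b)%g by rewrite HPVP; exists a => //; exists b.
have : [set (a * b^-1)%g | a in P & b in P] (a^-1 * b)%g by rewrite -HPPV.
move=> -[c Pc [d Pd E]]; exists c, d; split=> //.
by rewrite -(mulgVK d c) E !mulgA mulgV mul1g.
Qed.

(** The mirror image: a b^-1 is rewritten as c^-1 d. *)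
Lemma common_left_multiple a b : P a -> P b ->
  exists c d, [/\ P c, P d & (c * a = d * b)%g].
Proof.
move=> Pa Pb; have Hab : H (a * b^-1)%g by rewrite HPPV; exists a => //; exists b.
have : [set (a^-1 * b)%g | a in P & b in P] (a * b^-1)%g by rewrite -HPVP.
move=> -[c Pc [d Pd E]]; exists c, d; split=> //.
by rewrite -(mulgVK b a) -E !mulgA mulgV mul1g.
Qed.

(* Any two of the projections [u(k) e_b u(k)^-1] are sums of such projections
   with a common value of [b]. *)
Lemma span_mul x y : D x -> D y -> D (x ** y) /\ x ** y = y ** x.
Proof.
move=> Dx; move: y; apply: lspan_ind.
- by rewrite cmulx0 cmul0x; split=> //; exact: lspan0.
- by move=> v w [Dv xv] [Dw xw]; rewrite cmulDr cmulDl -xv -xw; split=> //; exact: lspanD.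
- by move=> a v [Dv xv]; rewrite cmulZr cmulZl -xv; split=> //; exact: lspanZ.
move=> _ [k' Mk' [b' Pb' <-]]; move: x Dx; apply: lspan_ind.
- by rewrite cmulx0 cmul0x; split=> //; exact: lspan0.
- by move=> v w [Dv xv] [Dw xw]; rewrite cmulDr cmulDl -xv -xw; split=> //; exact: lspanD.
- by move=> a v [Dv xv]; rewrite cmulZr cmulZl -xv; split=> //; exact: lspanZ.
move=> _ [k Mk [b Pb <-]]; rewrite -!/(pj _ _).
have [c [d [Pc Pd bc]]] := common_right_multiple Pb Pb'.
have [ks Mks ->] := translate_refine Mk Pb Pc; have [ks' Mks' ->] := translate_refine Mk' Pb' Pd.
rewrite -bc; have Pbc := P_mul Pb Pc.
(* At the common level bc two translates are orthogonal or equal. *)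
have gen z z' : z \in ks -> z' \in ks' ->
    D (pj z (b * c)%g ** pj z' (b * c)%g) /\
    pj z (b * c)%g ** pj z' (b * c)%g = pj z' (b * c)%g ** pj z (b * c)%g.
  move=> /Mks Mz /Mks' Mz'; have [z0|/(translate_coset Pbc Mz) ->] := translate_mul Pbc Mz Mz'; last first.
    rewrite (translate_isproj Mz Pbc).2; split=> //.
    by apply: lspan_gen; exists z => //; exists (b * c)%g.
  rewrite z0; split; first exact: lspan0.
  by rewrite -adj0 -z0 adjM !(translate_isproj _ Pbc).1.
split.
  rewrite cmul_suml big_seq; apply: lspan_sum => z zk.
  by rewrite cmul_sumr big_seq; apply: lspan_sum => z' zk'; case: (gen _ _ zk zk').
rewrite [RHS]cmul_sumr cmul_suml big_seq [RHS]big_seq; apply: eq_bigr => z zk.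
rewrite cmul_sumr cmul_suml big_seq [RHS]big_seq; apply: eq_bigr => z' zk'.
by case: (gen _ _ zk zk').
Qed.

Lemma span_translate k b : M k -> P b -> D (pj k b).
Proof. by move=> Mk Pb; apply: lspan_gen; exists k => //; exists b. Qed.

Lemma F_translate k b : M k -> P b -> F (pj k b).
Proof. by move=> Mk Pb; split; [exact: translate_isproj | exact: span_translate]. Qed.

Lemma translate_one b : pj 1 b = er b.
Proof. by rewrite /pj u_one cmul1x adj_cone cmulx1. Qed.

Lemma F_range_proj b : P b -> F (er b).
Proof. by move=> Pb; rewrite -translate_one; apply: F_translate => //; exact: M_one. Qed.

Lemma F_cone : F cone.
Proof.
by have := F_range_proj P_one; rewrite /range_proj s_one cmul1x adj_cone.
Qed.

Lemma F_zero : F 0.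
Proof. by split; [split; rewrite ?adj0 ?cmul0x | exact: lspan0]. Qed.

Lemma F_mul f g : F f -> F g -> F (f ** g) /\ f ** g = g ** f.
Proof.
move=> [[fa ff] Df] [[ga gg] Dg]; have [Dfg fg] := span_mul Df Dg.
split=> //; split=> //; split; first by rewrite adjM fa ga fg.
by rewrite cmulA -(cmulA f) -fg cmulA ff -cmulA gg.
Qed.

Lemma F_compl f : F f -> F (cone - f).
Proof.
move=> [[fa ff] Df]; split; first split.
- by rewrite adjB adj_cone fa.
- by rewrite cmulBl !cmulBr !cmul1x cmulx1 ff subrr subr0.
- by apply: lspanD; [case: F_cone | rewrite -scaleN1r; exact: lspanZ].
Qed.

Lemma F_conj_u m f : M m -> F f -> F (u m ** f ** (u m)^!).
Proof.
move=> Mm [fP Df]; split; first exact: conj_u_proj.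
move: f Df {fP}; apply: lspan_ind.
- by rewrite cmulx0 cmul0x; exact: lspan0.
- by move=> v w Dv Dw; rewrite cmulDr cmulDl; exact: lspanD.
- by move=> a v Dv; rewrite cmulZr cmulZl; exact: lspanZ.
move=> _ [k Mk [b Pb <-]].
have -> : u m ** (u k ** er b ** (u k)^!) ** (u m)^! = pj (m * k) b.
  by rewrite /pj u_mul // adjM !cmulA.
by apply: span_translate => //; exact: M_mul.
Qed.

Lemma F_conj_s a f : P a -> F f -> F (s a ** f ** (s a)^!).
Proof.
move=> Pa [fP Df]; split; first exact: conj_s_proj.
move: f Df {fP}; apply: lspan_ind.
- by rewrite cmulx0 cmul0x; exact: lspan0.
- by move=> v w Dv Dw; rewrite cmulDr cmulDl; exact: lspanD.
- by move=> c v Dv; rewrite cmulZr cmulZl; exact: lspanZ.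
move=> _ [k Mk [b Pb <-]].
have -> : s a ** (u k ** er b ** (u k)^!) ** (s a)^! = pj (a * k * a^-1) (a * b).
  rewrite -/(pj k b) !translateE s_mul // (cmulA (u (a * k * a^-1)%g)) -s_u //.
  by rewrite !adjM !cmulA.
by apply: span_translate; [exact: P_conj | exact: P_mul].
Qed.

(** [f] commutes with e_a, so the compression is again a projection. For the span, translates of e_b
    are refined to the level of a common multiple ad: those by an element of aMa^-1 become
    translates of e_d, and the others are killed. *)
Lemma F_conj_sV a f : P a -> F f -> F ((s a)^! ** f ** s a).
Proof.
move=> Pa Ff; have [fP Df] := Ff; have [_ fe] := F_mul Ff (F_range_proj Pa).
split.
  split; first by rewrite !adjM adjK fP.1 cmulA.
  rewrite -!cmulA (cmulA (s a)) -/(er a) (cmulA f) fe.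
  rewrite -(cmulA (er a)) (cmulA f f) fP.2 /range_proj !cmulA s_isom // cmul1x.
  by [].
move: f Df {Ff fP fe}; apply: lspan_ind.
- by rewrite cmulx0 cmul0x; exact: lspan0.
- by move=> v w Dv Dw; rewrite cmulDr cmulDl; exact: lspanD.
- by move=> c v Dv; rewrite cmulZr cmulZl; exact: lspanZ.
move=> _ [k Mk [b Pb <-]]; rewrite -/(pj k b).
have [c [d [Pc Pd E]]] := common_right_multiple Pb Pa.
have [ks Mks ->] := translate_refine Mk Pb Pc; rewrite E.
rewrite cmul_sumr cmul_suml big_seq; apply: lspan_sum => x /Mks Mx.
have [[m Mm <-]|nx] := pselect (conj_set a M x).
  have -> : (s a)^! ** pj (a * m * a^-1) (a * d) ** s a = pj m d.
    rewrite !translateE s_mul // (cmulA (u (a * m * a^-1)%g)) -s_u // -(cmulA (s a)).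
    rewrite adjM !cmulA s_isom // cmul1x -(cmulA _ (s a)^!) s_isom // cmulx1.
    by rewrite ?cmulA.
  exact: span_translate.
(* For x outside aMa^-1, e_a and its translate by [u x] are orthogonal; their product, stripped of
   the outer isometries, is this element. *)
suff sus : (s a)^! ** u x ** s a = 0.
  by rewrite translateE s_mul // adjM !cmulA sus !cmul0x; exact: lspan0.
have [e0|] := translate_mul Pa M_one Mx; last by rewrite invg1 mul1g.
  have : (s a)^! ** (pj 1 a ** pj x a) ** u x ** s a = 0.
    by rewrite e0 cmulx0 !cmul0x.
  rewrite translate_one translateE adjM /range_proj -!cmulA (cmulA (s a)^! (s a)) s_isom // cmul1x.
  by rewrite (cmulA (u x)^!) u_isom // cmul1x s_isom // cmulx1 cmulA.
Qed.

Lemma F_T f : F f -> T f.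
Proof.
move=> Ff; exists 1%g, 1%g, 1%g, 1%g, f; split;
  [exact: M_one|exact: M_one|exact: P_one|exact: P_one|split=> //].
by rewrite s_one u_one adj_cone !cmul1x !cmulx1.
Qed.

Lemma T_u m : M m -> T (u m).
Proof.
move=> Mm; exists m, 1%g, 1%g, 1%g, cone; split; [done|exact: M_one|exact: P_one|exact: P_one|split].
  exact: F_cone.
by rewrite s_one u_one adj_cone !cmul1x !cmulx1.
Qed.

Lemma T_s a : P a -> T (s a).
Proof.
move=> Pa; exists 1%g, 1%g, 1%g, a, cone; split; [exact: M_one|exact: M_one|exact: P_one|done|split].
  exact: F_cone.
by rewrite s_one u_one adj_cone !cmul1x.
Qed.

(** The middle factors of the elements of T. They form a star semigroup stable under conjugation by
    each [s a], over which T consists of fractions. *)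
Definition Tcore : set A :=
  [set x | exists m m' f, [/\ M m, M m', F f & x = u m ** f ** u m']].

Lemma TcoreP t : T t <-> exists a a' x, [/\ P a, P a', Tcore x & t = (s a)^! ** x ** s a'].
Proof.
split=> [[m [m' [a [a' [f [Mm Mm' Pa Pa' [Ff ->]]]]]]]|].
  by exists a, a', (u m ** f ** u m'); split=> //; [exists m, m', f | rewrite !cmulA].
move=> [a [a' [_ [Pa Pa' [m [m' [f [Mm Mm' Ff ->]]]] ->]]]].
by exists m, m', a, a', f; split=> //; split=> //; rewrite !cmulA.
Qed.

Lemma Tcore_mul x y : Tcore x -> Tcore y -> Tcore (x ** y).
Proof.
move=> [m [m' [f [Mm Mm' Ff ->]]]] [n [n' [g [Mn Mn' Fg ->]]]].
have Mmn := M_mul Mm' Mn.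
exists m, (m' * n * n')%g, (f ** (u (m' * n)%g ** g ** (u (m' * n)%g)^!)); split=> //.
- exact: M_mul.
- by case: (F_mul Ff (F_conj_u Mmn Fg)).
- rewrite (u_mul Mmn Mn') !cmulA -(cmulA _ _^! (u _)) u_isom // cmulx1.
  by rewrite u_mul // !cmulA.
Qed.

Lemma Tcore_F f : F f -> Tcore f.
Proof.
by move=> Ff; exists 1%g, 1%g, f; split; [exact: M_one|exact: M_one|done|rewrite u_one cmul1x cmulx1].
Qed.

Lemma Tcore_conj a x : P a -> Tcore x -> Tcore (s a ** x ** (s a)^!).
Proof.
move=> Pa [m [m' [f [Mm Mm' Ff ->]]]].
exists (a * m * a^-1)%g, (a * m' * a^-1)%g, (s a ** f ** (s a)^!); split;
  [exact: P_conj|exact: P_conj|exact: F_conj_s|].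
by rewrite !cmulA s_u // -(cmulA _ (s a)^! (u _)) s_adj_u // !cmulA.
Qed.

Lemma Tcore_adj x : Tcore x -> Tcore x^!.
Proof.
move=> [m [m' [f [Mm Mm' Ff ->]]]]; exists m'^-1%g, m^-1%g, f; split=> //.
- exact: M_inv.
- exact: M_inv.
- by rewrite !adjM !u_inv // cmulA Ff.1.1.
Qed.

(** Fractions are multiplied over a common left multiple c a' = d b: [s a' ** (s b)^!] equals
    [(s c)^! ** er (c * a') ** s d], and [s c], [s d] are then moved outwards by conjugating [v] and
    [w]. *)
Lemma T_mul x y : T x -> T y -> T (x ** y).
Proof.
move=> /TcoreP[a [a' [v [Pa Pa' Tv ->]]]] /TcoreP[b [b' [w [Pb Pb' Tw ->]]]].
have [c [d [Pc Pd E]]] := common_left_multiple Pa' Pb.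
apply/TcoreP; exists (c * a)%g, (d * b')%g,
  ((s c ** v ** (s c)^!) ** er (c * a')%g ** (s d ** w ** (s d)^!)).
split; [exact: P_mul|exact: P_mul| |].
  apply: Tcore_mul; last exact: Tcore_conj.
  by apply: Tcore_mul; [exact: Tcore_conj | apply/Tcore_F/F_range_proj/P_mul].
have -> : er (c * a')%g = s c ** (s a' ** (s b)^!) ** (s d)^!.
  by rewrite /range_proj {2}E !s_mul // adjM !cmulA.
rewrite !s_mul // adjM !cmulA.
rewrite -(cmulA _ (s c)^! (s c)) s_isom // cmulx1.
rewrite -(cmulA _ (s c)^! (s c)) s_isom // cmulx1.
rewrite -(cmulA _ (s d)^! (s d)) s_isom // cmulx1.
by rewrite -(cmulA _ (s d)^! (s d)) s_isom // cmulx1.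
Qed.

Lemma T_adj x : T x -> T x^!.
Proof.
move=> /TcoreP[a [a' [v [Pa Pa' Tv ->]]]]; apply/TcoreP; exists a', a, v^!.
by split=> //; [exact: Tcore_adj | rewrite !adjM adjK cmulA].
Qed.

Lemma T_range x : T x -> F (x ** x^!).
Proof.
move=> [m [m' [a [a' [f [Mm Mm' Pa Pa' [Ff ->]]]]]]].
have Fg : F (f ** (u m' ** er a' ** (u m')^!)) .
  by case: (F_mul Ff (F_conj_u Mm' (F_range_proj Pa'))).
have fg := (F_mul Ff (F_conj_u Mm' (F_range_proj Pa'))).2.
have := F_conj_sV Pa (F_conj_u Mm Fg); congr (F _).
rewrite !adjM adjK Ff.1.1 /range_proj.
have <- : f ** (u m' ** (s a' ** (s a')^!) ** (u m')^!) ** f =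
   f ** (u m' ** (s a' ** (s a')^!) ** (u m')^!).
  by rewrite -cmulA -fg cmulA Ff.1.2.
by rewrite !cmulA.
Qed.

Lemma T_inverse_subsemigroup : inverse_subsemigroup T.
Proof.
split.
- exact/F_T/F_zero.
- exact: T_mul.
- exact: T_adj.
- by move=> x /T_range[/pisom_proj].
- by move=> x y /T_range Fx /T_range Fy; case: (F_mul Fx Fy).
Qed.

Lemma T_idem e : T e -> e ** e = e -> F e.
Proof.
move=> Te ee; pose S := isg_of T_inverse_subsemigroup.
pose e' : S := exist _ e (mem_set Te).
have /idem_star/(congr1 val)/= ea : imul e' e' = e' by apply: val_inj.
by rewrite -ee -{2}ea; exact: T_range.
Qed.

End Relations.

(** * The tight spectrum *)

Section Idempotents.
Variables (R : realType) (A : unitalCStarAlgType R) (T : set A).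
Hypothesis hT : inverse_subsemigroup T.
Hypothesis T1 : T cone.
Hypothesis TC : forall e, T e -> e ** e = e -> T (cone - e).
Implicit Types e f g : A.

Local Notation S := (isg_of hT).

Definition idem_in : set A := [set e | T e /\ e ** e = e].
Local Notation E := idem_in.

Lemma idem_in_adj e : E e -> e^! = e.
Proof.
move=> [Te ee]; pose e' : S := exist _ e (mem_set Te).
by have /idem_star/(congr1 val) : imul e' e' = e' by apply: val_inj.
Qed.

Lemma idem_in_proj e : E e -> isproj e.
Proof. by move=> Ee; split; [exact: idem_in_adj | case: Ee]. Qed.

Lemma idem_inC e f : E e -> E f -> e ** f = f ** e.
Proof.
move=> Ee Ef; have := isub_projC hT Ee.1 Ef.1.
by rewrite !idem_in_adj // Ee.2 Ef.2.
Qed.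

Lemma idem_inM e f : E e -> E f -> E (e ** f).
Proof.
move=> Ee Ef; split; first exact: (isubM hT Ee.1 Ef.1).
by rewrite cmulA -(cmulA e) (idem_inC Ef Ee) cmulA Ee.2 -cmulA Ef.2.
Qed.

Lemma idem_in1 : E cone. Proof. by split; rewrite ?cmul1x. Qed.
Lemma idem_inB e : E e -> E (cone - e).
Proof.
move=> [Te ee]; split; first exact: TC.
by rewrite cmulBl !cmulBr !cmul1x cmulx1 ee subrr subr0.
Qed.

Lemma range_idem t : T t -> E (t ** t^!).
Proof.
move=> Tt; split; first by apply: isubM => //; exact: isubV.
by rewrite cmulA (isub_pisom hT Tt).
Qed.

Lemma conj_idem t e : T t -> E e -> E (t ** e ** t^!).
Proof.
move=> Tt Ee; have := range_idem (isubM hT Tt Ee.1).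
by rewrite adjM (idem_in_adj Ee) cmulA -(cmulA t) Ee.2.
Qed.

Definition mk_elt t (Tt : T t) : S := exist _ t (mem_set Tt).

Lemma mk_elt_idem e (Ee : E e) : imul (mk_elt Ee.1) (mk_elt Ee.1) = mk_elt Ee.1.
Proof. by apply: val_inj; exact: Ee.2. Qed.

Definition mk_idem e (Ee : E e) : @idempotents S := Idem (mk_elt_idem Ee).

Definition idem_val (e : @idempotents S) : A := val (sval e : T).

Lemma idem_valP (e : @idempotents S) : E (idem_val e).
Proof.
split; first exact: memT.
by have /(congr1 val) := idemP e.
Qed.

Lemma idem_val_inj : injective idem_val.
Proof. by move=> e f /val_inj ef; apply: EqP. Qed.

(* x(a) = 1, for an element a of A. *)
Definition ev (x : character S) (a : A) : Prop :=
  exists2 e : @idempotents S, idem_val e = a & x e.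

Section Characters.
Variable x : character S.

Lemma evE (e : @idempotents S) : ev x (idem_val e) <-> x e.
Proof. by split=> [[f /idem_val_inj <-]|xe] //; exists e. Qed.

Lemma ev_idem a : ev x a -> E a.
Proof. by move=> [e <- _]; exact: idem_valP. Qed.

Lemma ev0 : ~ ev x 0.
Proof.
move=> [e e0 xe]; have [_ _] := charP x.
have -> : Ezero S = e by apply: idem_val_inj; rewrite e0.
by rewrite [X in X = _]xe.
Qed.

Lemma evM e f : E e -> E f -> ev x (e ** f) <-> ev x e /\ ev x f.
Proof.
move=> Ee Ef; have [_ xM _] := charP x.
have := xM (mk_idem Ee) (mk_idem Ef) => h.
rewrite -[e]/(idem_val (mk_idem Ee)) -[f]/(idem_val (mk_idem Ef)).
rewrite -[X in ev x X]/(idem_val (Emul (mk_idem Ee) (mk_idem Ef))) !evE h.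
by split=> [/andP|[-> ->]].
Qed.

Lemma ev_le e f : E f -> e ** f = e -> ev x e -> ev x f.
Proof. by move=> Ef ef xe; have Ee := ev_idem xe; move: xe; rewrite -{1}ef => /(evM Ee Ef)[]. Qed.

Lemma ev1 : ev x cone.
Proof.
have [[e xe] _ _] := charP x; apply: (ev_le (e := idem_val e)) => //.
- exact: idem_in1.
- by rewrite cmulx1.
- by rewrite evE.
Qed.

Lemma ev_disj e : ev x e -> ~ ev x (cone - e).
Proof.
move=> xe xe'; apply: ev0; have [Ee Ee'] := (ev_idem xe, ev_idem xe').
have -> : 0 = e ** (cone - e) by rewrite cmulBr cmulx1 Ee.2 subrr.
by apply/(evM Ee Ee').
Qed.

End Characters.

Lemma ev_ext x y : (forall e, ev x e <-> ev y e) -> x = y.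
Proof.
by move=> xy; apply: char_ext => e; apply/idP/idP => /evE/xy/evE.
Qed.

Definition filter_set (Q : set A) : Prop :=
  [/\ Q cone, Q `<=` E, forall e f, Q e -> Q f -> Q (e ** f),
      forall e f, Q e -> E f -> e ** f = e -> Q f & ~ Q 0].

Lemma filter_character Q : filter_set Q -> exists x, forall e, ev x e <-> Q e.
Proof.
move=> [Q1 QE QM Qle Q0].
have qP : is_character (fun e : @idempotents S => `[< Q (idem_val e) >]).
  split.
  - by exists (mk_idem idem_in1); apply/asboolP.
  - move=> e f; have [Ee Ef] := (idem_valP e, idem_valP f).
    apply/idP/andP => [/asboolP Qef|[/asboolP Qe /asboolP Qf]].
      split; apply/asboolP; apply: Qle Qef _ _ => //.
        by rewrite /idem_val /= -/(idem_val e) -/(idem_val f) (idem_inC Ee Ef) -cmulA Ee.2.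
      by rewrite /idem_val /= -/(idem_val e) -/(idem_val f) -cmulA Ef.2.
    by apply/asboolP; exact: QM.
  - by apply/negbTE/asboolPn.
pose x : character S := exist _ (fun e : @idempotents S => `[< Q (idem_val e) >]) (mem_set qP).
exists x => e; split=> [[f <- /asboolP] //|Qe].
by exists (mk_idem (QE _ Qe)) => //; apply/asboolP.
Qed.

Lemma eval_open (e : @idempotents S) (b : bool) : open [set y : character S | y e = b].
Proof.
have -> : [set y : character S | y e = b] =
  (fun x : character S => sval x e) @^-1` [set b] by [].
apply: open_comp; last exact: discrete_open.
move=> x _; apply: (@continuous_comp _ {ptws @idempotents S -> bool} _
  (fun x : character S => sval x)
  (fun f : {ptws @idempotents S -> bool} => f e)).
  exact: initial_continuous.
exact: proj_continuous.
Qed.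

(** If neither holds, the filter [Q] generated by the support of [x] and by [e] is proper, since g e
    = 0 would mean g <= 1 - e; it then strictly extends the support of [x]. *)
Lemma maximal_compl x e : maximal_character x -> E e -> ev x e \/ ev x (cone - e).
Proof.
move=> xmax Ee; have [xe|xe] := pselect (ev x e); first by left.
have [xe'|xe'] := pselect (ev x (cone - e)); first by right.
exfalso.
have Ee' := idem_inB Ee.
pose Q : set A := [set f | E f /\ exists2 g, ev x g & g ** e ** f = g ** e].
have [z zQ] : exists z, forall f, ev z f <-> Q f.
  apply: filter_character; split.
  - by split; [exact: idem_in1 | exists cone; [exact: ev1 | rewrite cmulx1]].
  - by move=> f [].
  - move=> f f' [Ef [g xg gf]] [Ef' [g' xg' gf']]; split; first exact: idem_inM.
    have [Eg Eg'] := (ev_idem xg, ev_idem xg').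
    exists (g ** g'); first by apply/evM.
    rewrite cmulA (idem_inC Eg Eg') -!cmulA (cmulA g) (cmulA (g ** e)) gf.
    by rewrite !cmulA -(idem_inC Eg Eg') -!cmulA (cmulA g' e f') gf'.
  - move=> f f' [Ef [g xg gf]] Ef' ff'; split=> //; exists g => //.
    by rewrite -{1}gf -cmulA ff' gf.
  - move=> [_ [g xg]]; rewrite cmulx0 => ge0; apply: xe'.
    by apply: (ev_le (e := g)) => //; rewrite cmulBr cmulx1 -ge0 subr0.
have zx : char_support x `<=` char_support z.
  move=> f /= /evE xf; apply/evE/zQ; split; first exact: idem_valP.
  exists (idem_val f) => //; rewrite -cmulA (idem_inC Ee (idem_valP f)) cmulA.
  by rewrite (idem_valP f).2.
have /(congr1 (fun P => P (mk_idem Ee)))/= := xmax z zx.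
rewrite /char_support /= => h; apply: xe.
have : ev z e by apply/zQ; split=> //; exists cone; [exact: ev1 | rewrite cmul1x Ee.2].
by rewrite -[e]/(idem_val (mk_idem Ee)) !evE h.
Qed.

(** Vanishing at both [e] and 1 - e is an open condition that no maximal character satisfies, so no
    point of their closure does. *)
Lemma tight_compl x e : tight_character x -> E e -> ev x (cone - e) <-> ~ ev x e.
Proof.
move=> xt Ee; split=> [xe' /ev_disj //|xe].
apply: contrapT => xe'; pose e1 := mk_idem Ee; pose e2 := mk_idem (idem_inB Ee).
have x1 : x e1 = false by apply/negP => /evE.
have x2 : x e2 = false by apply/negP => /evE.
have : nbhs x ([set y : character S | y e1 = false] `&` [set y : character S | y e2 = false]).
  by apply: open_nbhs_nbhs; split=> //; apply: openI; exact: eval_open.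
move=> /xt[y [ymax [y1 y2]]].
have [/(evE y e1)|/(evE y e2)] := maximal_compl ymax Ee; first by rewrite y1.
by rewrite y2.
Qed.

(** Such a character is maximal: a larger one with value 1 at a further e would also have value 1 at
    1 - e. *)
Lemma tight_of_compl x : (forall e, E e -> ev x e \/ ev x (cone - e)) -> tight_character x.
Proof.
move=> xc; apply: subset_closure => y xy; apply/seteqP; split=> // e ye.
have [/evE //|xe'] := xc _ (idem_valP e).
exfalso; apply: (@ev_disj y (idem_val e)); first by rewrite evE.
by have [f <- xf] := xe'; rewrite evE; exact: xy.
Qed.

Definition seqprod (l : seq A) : A := foldr (@cmul R A) cone l.

Lemma seqprod_idem l : {in l, forall e, E e} -> E (seqprod l).
Proof.
elim: l => [_|e l IH lE]; first exact: idem_in1.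
apply: idem_inM; first by apply: lE; rewrite inE eqxx.
by apply: IH => f fl; apply: lE; rewrite inE fl orbT.
Qed.

Lemma seqprod_cat l l' : seqprod (l ++ l') = seqprod l ** seqprod l'.
Proof. by elim: l => [|e l IH] /=; rewrite ?cmul1x // IH cmulA. Qed.

(* Otherwise the complements of the idempotents in Q have the finite
   intersection property, and an ultrafilter containing them is a tight
   character that avoids Q. *)
Lemma tight_cover (Q : set A) :
  (forall x : character S, tight_character x -> exists2 e, ev x e & Q e) ->
  exists2 l : seq A, {in l, forall e, E e /\ Q e} &
    seqprod [seq cone - e | e <- l] = 0.
Proof.
move=> Qcov; apply: contrapT => noQ.
pose B : set A := [set f | exists2 e, E e /\ Q e & f = cone - e].
have BE f : B f -> E f by move=> [e [Ee _] ->]; exact: idem_inB.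
pose FIP X := X `<=` E /\
  forall l : seq A, {in l, forall e, X e \/ B e} -> seqprod l <> 0.
have FIP0 : FIP set0.
  split=> // l lB l0; apply: noQ; suff [l' l'Q ll'] : exists2 l' : seq A,
      {in l', forall e, E e /\ Q e} & l = [seq cone - e | e <- l'].
    by exists l' => //; rewrite -ll'.
  elim: l lB {l0} => [|f l IH] lB; first by exists [::].
  have [|l' l'Q ->] := IH; first by move=> e el; apply: lB; rewrite inE el orbT.
  have [//|[e eQ ->]] := lB f (mem_head _ _).
  by exists (e :: l') => // g; rewrite inE => /orP[/eqP ->|/l'Q].
have [X [[XE XP] Xmax]] : exists X, FIP X /\ forall Y, X `<` Y -> ~ FIP Y.
  apply: Zorn_bigcup => F FP Ftot; split; first by move=> e [X /FP[XE _] /XE].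
  move=> l lF; suff [Y [FY lY]] : exists Y, FIP Y /\ {in l, forall e, Y e \/ B e}.
    by apply: FY.2.
  (* Finitely many elements of the union of the chain lie in one member; the alternative [set0]
     covers an empty chain and lists drawn from [B] only. *)
  suff [Y [[FY|->] lY]] : exists Y, (F Y \/ Y = set0) /\ {in l, forall e, Y e \/ B e}.
  - by exists Y; split=> //; exact: FP.
  - by exists set0.
  elim: l lF => [|f l IH] lF; first by exists set0; split=> //; right.
  have [|Y [FY lY]] := IH; first by move=> e el; apply: lF; rewrite inE el orbT.
  have [[X FX Xf]|Bf] := lF f (mem_head _ _); last first.
    by exists Y; split=> // g; rewrite inE => /orP[/eqP ->|/lY //]; right.
  have [[YX|XY]|Y0] : (Y `<=` X \/ X `<=` Y /\ F Y) \/ Y = set0.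
  - case: FY => [FY|]; last by right.
    by left; case: (Ftot _ _ FX FY) => ?; [right|left].
  - exists X; split; first by left.
    by move=> g; rewrite inE => /orP[/eqP ->|/lY[/YX|]]; [left|left|right].
  - case: XY => XY FY'; exists Y; split=> // g; rewrite inE => /orP[/eqP ->|/lY //].
    by left; exact: XY.
  - exists X; split; first by left.
    move=> g; rewrite inE => /orP[/eqP ->|/lY]; first by left.
    by rewrite Y0 => -[|]; [|right].
have XBE l : {in l, forall e, X e \/ B e} -> E (seqprod l).
  by move=> lX; apply: seqprod_idem => e /lX[/XE|/BE].
pose U : set A := [set f | E f /\
  exists2 l : seq A, {in l, forall e, X e \/ B e} & seqprod l ** f = seqprod l].
have UF : filter_set U.
  split.
  - by split; [exact: idem_in1 | exists [::] => //; rewrite cmulx1].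
  - by move=> f [].
  - move=> f f' [Ef [l lX lf]] [Ef' [l' lX' lf']]; split; first exact: idem_inM.
    exists (l ++ l'); first by move=> e; rewrite mem_cat => /orP[/lX|/lX'].
    rewrite seqprod_cat -cmulA (cmulA (seqprod l')) -(idem_inC Ef (XBE _ lX')).
    by rewrite !cmulA lf -cmulA lf'.
  - move=> f f' [Ef [l lX lf]] Ef' ff'; split=> //; exists l => //.
    by rewrite -{1}lf -cmulA ff' lf.
  - by move=> [_ [l lX]]; rewrite cmulx0 => l0; apply: (XP l lX).
have UX e : X e \/ B e -> U e.
  move=> Xe; have Ee : E e by case: Xe => [/XE|/BE].
  split=> //; exists [:: e]; first by move=> f; rewrite inE => /eqP ->.
  by rewrite /= cmulx1 Ee.2.
have [x xU] := filter_character UF.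
have xt : tight_character x.
  apply: tight_of_compl => e Ee; have [Xe|Xe] := pselect (X e).
    by left; apply/xU/UX; left.
  right; apply/xU; split; first exact: idem_inB.
  (* By maximality, adding [e] destroys the finite intersection property: some product of elements
     of [X] and [B] is annihilated by [e], hence lies below 1 - e. *)
  have : X `<` X `|` [set e].
    by split; [move=> f; left | move=> /(_ e) h; apply: Xe; apply: h; right].
  move=> /Xmax nF; have [l [lX l0]] : exists l : seq A,
      {in l, forall f, (X f \/ f = e) \/ B f} /\ seqprod l = 0.
    apply: contrapT => nl; apply: nF; split; first by move=> f [/XE|->].
    by move=> l lX l0; apply: nl; exists l; split.
  suff [l' lX' ll'] : exists2 l' : seq A, {in l', forall f, X f \/ B f} &
      seqprod l' ** e = seqprod l ** e.
    by exists l' => //; rewrite cmulBr cmulx1 ll' l0 cmul0x subr0.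
  elim: l lX {l0} => [|f l IH] lX; first by exists [::].
  have [|l' lX' ll'] := IH; first by move=> g gl; apply: lX; rewrite inE gl orbT.
  have lE : E (seqprod l).
    apply: seqprod_idem => g gl; have glf : g \in f :: l by rewrite inE gl orbT.
    by have [[/XE|->]|/BE] := lX g glf.
  have [Xf|fe] : (X f \/ B f) \/ f = e by have [[]|] := lX f (mem_head _ _); auto.
    exists (f :: l'); first by move=> g; rewrite inE => /orP[/eqP ->|/lX'].
    by rewrite /= -!cmulA ll'.
  by exists l' => //=; rewrite fe (idem_inC Ee lE) -cmulA Ee.2.
have [e xe Qe] := Qcov x xt; apply: (ev_disj xe); apply/xU/UX; right.
by exists e => //; split=> //; exact: ev_idem xe.
Qed.

(** Compactness of the tight spectrum in algebraic form, and the passage from local to global used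
    throughout: a local property inherited by smaller idempotents holds on the pieces of a finite
    partition of 1. The cover is made disjoint by cutting each member with the complements of those
    later in the list. *)
Lemma tight_partition (Q : set A) :
  (forall x : character S, tight_character x -> exists2 e, ev x e & Q e) ->
  (forall e f, Q e -> E e -> E f -> Q (e ** f)) ->
  exists n (e : 'I_n -> A), [/\ forall i, E (e i) /\ Q (e i),
    forall i j, i != j -> e i ** e j = 0 & \sum_i e i = cone].
Proof.
move=> /tight_cover[l lQ l0] Qle.
suff : exists n (e : 'I_n -> A), [/\ forall i, E (e i) /\ Q (e i),
    forall i j, i != j -> e i ** e j = 0 &
    \sum_i e i = cone - seqprod [seq cone - e | e <- l]].
  by rewrite l0 subr0.
have pE l' : {in l', forall e, E e /\ Q e} -> E (seqprod [seq cone - e | e <- l']).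
  move=> h; apply: seqprod_idem => _ /mapP[e el ->].
  by apply: idem_inB; case: (h e el).
elim: l lQ {l0} => [|f l IH] lQ.
  by exists 0%N, (fun _ => 0); split=> [[]|[]|] //; rewrite big_ord0 subrr.
have [|n [e [eQ eO eS]]] := IH; first by move=> g gl; apply: lQ; rewrite inE gl orbT.
have [Ef Qf] := lQ f (mem_head _ _).
have Ep : E (seqprod [seq cone - e | e <- l]).
  by apply: pE => g gl; apply: lQ; rewrite inE gl orbT.
set p := seqprod _ in eS Ep.
have ep i : e i ** p = 0.
  have -> : p = cone - \sum_i e i by rewrite eS opprB addrC subrK.
  rewrite cmulBr cmulx1 cmul_sumr (bigD1 i) //= (eQ i).1.2 big1 ?addr0 ?subrr //.
  by move=> j ji; apply: eO; rewrite eq_sym.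
have pe i : p ** e i = 0 by rewrite (idem_inC Ep (eQ i).1) ep.
exists n.+1, (fun i => if unlift ord0 i is Some j then e j else f ** p); split.
- move=> i; case: unliftP => [j _|_]; first exact: eQ.
  by split; [exact: idem_inM | exact: Qle].
- move=> i j; case: (unliftP ord0 i) => [i' ->|->]; case: (unliftP ord0 j) => [j' ->|->] //.
  + by move=> ij; apply: eO; apply: contra ij => /eqP ->.
  + by rewrite (idem_inC Ef Ep) cmulA ep cmul0x.
  + by rewrite -cmulA pe cmulx0.
- rewrite big_ord_recl unlift_none; under eq_bigr do rewrite liftK.
  by rewrite eS /= cmulBl cmul1x opprB addrC addrA addrAC.
Qed.

End Idempotents.

(** * Germs *)

Local Open Scope quotient_scope.

Section TightGroupoid.
Variables (R : realType) (A : unitalCStarAlgType R) (T : set A).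
Hypothesis hT : inverse_subsemigroup T.
Hypothesis T1 : T cone.
Hypothesis TC : forall e, T e -> e ** e = e -> T (cone - e).

Local Notation S := (isg_of hT).
Local Notation E := (idem_in T).
Local Notation G := (tight_groupoid S).
Local Notation character := (Defs.character S).
Implicit Types (x y : character) (g h : G) (t : A).

(** A basic neighbourhood prescribes values 1 and 0. On tight characters a value 0 at f is a value 1
    at 1 - f, so one idempotent, a product, describes it. *)
Lemma tight_nbhs x (W : set character) : tight_character x -> open W -> W x ->
  exists2 e, ev x e & forall y, tight_character y -> ev y e -> W y.
Proof.
move=> xt oW Wx; have [V oV VW] : wopen (set_val : character -> {ptws @idempotents S -> bool}) W := oW.
(* The filter generated by the candidate neighbourhoods. It converges to [x] because it does so at
   each coordinate, hence it contains [V]. *)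
pose N : set_system {ptws @idempotents S -> bool} :=
  [set B | exists2 e, ev x e & forall y, tight_character y -> ev y e -> B (sval y)].
have NF : Filter N.
  split.
  - by exists cone => //; exact: ev1.
  - move=> B C [e xe eB] [f xf fC].
    have [Ee Ef] := (ev_idem xe, ev_idem xf).
    by exists (e ** f) => [|y yt /(evM _ Ee Ef)[ye yf]]; [apply/evM | split; [exact: eB | exact: fC]].
  - by move=> B C BC [e xe eB]; exists e => // y yt ye; apply/BC/eB.
have : {ptws, N --> (sval x : {ptws @idempotents S -> bool})}.
  apply/pointwise_cvgP => e B /nbhs_singleton Bx.
  have Ee := idem_valP e; have [xe|xe] := boolP (x e).
    exists (idem_val e); first by rewrite evE.
    by move=> y yt /evE ye /=; rewrite -[sval y e]/(y e) ye -xe.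
  exists (cone - idem_val e); first by apply/tight_compl => //; rewrite evE; apply/negP.
  move=> y yt /(tight_compl T1 TC yt Ee); rewrite evE => /negP/negbTE ye /=.
  by rewrite -[sval y e]/(y e) ye -(negbTE xe).
move=> /(_ V) []; first by apply: open_nbhs_nbhs; split=> //; rewrite -VW in Wx.
by move=> e xe eV; exists e => // y yt ye; rewrite -VW; exact: eV.
Qed.

(* Range x and source x.t of the germ g = [(x, t)]; gin g t says that g lies in
   theta(t), the set of all germs of t. *)
Definition rg g : character := germ_char (repr (val g)).
Definition sr g : character := germ_act (repr (val g)).
Definition gin g t : Prop :=
  exists2 p : germ_pair (S := S), \pi_(germ S) p = val g & val (germ_elt p) = t.

Lemma rg_germ g (p : germ_pair (S := S)) : \pi_(germ S) p = val g -> rg g = germ_char p.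
Proof. by rewrite /rg => <-; apply: char_rel; exact: germ_repr. Qed.

Lemma sr_germ g (p : germ_pair (S := S)) : \pi_(germ S) p = val g -> sr g = germ_act p.
Proof. by rewrite /sr => <-; apply: act_rel; exact: germ_repr. Qed.

Lemma gin_ex g : exists t, gin g t.
Proof. by exists (val (germ_elt (repr (val g)))), (repr (val g)) => //; rewrite reprK. Qed.

Lemma gin_T g t : gin g t -> T t.
Proof. by move=> [p _ <-]; exact: memT. Qed.

Lemma rg_gin g t : gin g t -> ev (rg g) (t ** t^!).
Proof.
move=> [p pg <-]; rewrite (rg_germ pg).
by exists (Eproj (germ_elt p)) => //; exact: germ_domP.
Qed.

Lemma sr_gin g t e : gin g t -> E e -> ev (sr g) e <-> ev (rg g) (t ** e ** t^!).
Proof.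
move=> [p pg <-] Ee; rewrite (sr_germ pg) (rg_germ pg).
rewrite -[e]/(idem_val (mk_idem hT Ee)) evE germ_actE.
by rewrite -[X in ev _ X]/(idem_val (Econj (germ_elt p) (mk_idem hT Ee))) evE.
Qed.

Lemma germ_unit (p : germ_pair (S := S)) :
  germ_mul (\pi_(germ S) p) (germ_inv (\pi_(germ S) p)) = \pi_(germ S) (pair_mul p (pair_inv p)).
Proof. by rewrite germ_invE germ_mulE. Qed.

Lemma tight_unitsP (p : germ_pair (S := S)) :
  tight_units (grange (\pi_(germ S) p : germ_groupoid S)) <-> tight_character (germ_char p).
Proof.
rewrite /grange /= germ_unit.
have pc : pair_comp p (pair_inv p) by [].
have [c1 e1] := pair_mulE pc.
split=> [[q [_ qt] /germ_eqP/char_rel]|pt]; first by rewrite c1 => <-.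
by exists (pair_mul p (pair_inv p)) => //; split; rewrite ?c1 // e1; exact: idem_proj.
Qed.

(** Invariance of the tight spectrum: t(1 - e)t^! is the complement of t e t^! below t t^!, where
    the character takes the value 1. *)
Lemma act_tight (p : germ_pair (S := S)) :
  tight_character (germ_char p) -> tight_character (germ_act p).
Proof.
move=> pt; apply: (tight_of_compl) => e Ee.
set x := germ_char p in pt *; set t := val (germ_elt p); have Tt : T t := memT (germ_elt p).
have act_ev f (Ef : E f) : ev (germ_act p) f <-> ev x (t ** f ** t^!).
  rewrite -[f]/(idem_val (mk_idem hT Ef)) evE germ_actE.
  by rewrite -[X in ev _ X]/(idem_val (Econj (germ_elt p) (mk_idem hT Ef))) evE.
have Ee' := idem_inB TC Ee; rewrite !act_ev //.
have [|xe] := pselect (ev x (t ** e ** t^!)); first by left.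
right; have xt : ev x (t ** t^!) by exists (Eproj (germ_elt p)) => //; exact: germ_domP.
have -> : t ** (cone - e) ** t^! = (t ** t^!) ** (cone - t ** e ** t^!).
  rewrite cmulBr cmulx1 cmulBl cmulBr cmulx1; congr (_ - _).
  by rewrite !cmulA (isub_pisom hT Tt).
apply/evM; first exact: range_idem.
  by apply: idem_inB => //; exact: conj_idem.
by split=> //; apply/(tight_compl T1 TC pt) => //; exact: conj_idem.
Qed.

Lemma gin_germ (p : germ_pair (S := S)) : tight_character (germ_char p) ->
  exists g, val g = \pi_(germ S) p.
Proof.
move=> pt; have pr : red_arrow (@tight_units S) (\pi_(germ S) p).
  split; first exact/tight_unitsP.
  have -> : gsource (\pi_(germ S) p : germ_groupoid S) =
      grange (\pi_(germ S) (pair_inv p) : germ_groupoid S).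
    by rewrite /gsource /grange /= germ_invE germ_invE pair_invK.
  by apply/tight_unitsP; exact: act_tight.
pose g : set_type (red_arrow (@tight_units S)) := exist _ (\pi_(germ S) p) (mem_set pr).
by exists (g : G).
Qed.

Lemma rg_tight g : tight_character (rg g).
Proof.
apply/tight_unitsP; rewrite reprK.
by have [] : red_arrow (@tight_units S) (val g) := set_mem (valP g).
Qed.

Lemma sr_tight g : tight_character (sr g).
Proof. exact/act_tight/rg_tight. Qed.

Lemma ginP x t : tight_character x -> T t -> ev x (t ** t^!) ->
  exists2 g, rg g = x & gin g t.
Proof.
move=> xt Tt xtt; have xd : dom (mk_elt hT Tt) x.
  rewrite /dom /=; apply/evE; move: xtt; congr (ev x _).
have [g gp] := @gin_germ (GermPair xd) xt.
by exists g; [rewrite (rg_germ (esym gp)) | exists (GermPair xd)].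
Qed.

Lemma gin_eq g h t t' : gin g t -> gin h t' -> rg g = rg h ->
  (g = h <-> exists2 e, ev (rg g) e & e ** t = e ** t').
Proof.
move=> [p pg <-] [q qh <-] gh; rewrite (rg_germ pg); rewrite (rg_germ pg) (rg_germ qh) in gh.
split=> [gh'|[e xe et]].
  have /germ_eqP/asboolP[_ [e xe /(congr1 val)/= et]] : \pi_(germ S) p = \pi_(germ S) q.
    by rewrite pg qh gh'.
  by exists (idem_val e) => //; rewrite evE.
apply: val_inj; rewrite -pg -qh; apply/germ_eqP/asboolP; split=> //.
by have [f fe xf] := xe; exists f => //; apply: val_inj; rewrite /= -/(idem_val f) fe.
Qed.

Lemma composableE g h : composable g h <-> rg h = sr g.
Proof. by []. Qed.

Lemma val_gmul g h : composable g h -> val (gmul g h) = germ_mul (val g) (val h).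
Proof. by move=> gh; exact: (@red_mulE _ (@tight_units S) g h gh). Qed.

Lemma gin_mul g h t t' : gin g t -> gin h t' -> composable g h -> gin (gmul g h) (t ** t').
Proof.
move=> [p pg <-] [q qh <-] gh.
have pq : pair_comp p q by apply/germ_compE; rewrite pg qh.
exists (pair_mul p q); first by rewrite val_gmul // -pg -qh germ_mulE.
by have [_ ->] := pair_mulE pq.
Qed.

Lemma gin_inv g t : gin g t -> gin (ginv g) t^!.
Proof. by move=> [p pg <-]; exists (pair_inv p) => //=; rewrite -pg germ_invE. Qed.

Lemma rg_inv g : rg (ginv g) = sr g.
Proof.
by rewrite (@rg_germ _ (pair_inv (repr (val g)))) //= -[in RHS](reprK (val g)) germ_invE.
Qed.

Lemma sr_inv g : sr (ginv g) = rg g.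
Proof. by rewrite -rg_inv ginvK. Qed.

Lemma rg_mul g h : composable g h -> rg (gmul g h) = rg g.
Proof.
move=> gh; have pq : pair_comp (repr (val g)) (repr (val h)) by [].
rewrite (@rg_germ _ (pair_mul (repr (val g)) (repr (val h)))).
  by have [->] := pair_mulE pq.
by rewrite val_gmul.
Qed.

Lemma rg_grange g : rg (grange g) = rg g.
Proof. by apply: rg_mul; exact: gcompVr. Qed.

Lemma rg_gsource g : rg (gsource g) = sr g.
Proof. by rewrite rg_mul ?rg_inv //; exact: gcompV. Qed.

(** A unit is determined by its character: the germs of two idempotents are identified by the
    product of the two. *)
Lemma grange_rg g h : rg g = rg h -> grange g = grange h.
Proof.
move=> gh; have [[t gt] [t' ht']] := (gin_ex g, gin_ex h).
have g1 := gin_mul gt (gin_inv gt) (gcompVr g).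
have h1 := gin_mul ht' (gin_inv ht') (gcompVr h).
apply/(gin_eq g1 h1); first by rewrite !rg_grange.
have [Et Et'] := (range_idem hT (gin_T gt), range_idem hT (gin_T ht')).
exists ((t ** t^!) ** (t' ** t'^!)).
  by rewrite rg_grange; apply/evM => //; split; [exact: rg_gin | rewrite gh; exact: rg_gin].
by rewrite -[RHS]cmulA Et'.2 (idem_inC hT Et Et') -cmulA Et.2.
Qed.

Lemma gin_inj_rg g h t : gin g t -> gin h t -> rg g = rg h -> g = h.
Proof.
by move=> gt ht gh; apply/(gin_eq gt ht gh); exists cone => //; exact: ev1.
Qed.

Lemma gin_inj_sr g h t : gin g t -> gin h t -> sr g = sr h -> g = h.
Proof.
move=> gt ht gh; rewrite -[g]ginvK -[h]ginvK; congr ginv.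
by apply: (gin_inj_rg (gin_inv gt) (gin_inv ht)); rewrite !rg_inv.
Qed.

Lemma gin_open t : open [set g | gin g t].
Proof.
have [Tt|nT] := pselect (T t); last first.
  suff -> : [set g | gin g t] = set0 by exact: open0.
  by apply/seteqP; split=> // g /= /gin_T.
have -> : [set g | gin g t] = val @^-1` (theta (mk_elt hT Tt) (dom (mk_elt hT Tt))).
  apply/seteqP; split=> g /=.
    move=> [p pg pt]; have pt' : germ_elt p = mk_elt hT Tt by apply: val_inj.
    by exists p => //; split=> //; rewrite -pt'; exact: germ_domP.
  by move=> [p [pt _] pg]; exists p => //; rewrite pt.
exists (theta (mk_elt hT Tt) (dom (mk_elt hT Tt))) => //.
exists [set (theta (mk_elt hT Tt) (dom (mk_elt hT Tt)))]; last by rewrite bigcup_set1.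
by move=> _ ->; exists (mk_elt hT Tt), (dom (mk_elt hT Tt)); split=> //; exact: dom_open.
Qed.

(** The full sets theta(t) already form a base: theta(s, W) is shrunk around [g] to theta(e s),
    where [e] isolates a neighbourhood of the range of [g] inside [W]. *)
Lemma open_gin (U : set G) g : open U -> U g -> exists2 t, gin g t & forall h, gin h t -> U h.
Proof.
move=> [V oV <-] /= Vg; have [D DB DV] := oV.
move: Vg; rewrite -DV => -[B DBB Bg]; have [s [W [oW Ws BE]]] := DB _ DBB.
move: Bg; rewrite BE => -[p [ps Wp] pg].
have gt : tight_character (germ_char p) by rewrite -(rg_germ pg); exact: rg_tight.
have [e xe eW] := tight_nbhs gt oW Wp; have Ee := ev_idem xe.
have gs : gin g (val s) by exists p => //; rewrite ps.
have Ts : T (val s) := memT s.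
have [h hg hes] : exists2 h, rg h = rg g & gin h (e ** val s).
  apply: ginP; [exact: rg_tight | exact: (isubM hT Ee.1 Ts) |].
  rewrite adjM (idem_in_adj hT Ee) cmulA -(cmulA e) .
  have Es := range_idem hT Ts; apply/evM => //; first exact: idem_inM.
  by rewrite (rg_germ pg); split=> //; apply/evM => //; split=> //; rewrite -(rg_germ pg); exact: rg_gin.
exists (e ** val s).
  suff -> : g = h by [].
  apply/(gin_eq gs hes (esym hg)); exists e; first by rewrite (rg_germ pg).
  by rewrite cmulA Ee.2.
move=> k [q qk qe]; exists B => //; rewrite BE.
have := rg_gin (ex_intro2 _ _ q qk qe : gin k _).
rewrite adjM (idem_in_adj hT Ee) cmulA -(cmulA e) => ke.
have Es := range_idem hT Ts.
have [] := (evM _ (idem_inM hT Ee Es) Ee).1 ke => /(evM _ Ee Es)[ke' ks] _.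
have kW : W (rg k) by apply: eW => //; exact: rg_tight.
have kd : dom s (rg k) by exact: Ws.
exists (GermPair kd); first by split.
apply: (etrans _ qk); apply/germ_eqP/asboolP; split; first by rewrite -(rg_germ qk).
by exists (mk_idem hT Ee); [apply/evE | apply: val_inj; rewrite /= qe cmulA Ee.2].
Qed.

End TightGroupoid.

Arguments rg_tight {R A T hT} g _ _.
Arguments sr_tight {R A T hT} _ _ g _ _.

(** * Functions on the tight groupoid *)

Section GermFunctions.
Variables (R : realType) (A : unitalCStarAlgType R) (T : set A).
Hypothesis hT : inverse_subsemigroup T.
Hypothesis T1 : T cone.
Hypothesis TC : forall e, T e -> e ** e = e -> T (cone - e).

Local Notation S := (isg_of hT).
Local Notation E := (idem_in T).
Local Notation G := (tight_groupoid S).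
Local Notation character := (Defs.character S).
Implicit Types (x y : character) (g h : G) (t : A).

Lemma range_idem_mul e t : E e -> T t -> (e ** t) ** (e ** t)^! = e ** (t ** t^!).
Proof.
move=> Ee Tt; rewrite adjM (idem_in_adj hT Ee) cmulA -(cmulA e).
by rewrite -cmulA -(idem_inC hT Ee (range_idem hT Tt)) cmulA Ee.2.
Qed.

(** Where the character is 1 at [e], the idempotent [e] itself identifies the germs of t and e t. *)
Lemma gin_idem_mul g e t : E e -> T t -> gin g (e ** t) <-> ev (rg g) e /\ gin g t.
Proof.
move=> Ee Tt; have Et := range_idem hT Tt; have Tet := isubM hT Ee.1 Tt.
split=> [get|[ge gt]].
  have := rg_gin get; rewrite range_idem_mul // => /(evM _ Ee Et)[ge gtt]; split=> //.
  have [h hg ht] := ginP T1 TC (rg_tight g) Tt gtt.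
  suff -> : g = h by [].
  by apply/(gin_eq get ht (esym hg)); exists e => //; rewrite cmulA Ee.2.
have gtt := rg_gin gt.
have gett : ev (rg g) ((e ** t) ** (e ** t)^!) by rewrite range_idem_mul //; apply/evM.
have [h hg het] := ginP T1 TC (rg_tight g) Tet gett.
suff -> : g = h by [].
by apply/(gin_eq gt het (esym hg)); exists e => //; rewrite cmulA Ee.2.
Qed.

Lemma gin_transfer g t t' : gin g t -> gin g t' ->
  exists2 e, ev (rg g) e & forall h, gin h t -> ev (rg h) e -> gin h t'.
Proof.
move=> gt gt'; have [e ge et] := (gin_eq gt gt' erefl).1 erefl.
exists e => // h ht he; have Ee := ev_idem ge.
have : gin h (e ** t) by apply/gin_idem_mul => //; exact: gin_T ht.
rewrite et => /(gin_idem_mul _ Ee (gin_T gt'))[] //.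
Qed.

Lemma ev_meet (I : finType) x (f : I -> A) : (forall i, ev x (f i)) ->
  exists2 e, ev x e & forall i, e ** f i = e.
Proof.
move=> xf; suff [e xe ef] : exists2 e, ev x e & forall i, i \in enum I -> e ** f i = e.
  by exists e => // i; apply: ef; rewrite mem_enum.
elim: (enum I) => [|i s [e xe es]]; first by exists cone => //; exact: ev1.
have [Ee Ei] := (ev_idem xe, ev_idem (xf i)).
exists (f i ** e); first by apply/evM.
move=> j; rewrite inE => /orP[/eqP ->|/es ej]; last by rewrite -cmulA ej.
by rewrite (idem_inC hT Ei Ee) -cmulA Ei.2.
Qed.

Lemma ev_partition (n : nat) (e : 'I_n -> A) x : tight_character x ->
  (forall i, E (e i)) -> \sum_i e i = cone -> exists i, ev x (e i).
Proof.
move=> xt eE eS; apply: contrapT => ne.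
have [|f xf fe] := @ev_meet _ x (fun i => cone - e i).
  by move=> i; apply/(tight_compl T1 TC xt) => // xe; apply: ne; exists i.
have fe0 i : f ** e i = 0.
  have := subrr f; rewrite -{2}(fe i) cmulBr cmulx1 opprB addrC subrK.
  by move=> ->.
apply: (@ev0 _ _ _ _ x); suff <- : f = 0 by [].
by rewrite -[f]cmulx1 -eS cmul_sumr big1.
Qed.

Lemma ev_orth x e f : ev x e -> ev x f -> e ** f <> 0.
Proof.
move=> xe xf ef; apply: (@ev0 _ _ _ _ x); rewrite -ef.
by apply/evM => //; [exact: ev_idem xe | exact: ev_idem xf].
Qed.

(* (xi o r) 1_{theta(t)} *)
Definition theta_fun (xi : character -> Cplx R) t : G -> Cplx R :=
  fun g => if pselect (gin g t) then xi (rg g) else 0.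

Definition chi t := theta_fun (fun=> 1) t.

Lemma theta_fun_in xi t g : gin g t -> theta_fun xi t g = xi (rg g).
Proof. by rewrite /theta_fun; case: pselect. Qed.

Lemma theta_fun_out xi t g : ~ gin g t -> theta_fun xi t g = 0.
Proof. by rewrite /theta_fun; case: pselect. Qed.

(* Over a small neighbourhood of x two elements of the family whose germs at x
   coincide are equal, so the sum regroups by germs at x; no Hausdorff property
   of the groupoid is involved. *)
Lemma germ_relation (I : finType) (t : I -> A) (eta : I -> character -> Cplx R) :
  (forall i, T (t i)) -> (forall g, \sum_i theta_fun (eta i) (t i) g = 0) ->
  forall x, tight_character x -> exists2 e, ev x e & \sum_i eta i x *: (e ** t i) = 0.
Proof.
move=> tT sum0 x xt.
(* [K i] says that [t i] has a germ at [x]. This germ will be [g i]; in the other case [g i] is a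
   placeholder. *)
pose K i := ev x (t i ** (t i)^!).
have [g0 g0x _] : exists2 g, rg g = x & gin g cone.
  by apply: ginP => //; rewrite adj_cone cmulx1; exact: ev1.
have /choice[g gP] : forall i, exists g, K i -> rg g = x /\ gin g (t i).
  move=> i.
  have [Ki|nK] := pselect (K i); last by exists g0.
  by have [g gx gt] := ginP T1 TC xt (tT i) Ki; exists g.
(* [f (i, j)] witnesses that [t i] and [t j] have the same germ at [x], or kills [t i] when it has
   none; a common lower bound [e] settles all pairs at once. *)
have /choice[f fP] : forall p : I * I, exists f, [/\ ev x f,
    K p.1 -> K p.2 -> g p.1 = g p.2 -> f ** t p.1 = f ** t p.2 &
    ~ K p.1 -> f ** t p.1 = 0].
  move=> [i j] /=.
  have [Ki|nK] := pselect (K i); last first.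
    exists (cone - t i ** (t i)^!); split=> //.
      by apply/(tight_compl T1 TC xt) => //; exact: range_idem.
    by rewrite cmulBl cmul1x (isub_pisom hT (tT i)) subrr.
  have [[Kj gij]|nij] := pselect (K j /\ g i = g j); last first.
    by exists cone; split=> [|_ Kj gij|//]; [exact: ev1 | case: nij].
  have [gix git] := gP i Ki; have [gjx gjt] := gP j Kj.
  have [|e xe et] := (gin_eq git gjt _).1 gij; first by rewrite gix gjx.
  by exists e; split=> //; rewrite -gix.
have [|e xe ef] := @ev_meet _ x f; first by move=> p; case: (fP p).
exists e => //.
have et i j : K i -> K j -> g i = g j -> e ** t i = e ** t j.
  move=> Ki Kj gij; have [_ h _] := fP (i, j).
  by rewrite -(ef (i, j)) -cmulA h // !cmulA.
have et0 i : ~ K i -> e ** t i = 0.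
  by move=> nK; have [_ _ h] := fP (i, i); rewrite -(ef (i, i)) -cmulA h // cmulx0.
rewrite (bigID (fun i => `[< K i >])) /= [X in _ + X]big1 ?addr0; last first.
  by move=> i /asboolPn nK; rewrite et0 // scaler0.
(* Germs are labelled by sets of indices, because the sum must be split along a finite type. On a
   class all e t_i agree, and their coefficients add up to the value of the given function at the
   common germ, which is 0. *)
pose germ_class i : {set I} := [set j | g j == g i]%SET.
rewrite (partition_big germ_class xpredT) //= big1 // => C _.
have [[i0 /andP[/asboolP Ki0 /eqP iC]]|nC] :=
  pselect (exists i0, `[< K i0 >] && (germ_class i0 == C)); last first.
  by apply: big_pred0 => i; apply/negP => h; apply: nC; exists i.
have [gx gt] := gP i0 Ki0.
have PE i : `[< K i >] && (germ_class i == C) = `[< gin (g i0) (t i) >].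
  apply/andP/asboolP => [[/asboolP Ki /eqP ciC]|git].
    have : i \in germ_class i0 by rewrite iC -ciC inE.
    by rewrite inE => /eqP <-; case: (gP i Ki).
  have Ki : K i by rewrite /K -gx; exact: rg_gin.
  have [gix gi] := gP i Ki.
  have E : g i = g i0 by apply: (gin_inj_rg T1 gi git); rewrite gix gx.
  by split; [exact/asboolP | rewrite -iC /germ_class E].
rewrite (eq_bigl _ _ PE).
rewrite (eq_bigr (fun i => eta i x *: (e ** t i0))); last first.
  move=> i; rewrite -PE => /andP[/asboolP Ki /eqP ciC]; rewrite (et i i0) //.
  have : i \in germ_class i0 by rewrite iC -ciC inE.
  by rewrite inE => /eqP.
rewrite -scaler_suml big_mkcond /=.
rewrite (eq_bigr (fun i => theta_fun (eta i) (t i) (g i0))) ?sum0 ?scale0r // => i _.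
case: ifPn => [/asboolP gi|/asboolPn gi]; first by rewrite theta_fun_in // gx.
by rewrite theta_fun_out.
Qed.

Lemma nrm_T t : T t -> nrm t <= 1.
Proof.
move=> Tt; have := range_idem hT (isubV hT Tt); rewrite adjK => /(idem_in_proj hT).
by apply: nrm_isom_le1.
Qed.

(** This is what makes 1_{theta(t)} |-> t well defined and bounded. By [germ_relation] for the
    differences c_i - xi_i, there are a partition e_j of 1 and points x_j such that the constants
    c_i may be replaced by xi_i(x_j) on e_j; the coefficient of t_i becomes a combination of
    orthogonal projections of norm at most b_i. *)
Lemma nrm_combination_le (I : finType) (t : I -> A) (c : I -> Cplx R)
    (xi : I -> character -> Cplx R) (b : I -> R) :
  (forall i, T (t i)) -> (forall i, 0 <= b i) ->
  (forall i x, tight_character x -> cabs (xi i x) <= b i) ->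
  (forall g, \sum_i c i * chi (t i) g = \sum_i theta_fun (xi i) (t i) g) ->
  nrm (\sum_i c i *: t i) <= \sum_i b i.
Proof.
move=> tT b0 xib sumE; pose eta i x := c i - xi i x.
pose Q e := exists2 x, tight_character x & \sum_i eta i x *: (e ** t i) = 0.
have [||n [e [eQ eO eS]]] := @tight_partition _ _ _ hT T1 TC Q.
- move=> x xt; have [|e xe h] := @germ_relation I t eta tT _ x xt; last by exists e => //; exists x.
  move=> g; transitivity (\sum_i (c i * chi (t i) g - theta_fun (xi i) (t i) g)).
    apply: eq_bigr => i _; have [gi|gi] := pselect (gin g (t i)).
      by rewrite /chi !theta_fun_in // mulr1.
    by rewrite /chi !theta_fun_out // mulr0 subrr.
  by rewrite sumrB sumE subrr.
- move=> e f [x xt sum0] Ee Ef; exists x => //.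
  transitivity (f ** \sum_i eta i x *: (e ** t i)); last by rewrite sum0 cmulx0.
  rewrite cmul_sumr; apply: eq_bigr => i _.
  by rewrite cmulZr cmulA (idem_inC hT Ee Ef).
have /choice[x xP] : forall j, exists x, tight_character x /\
    \sum_i eta i x *: (e j ** t i) = 0.
  by move=> j; have [_ [x xt h]] := eQ j; exists x.
have -> : \sum_i c i *: t i = \sum_i (\sum_j xi i (x j) *: e j) ** t i.
  transitivity (\sum_j \sum_i c i *: (e j ** t i)).
    rewrite -[LHS]cmul1x -eS cmul_suml; apply: eq_bigr => j _.
    by rewrite cmul_sumr; apply: eq_bigr => i _; rewrite cmulZr.
  transitivity (\sum_j \sum_i xi i (x j) *: (e j ** t i)).
    apply: eq_bigr => j _; have [_ /eqP] := xP j.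
    under eq_bigr do rewrite scalerBl.
    by rewrite sumrB subr_eq0 => /eqP.
  rewrite exchange_big; apply: eq_bigr => i _; rewrite cmul_suml.
  by apply: eq_bigr => j _; rewrite cmulZl.
apply: le_trans (nrm_sum _ _ _) _; apply: ler_sum => i _.
apply: le_trans (nrmM _ _) _.
have h := nrm_orth_sum (fun j => idem_in_proj hT (eQ j).1) eO (fun j => xib i (x j) (xP j).1) (b0 i).
have := nrm_T (tT i); have := nrm_ge0 (t i); have := nrm_ge0 (\sum_j xi i (x j) *: e j); nra.
Qed.

End GermFunctions.

(** * Convolution and involution of functions carried by the sets theta(t) *)

Section ConvolutionAlgebra.
Variables (R : realType) (A : unitalCStarAlgType R) (T : set A).
Hypothesis hT : inverse_subsemigroup T.
Hypothesis T1 : T cone.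
Hypothesis TC : forall e, T e -> e ** e = e -> T (cone - e).

Local Notation S := (isg_of hT).
Local Notation E := (idem_in T).
Local Notation G := (tight_groupoid S).
Local Notation character := (Defs.character S).
Local Notation chi := (@chi R A T hT).
Implicit Types (x y : character) (g h k : G) (t : A) (xi eta : character -> Cplx R).
Implicit Types (f : G -> Cplx R).

(* Continuity of xi on the tight spectrum, where the sets {y : y(p) = 1} are a
   base of neighbourhoods. *)
Definition econt xi : Prop := forall x, tight_character x -> forall e : R, 0 < e ->
  exists2 p, ev x p & forall y, tight_character y -> ev y p -> cabs (xi y - xi x) <= e.

Lemma econt_cst c : econt (fun=> c).
Proof. by move=> x _ e e0; exists cone; [exact: ev1 | move=> y _ _; rewrite subrr cabs0 ltW]. Qed.

Lemma econtM xi eta : econt xi -> econt eta -> econt (fun x => xi x * eta x).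
Proof.
move=> cx ce x xt e e0; set a := cabs (xi x); set b := cabs (eta x).
have a0 : 0 <= a := cabs_ge0 _; have b0 : 0 <= b := cabs_ge0 _.
(* The error of the product is at most d^2 + d b + a d <= d (a + b + 1). *)
pose d := Num.min 1 (e / (a + b + 1)).
have d0 : 0 < d by rewrite lt_min ltr01 divr_gt0 //; lra.
have d1 : d <= 1 by rewrite ge_min lexx.
have de : d * (a + b + 1) <= e by rewrite -ler_pdivlMr; [rewrite ge_min lexx orbT | lra].
have [p xp pP] := cx x xt d d0; have [q xq qP] := ce x xt d d0.
have [Ep Eq] := (ev_idem xp, ev_idem xq).
exists (p ** q); first by apply/evM.
move=> y yt /(evM _ Ep Eq)[yp yq].
have -> : xi y * eta y - xi x * eta x =
    (xi y - xi x) * (eta y - eta x) + ((xi y - xi x) * eta x + xi x * (eta y - eta x)) by ring.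
have h1 := pP y yt yp; have h2 := qP y yt yq.
apply: le_trans (cabsD _ _) _; have := cabsD ((xi y - xi x) * eta x) (xi x * (eta y - eta x)).
rewrite !cabsM -/a -/b; have := cabs_ge0 (xi y - xi x); have := cabs_ge0 (eta y - eta x).
move: (cabs (xi y - xi x)) (cabs (eta y - eta x)) h1 h2 => u v h1 h2 v0 u0 h3.
by apply: le_trans (lerD (lexx _) h3) _; nra.
Qed.

Lemma econt_conj xi : econt xi -> econt (fun x => (xi x)^*%R).
Proof.
move=> cx x xt e e0; have [p xp pP] := cx x xt e e0; exists p => // y yt yp.
by rewrite -rmorphB cabsC; exact: pP.
Qed.

(* x |-> eta(x.t), extended by 0. *)
Definition pull t eta : character -> Cplx R := fun x =>
  xget 0 [set z | exists2 g, rg g = x /\ gin g t & z = eta (sr g)].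

Lemma pull_in g t eta : gin g t -> pull t eta (rg g) = eta (sr g).
Proof.
move=> gt; rewrite /pull; apply: xget_unique; first by exists g.
by move=> z [h [hg ht] ->]; rewrite (gin_inj_rg T1 ht gt hg).
Qed.

Lemma pull_out x t eta : ~ ev x (t ** t^!) -> pull t eta x = 0.
Proof.
move=> nx; apply: xgetPN => z [g [gx gt] _]; apply: nx.
by rewrite -gx; exact: rg_gin.
Qed.

Lemma pull_bound t eta x b : tight_character x -> 0 <= b ->
  (forall x, tight_character x -> cabs (eta x) <= b) -> cabs (pull t eta x) <= b.
Proof.
move=> xt b0 eb; have [[g [gx gt]]|ng] := pselect (exists g, rg g = x /\ gin g t).
  by rewrite -gx pull_in //; apply: eb; exact: (sr_tight T1 TC).
rewrite /pull xgetPN ?cabs0 // => z [g [gx gt] _].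
by apply: ng; exists g.
Qed.

(** If q isolates a neighbourhood of the source, then t q t^! isolates the corresponding one of the
    range. Where t has no germ the function is locally 0, the domain of t being open and closed in
    the tight spectrum. *)
Lemma econt_pull t eta : T t -> econt eta -> econt (pull t eta).
Proof.
move=> Tt ce x xt e e0; have Et := range_idem hT Tt.
have [xtt|nx] := pselect (ev x (t ** t^!)); last first.
  exists (cone - t ** t^!); first by apply/(tight_compl T1 TC xt).
  move=> y yt /(tight_compl T1 TC yt Et) ny.
  by rewrite !pull_out // subrr cabs0 ltW.
have [g gx gt] := ginP T1 TC xt Tt xtt.
have [q sq qP] := ce (sr g) (sr_tight T1 TC g) e e0; have Eq := ev_idem sq.
have Etq := conj_idem hT Tt Eq.
exists (t ** q ** t^!); first by rewrite -gx; apply/sr_gin.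
move=> y yt yq; have ytt : ev y (t ** t^!).
  apply: (ev_le Et _ yq); rewrite -!cmulA (cmulA t^! t).
  by have := isub_pisom hT (isubV hT Tt); rewrite adjK => ->.
have [h hy ht] := ginP T1 TC yt Tt ytt.
rewrite -hy -gx !pull_in //; apply: qP; first exact: (sr_tight T1 TC).
by apply/(sr_gin ht) => //; rewrite hy.
Qed.

Lemma econt_bounded xi : econt xi ->
  exists2 b : R, 0 <= b & forall x, tight_character x -> cabs (xi x) <= b.
Proof.
move=> cx; pose Q p := exists2 b : R, 0 <= b & forall x, tight_character x -> ev x p -> cabs (xi x) <= b.
have [||n [e [eQ eO eS]]] := @tight_partition _ _ _ hT T1 TC Q.
- move=> x xt; have [p xp pP] := cx x xt 1 ltr01; exists p => //.
  exists (cabs (xi x) + 1); first by rewrite addr_ge0 ?cabs_ge0.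
  move=> y yt yp; rewrite -[xi y](subrK (xi x)); apply: le_trans (cabsD _ _) _.
  by rewrite addrC lerD // pP.
- move=> p q [b b0 bP] Ep Eq; exists b => // x xt /(evM _ Ep Eq)[xp _]; exact: bP.
have /choice[b bP] : forall i, exists b : R, 0 <= b /\
   forall x, tight_character x -> ev x (e i) -> cabs (xi x) <= b.
  by move=> i; have [_ [b b0 h]] := eQ i; exists b.
exists (\sum_i b i); first by apply: sumr_ge0 => i _; case: (bP i).
move=> x xt; have [i xi'] := ev_partition T1 TC xt (fun i => (eQ i).1) eS.
apply: le_trans ((bP i).2 x xt xi') _; rewrite (bigD1 i) //= lerDl.
by apply: sumr_ge0 => j _; case: (bP j).
Qed.

(* On each fibre of the range map such a function has finite support. *)
Definition fsupp f : Prop := exists (I : finType) (t : I -> A),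
  forall g, (forall i, ~ gin g (t i)) -> f g = 0.

Lemma fsupp_theta_fun xi t : fsupp (theta_fun xi t).
Proof. by exists unit, (fun=> t) => g /(_ tt); exact: theta_fun_out. Qed.

Lemma fsupp_lin c f f' : fsupp f -> fsupp f' -> fsupp (c *: f + f').
Proof.
move=> [I [t ft]] [J [t' ft']].
exists (I + J)%type, (fun s => match s with inl i => t i | inr j => t' j end) => g ng.
rewrite [LHS](_ : _ = c *: f g + f' g) // ft ?ft' ?scaler0 ?addr0 //.
  by move=> j; have := ng (inr j).
by move=> i; have := ng (inl i).
Qed.

(** A factorization k = a b is determined by a, which has the range of k, and each theta(t_i)
    contains at most one such a. The list depends only on [t] and [k], so convolutions can be
    compared term by term. *)
Lemma convolution_list (I : finType) (t : I -> A) k :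
  exists r : seq (G * G), forall f (h : G -> Cplx R), (forall g, (forall i, ~ gin g (t i)) -> f g = 0) ->
    convolution f h k = \sum_(p <- r) f p.1 * h p.2.
Proof.
pose K i := exists2 g, rg g = rg k & gin g (t i).
have /choice[g gP] : forall i, exists g, K i -> rg g = rg k /\ gin g (t i).
  by move=> i; have [[g gk gt]|nK] := pselect (K i); [exists g | exists k].
pose r : seq (G * G)%type := undup [seq (g i, gmul (ginv (g i)) k) | i <- enum I & `[< K i >]].
have rK (p : (G * G)%type) : p \in r -> exists2 i, K i & p = (g i, gmul (ginv (g i)) k).
  rewrite mem_undup => pr; have [i iK ->] := mapP pr.
  by exists i => //; move: iK; rewrite mem_filter => /andP[/asboolP].
exists r => f h fz; rewrite /convolution (fsbigE r) ?undup_uniq //.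
- rewrite big_seq_cond [RHS]big_seq_cond; apply: eq_bigl => p; rewrite andbT.
  apply: andb_idr => pr; apply: mem_set.
  have {pr}[i Ki ->] /= := rK _ pr.
  have [gk gt] := gP i Ki.
  have ck : composable (ginv (g i)) k by rewrite composableE sr_inv gk.
  have [_ h2 _] := gmulA (gcompVr (g i)) ck.
  by split=> //; have := gmulKl ck; rewrite ginvK.
- move=> p /= pr; have {pr}[i Ki ->] /= := rK _ pr.
  have [gk gt] := gP i Ki.
  have ck : composable (ginv (g i)) k by rewrite composableE sr_inv gk.
  have [_ h2 _] := gmulA (gcompVr (g i)) ck.
  by split=> //; have := gmulKl ck; rewrite ginvK.
- move=> [a b] /= [ab abk] nr; rewrite fz ?mul0r // => i ai.
  have ak : rg a = rg k by rewrite -abk rg_mul.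
  have Ki : K i by exists a.
  have [gk gt] := gP i Ki; have ga : g i = a by apply: (gin_inj_rg T1 gt ai); rewrite gk ak.
  move/negP: nr; apply; rewrite mem_undup; apply/mapP; exists i.
    by rewrite mem_filter mem_enum andbT; exact/asboolP.
  by rewrite ga -abk gmulKl.
Qed.

Lemma convolution_linl c f f' (h : G -> Cplx R) : fsupp f -> fsupp f' ->
  convolution (c *: f + f') h = c *: convolution f h + convolution f' h.
Proof.
move=> [I [t ft]] [J [t' ft']]; apply/funext => k.
have [r rP] := @convolution_list (I + J)%type (fun s => match s with inl i => t i | inr j => t' j end) k.
have ft1 g : (forall s : I + J, ~ gin g (match s with inl i => t i | inr j => t' j end)) -> f g = 0.
  by move=> ng; apply: ft => i; exact: (ng (inl i)).
have ft2 g : (forall s : I + J, ~ gin g (match s with inl i => t i | inr j => t' j end)) -> f' g = 0.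
  by move=> ng; apply: ft' => i; exact: (ng (inr i)).
rewrite [RHS](_ : _ = c * convolution f h k + convolution f' h k) // !rP //; last first.
  by move=> g ng; rewrite [LHS](_ : _ = c * f g + f' g) // ft1 // ft2 // mulr0 addr0.
rewrite mulr_sumr -big_split /=; apply: eq_bigr => p _.
by rewrite mulrA -mulrDl.
Qed.

Lemma convolution_linr c f (h h' : G -> Cplx R) : fsupp f ->
  convolution f (c *: h + h') = c *: convolution f h + convolution f h'.
Proof.
move=> [I [t ft]]; apply/funext => k; have [r rP] := convolution_list t k.
rewrite [RHS](_ : _ = c * convolution f h k + convolution f h' k) // !rP //.
rewrite mulr_sumr -big_split /=; apply: eq_bigr => p _.
by rewrite mulrCA -mulrDr.
Qed.

(** Only one factorization of [k] contributes, the one whose first factor is the germ of [t] at the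
    range of [k]; [pull] carries [eta] from the source of that germ to its range. *)
Lemma convolution_theta_fun xi eta t t' : T t -> T t' ->
  convolution (theta_fun xi t) (theta_fun eta t') = theta_fun (fun x => xi x * pull t eta x) (t ** t').
Proof.
move=> Tt Tt'; apply/funext => k.
have E' := range_idem hT Tt'; have E1 := conj_idem hT Tt E'; have Et := range_idem hT Tt.
have [ktt|nk] := pselect (ev (rg k) (t ** t^!)); last first.
  rewrite /convolution fsbig1; last first.
    move=> [a b] /= [ab abk]; rewrite theta_fun_out ?mul0r // => ag.
    by apply: nk; rewrite -abk rg_mul //; exact: rg_gin.
  have [kt|kt] := pselect (gin k (t ** t')); last by rewrite theta_fun_out.
  by rewrite theta_fun_in // pull_out // mulr0.
have [g gk gt] := ginP T1 TC (rg_tight k) Tt ktt.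
have ck : composable (ginv g) k by rewrite composableE sr_inv gk.
have gkk : gmul g (gmul (ginv g) k) = k by have := gmulKl ck; rewrite ginvK.
have [_ gc _] := gmulA (gcompVr g) ck.
rewrite /convolution (fsbigE [:: (g, gmul (ginv g) k)]) //.
- rewrite big_mkcond big_seq1 /= mem_set //= (theta_fun_in _ gt).
  set h := gmul (ginv g) k in gkk gc *.
  have rh : rg h = sr g by rewrite rg_mul // rg_inv.
  have [ht|nh] := pselect (gin h t').
    have kt : gin k (t ** t') by rewrite -gkk; exact: gin_mul.
    by rewrite (theta_fun_in _ ht) rh (theta_fun_in _ kt) -gk pull_in.
  rewrite (theta_fun_out _ nh) mulr0 theta_fun_out // => kt; apply: nh.
  have := gin_mul (gin_inv gt) kt ck; rewrite cmulA -/h.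
  have Et2 : E (t^! ** t) by have := range_idem hT (isubV hT Tt); rewrite adjK.
  by move=> /(gin_idem_mul T1 TC _ Et2 Tt')[].
- by move=> p; rewrite /= inE => /eqP ->; split.
- move=> [a b] /= [ab abk] nr; rewrite theta_fun_out ?mul0r // => at'; move/negP: nr; apply.
  have ga : a = g by apply: (gin_inj_rg T1 at' gt); rewrite gk -abk rg_mul.
  rewrite inE -ga -abk; apply/eqP; congr (_, _); symmetry; exact: (@gmulKl G a b ab).
Qed.

Lemma involution_theta_fun xi t : T t ->
  involution (theta_fun xi t) = theta_fun (pull t^! (fun x => (xi x)^*%R)) t^!.
Proof.
move=> Tt; apply/funext => g; rewrite /involution.
have [gt|ng] := pselect (gin g t^!).
  have gt' : gin (ginv g) t by have := gin_inv gt; rewrite adjK.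
  by rewrite (theta_fun_in _ gt') (theta_fun_in _ gt) pull_in // rg_inv.
rewrite (theta_fun_out _ ng) theta_fun_out ?rmorph0 // => gt; apply: ng.
by have := gin_inv gt; rewrite ginvK.
Qed.

Lemma theta_fun_ext xi eta t : (forall x, tight_character x -> ev x (t ** t^!) -> xi x = eta x) ->
  theta_fun xi t = theta_fun eta t.
Proof.
move=> xe; apply/funext => g; have [gt|ng] := pselect (gin g t); last by rewrite !theta_fun_out.
by rewrite !theta_fun_in //; apply: xe; [exact: rg_tight | exact: rg_gin].
Qed.

Lemma pull_cst c t x : tight_character x -> T t -> ev x (t ** t^!) -> pull t (fun=> c) x = c.
Proof. by move=> xt Tt xtt; have [g <- gt] := ginP T1 TC xt Tt xtt; rewrite pull_in. Qed.

Lemma convolution_chi t t' : T t -> T t' ->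
  convolution (chi t) (chi t') = chi (t ** t').
Proof.
move=> Tt Tt'; rewrite /chi convolution_theta_fun //; apply: theta_fun_ext => x xt xtt.
rewrite mul1r pull_cst //; apply: ev_le xtt; first exact: range_idem.
have E' := range_idem hT Tt'.
rewrite adjM -!cmulA (cmulA t^! t).
by have := isub_pisom hT (isubV hT Tt); rewrite adjK => ->.
Qed.

Lemma involution_chi t : T t -> involution (chi t) = chi t^!.
Proof.
move=> Tt; rewrite /chi involution_theta_fun //; apply: theta_fun_ext => x xt xtt.
by rewrite rmorph1 pull_cst //; exact: isubV.
Qed.

End ConvolutionAlgebra.

(** * Compactness of the sets theta(t) and decomposition of C_c(U) *)

Section CompactSupport.
Variables (R : realType) (A : unitalCStarAlgType R) (T : set A).
Hypothesis hT : inverse_subsemigroup T.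
Hypothesis T1 : T cone.
Hypothesis TC : forall e, T e -> e ** e = e -> T (cone - e).

Local Notation S := (isg_of hT).
Local Notation E := (idem_in T).
Local Notation G := (tight_groupoid S).
Local Notation character := (Defs.character S).
Local Notation econt := (@econt R A T hT).
Implicit Types (x y : character) (g h k : G) (t : A) (xi eta : character -> Cplx R).
Implicit Types (f : G -> Cplx R).

(** Without a cluster point, each tight character has an idempotent over which theta(t) misses some
    member of the filter. A finite partition into such idempotents makes theta(t) miss an
    intersection of finitely many members. *)
Lemma gin_compact t : T t -> compact [set g : G | gin g t].
Proof.
move=> Tt F FF Ft; apply: contrapT => nc; have Et := range_idem hT Tt.
pose Q e := exists2 B, F B & forall g, gin g t -> ev (rg g) e -> ~ B g.
have [||n [e [eQ eO eS]]] := @tight_partition _ _ _ hT T1 TC Q.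
- move=> x xt; have [xtt|nx] := pselect (ev x (t ** t^!)); last first.
    exists (cone - t ** t^!); first by apply/(tight_compl T1 TC xt).
    exists setT; first exact: filterT.
    by move=> g gt /(tight_compl T1 TC (rg_tight g) Et) /(_ (rg_gin gt)).
  have [g gx gt] := ginP T1 TC xt Tt xtt.
  have : ~ cluster F g by move=> cg; apply: nc; exists g.
  move=> /existsNP[B /existsNP[C /not_implyP[FB /not_implyP[gC BC]]]].
  have [t' gt' t'C] : exists2 t', gin g t' & forall h, gin h t' -> C h.
    have := open_gin T1 TC (open_interior C) (gC : C^° g).
    by move=> [t' gt' h]; exists t' => // k /h/interior_subset.
  have [p gp pP] := gin_transfer T1 TC gt gt'.
  exists p; first by rewrite -gx.
  by exists B => // h ht hp Bh; apply: BC; exists h; split=> //; apply/t'C/pP.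
- move=> p q [B FB h] Ep Eq; exists B => // g gt /(evM _ Ep Eq)[gp _]; exact: h.
have /choice[B BP] : forall i, exists B, F B /\
    forall g, gin g t -> ev (rg g) (e i) -> ~ B g.
  by move=> i; have [_ [B FB h]] := eQ i; exists B.
have FBt : F ([set g : G | gin g t] `&` [set g : G | forall i, B i g]).
  by apply: filterI => //; apply: filter_forall => i; case: (BP i).
have [g [gt gB]] := filter_ex FBt.
have [i gi] := ev_partition T1 TC (rg_tight g) (fun i => (eQ i).1) eS.
exact: (BP i).2 g gt gi (gB i).
Qed.

Lemma gin_bisection t : bisection [set g : G | gin g t].
Proof.
split=> g h; rewrite !inE => gt ht gh.
  by apply: (gin_inj_rg T1 gt ht); rewrite -rg_grange gh rg_grange.
by apply: (gin_inj_sr T1 gt ht); rewrite -rg_gsource gh rg_gsource.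
Qed.

Lemma bisection_fun_theta_fun xi t : T t -> econt xi -> bisection_fun (theta_fun xi t).
Proof.
move=> Tt cx; exists [set g : G | gin g t], [set g : G | gin g t]; split=> //.
- exact: gin_open.
- exact: gin_bisection.
- exact: gin_compact.
split; last by move=> g; exact: theta_fun_out.
apply/subspace_continuousP => g gt; apply/cvgrPdist_le => e /gt0_real_complex[d d0 ->].
have [p gp pP] := cx (rg g) (rg_tight g) d d0; have Ep := ev_idem gp.
have gpt : gin g (p ** t) by apply/(gin_idem_mul T1 TC).
have : nbhs g [set h : G | gin h (p ** t)] by apply: open_nbhs_nbhs; split => //; exact: gin_open.
apply: filterS => h /(gin_idem_mul T1 TC _ Ep Tt)[hp _] ht.
rewrite -[X in is_true X]/(`|theta_fun xi t g - theta_fun xi t h| <= d%:K).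
rewrite !theta_fun_in // cabsE lecR cabs_distC; apply: pP => //; exact: rg_tight.
Qed.

(** 1 is partitioned so that, over each piece, the compact support lies in a single theta(t) inside
    U; over a piece that avoids the range of the support, t = 0 serves. *)
Lemma bisection_fun_sum f : bisection_fun f ->
  exists n (xi : 'I_n -> character -> Cplx R) (t : 'I_n -> A),
    (forall i, T (t i) /\ econt (xi i)) /\ forall g, f g = \sum_i theta_fun (xi i) (t i) g.
Proof.
move=> [U [K [oU [Ug Us] cK KU [cf f0]]]].
have Urg g h : U g -> U h -> rg g = rg h -> g = h.
  move=> gU hU gh; apply: Ug; rewrite ?inE //; exact: grange_rg.
pose Q e := exists t, [/\ T t, forall g, gin g t -> U g &
   forall g, K g -> ev (rg g) e -> gin g t].
have [||n [e [eQ eO eS]]] := @tight_partition _ _ _ hT T1 TC Q.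
- move=> x xt; have [[k [Kk kx]]|nk] := pselect (exists k, K k /\ rg k = x).
    have [t kt tU] := open_gin T1 TC oU (KU _ Kk); have Tt := gin_T kt.
    exists (t ** t^!); first by rewrite -kx; exact: rg_gin.
    exists t; split=> // g Kg gtt; have [h hg ht] := ginP T1 TC (rg_tight g) Tt gtt.
    by rewrite (Urg g h) //; [exact: KU | exact: tU].
  (* Here [x] is not the range of a point of [K]. [F] is the filter of idempotents shrinking to [x];
     near-covering compactness of [K] along it gives one idempotent that separates [x] from all of
     these ranges. *)
  pose F : set_system A := [set B | exists2 e, ev x e & forall p, ev x p -> p ** e = p -> B p].
  have FF : Filter F.
    split.
    - by exists cone => //; exact: ev1.
    - move=> B C [p xp pB] [q xq qC]; have [Ep Eq] := (ev_idem xp, ev_idem xq).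
      exists (p ** q); first by apply/evM.
      move=> r xr rpq; split; [apply: pB => // | apply: qC => //].
        by rewrite -{1}rpq (idem_inC hT Ep Eq) -!cmulA Ep.2 -(idem_inC hT Ep Eq).
      by rewrite -{1}rpq -!cmulA Eq.2.
    - by move=> B C BC [p xp pB]; exists p => // r xr rp; apply/BC/pB.
  have := (compact_near_coveringP K).1 cK A F (fun p k => ~ ev (rg k) p) FF.
  case=> [k Kk|p xp pK].
    have [q xq nq] : exists2 q, ev x q & ~ ev (rg k) q.
      apply: contrapT => nq; apply: nk; exists k; split=> //.
      apply: ev_ext => q; split=> [kq|xq]; last by apply: contrapT => ?; apply: nq; exists q.
      have Eq := ev_idem kq; apply: contrapT => nxq; apply: nq; exists (cone - q).
        by apply/(tight_compl T1 TC xt).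
      exact: ev_disj kq.
    have Eq := ev_idem xq; have kq : ev (rg k) (cone - q).
      by apply/(tight_compl T1 TC (rg_tight k)).
    have [t kt] := gin_ex k; have Tt := gin_T kt.
    exists ([set h : G | gin h ((cone - q) ** t)], [set p | p ** q = p]).
      split; last by exists q.
      apply: open_nbhs_nbhs; split; first exact: gin_open.
      by apply/(gin_idem_mul T1 TC) => //; exact: idem_inB.
    move=> [h p] /= [/(gin_idem_mul T1 TC _ (idem_inB TC Eq) Tt)[hq _] pq] hp.
    by move: hq; apply: ev_disj; apply: (ev_le Eq pq).
  exists p => //; exists 0; split; first exact: isub0 hT.
    by move=> g /rg_gin; rewrite cmul0x => /ev0.
  have Ep := ev_idem xp; move=> g Kg gp; exfalso; apply: (pK p xp _ g Kg) => //.
  exact: Ep.2.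
- move=> p q [t [Tt tU tK]] Ep Eq; exists t; split=> // g Kg /(evM _ Ep Eq)[gp _].
  exact: tK.
have /choice[t tP] : forall i, exists t, [/\ T t, forall g, gin g t -> U g &
   forall g, K g -> ev (rg g) (e i) -> gin g t].
  by move=> i; have [_ [t h]] := eQ i; exists t.
(* [f] on theta(t_i), transported to ranges by the inverse of the injective range map. *)
pose xi i x := xget 0 [set z | exists2 g, rg g = x /\ gin g (t i) & z = f g].
have xiE i g : gin g (t i) -> xi i (rg g) = f g.
  move=> gt; rewrite /xi; apply: xget_unique; first by exists g.
  by move=> z [h [hg ht] ->]; rewrite (gin_inj_rg T1 ht gt hg).
have xi0 i x : ~ ev x (t i ** (t i)^!) -> xi i x = 0.
  move=> nx; rewrite /xi xgetPN // => z [g [gx gt] _]; apply: nx.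
  by rewrite -gx; exact: rg_gin.
have eE i : E (e i) := (eQ i).1.
exists n, xi, (fun i => e i ** t i); split.
  move=> i; have [Tt tU tK] := tP i; split; first exact: (isubM hT (eE i).1 Tt).
  move=> x xt d d0; have Et := range_idem hT Tt.
  have [xtt|nx] := pselect (ev x (t i ** (t i)^!)); last first.
    exists (cone - t i ** (t i)^!); first by apply/(tight_compl T1 TC xt).
    move=> y yt /(tight_compl T1 TC yt Et) ny.
    by rewrite !xi0 // subrr cabs0 ltW.
  have [g gx gt] := ginP T1 TC xt Tt xtt.
  have := (subspace_continuousP _ _).1 cf g (tU g gt).
  move=> /cvgrPdist_le/(_ (d%:K)); rewrite ltcR => /(_ d0) fnear.
  have [B oB [Bg BU]] : exists2 B, open B & B g /\ forall h, B h -> U h -> cabs (f g - f h) <= d.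
    move: fnear; rewrite /prop_near1 /= /within /= nbhsE => -[B [oB Bg] BP].
    exists B => //; split=> // h /BP + Uh => /(_ Uh) /=.
    by rewrite cabsE lecR.
  have [t' gt' t'B] := open_gin T1 TC oB Bg.
  have [p gp pP] := gin_transfer T1 TC gt gt'.
  have Ep := ev_idem gp.
  exists (p ** (t i ** (t i)^!)); first by rewrite -gx; apply/evM => //; split=> //; exact: rg_gin.
  move=> y yt /(evM _ Ep Et)[yp ytt].
  have [h hy ht] := ginP T1 TC yt Tt ytt.
  rewrite -hy -gx !xiE // cabs_distC; apply: BU; last exact: tU.
  by apply/t'B/pP => //; rewrite hy.
move=> g; have [i gi] := ev_partition T1 TC (rg_tight g) eE eS.
rewrite (bigD1 i) //= big1 ?addr0; last first.
  move=> j ji; apply: theta_fun_out => /(gin_idem_mul T1 TC _ (eE j) _)[]; first by case: (tP j).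
  by move=> gj _; apply: (ev_orth gj gi); exact: eO.
have [Tt tU tK] := tP i.
have [gt|gt] := pselect (gin g (t i)).
  by rewrite theta_fun_in ?xiE //; apply/(gin_idem_mul T1 TC).
rewrite theta_fun_out; last by move=> /(gin_idem_mul T1 TC _ (eE i) Tt)[].
by apply: f0 => Kg; apply: gt; exact: tK.
Qed.

End CompactSupport.

(** * The representation of C_c in A *)

Section Integration.
Variables (R : realType) (A : unitalCStarAlgType R) (T : set A).
Hypothesis hT : inverse_subsemigroup T.
Hypothesis T1 : T cone.
Hypothesis TC : forall e, T e -> e ** e = e -> T (cone - e).

Local Notation S := (isg_of hT).
Local Notation E := (idem_in T).
Local Notation G := (tight_groupoid S).
Local Notation character := (Defs.character S).
Local Notation econt := (@econt R A T hT).
Local Notation chi := (@chi R A T hT).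
Implicit Types (x y : character) (t a : A) (xi eta : character -> Cplx R).
Implicit Types (f h : G -> Cplx R).

(** The graph of the linear extension of 1_{theta(t)} |-> t. It is a relation because presentations
    of [f] are not unique; [simple_small] makes it single-valued. *)
Definition simple_fun f a : Prop := exists (I : finType) (c : I -> Cplx R) (t : I -> A),
  [/\ forall i, T (t i), f = \sum_i c i *: chi (t i) & a = \sum_i c i *: t i].

(** The infimum of the admissible [b] is the auxiliary norm on C_c, of l^1 type over decompositions
    and sup type on each piece. It is compatible with convolution and involution, and it bounds
    every representation by [pi_small]. *)
Definition small_fun f (b : R) : Prop :=
  exists (I : finType) (xi : I -> character -> Cplx R) (t : I -> A) (B : I -> R),
  [/\ forall i, [/\ T (t i), econt (xi i), 0 <= B i &
        forall x, tight_character x -> cabs (xi i x) <= B i],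
      f = \sum_i theta_fun (xi i) (t i) & \sum_i B i <= b].

Lemma econtD xi eta : econt xi -> econt eta -> econt (fun x => xi x + eta x).
Proof.
move=> cx ce x xt e e0; have e2 : 0 < e / 2 by rewrite divr_gt0.
have [p xp pP] := cx x xt _ e2; have [q xq qP] := ce x xt _ e2.
have [Ep Eq] := (ev_idem xp, ev_idem xq).
exists (p ** q); first by apply/evM.
move=> y yt /(evM _ Ep Eq)[yp yq].
have -> : xi y + eta y - (xi x + eta x) = (xi y - xi x) + (eta y - eta x) by ring.
apply: le_trans (cabsD _ _) _; have := pP y yt yp; have := qP y yt yq; lra.
Qed.

Lemma econt_sum (I : finType) (xi : I -> character -> Cplx R) :
  (forall i, econt (xi i)) -> econt (fun x => \sum_i xi i x).
Proof.
move=> cx; elim: (index_enum I) => [|i s IH].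
  have -> : (fun x => \sum_(i <- [::]) xi i x) = fun=> 0.
    by apply/funext => x; rewrite big_nil.
  exact: econt_cst.
have -> : (fun x => \sum_(j <- i :: s) xi j x) = fun x => xi i x + \sum_(j <- s) xi j x.
  by apply/funext => x; rewrite big_cons.
exact: econtD.
Qed.

Definition ind e x : Cplx R := if pselect (ev x e) then 1 else 0.

Lemma ind1 e x : ev x e -> ind e x = 1. Proof. by rewrite /ind; case: pselect. Qed.
Lemma ind0 e x : ~ ev x e -> ind e x = 0. Proof. by rewrite /ind; case: pselect. Qed.

Lemma econt_ind e : E e -> econt (ind e).
Proof.
move=> Ee x xt d d0; have [xe|xe] := pselect (ev x e).
  by exists e => // y _ ye; rewrite !ind1 // subrr cabs0 ltW.
exists (cone - e); first by apply/(tight_compl T1 TC xt).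
by move=> y yt /(tight_compl T1 TC yt Ee) ye; rewrite !ind0 // subrr cabs0 ltW.
Qed.

Lemma small_theta_fun xi t B : T t -> econt xi -> 0 <= B ->
  (forall x, tight_character x -> cabs (xi x) <= B) -> small_fun (theta_fun xi t) B.
Proof.
move=> Tt cx B0 xB; exists unit, (fun=> xi), (fun=> t), (fun=> B); split=> //.
  by rewrite (big_pred1 tt) // => -[].
by rewrite (big_pred1 tt) // => -[].
Qed.

Lemma small_le f b b' : b <= b' -> small_fun f b -> small_fun f b'.
Proof.
by move=> bb' [I [xi [t [B [h fE Bb]]]]]; exists I, xi, t, B; split=> //; exact: le_trans Bb _.
Qed.

Lemma smallD f h b b' : small_fun f b -> small_fun h b' -> small_fun (f + h) (b + b').
Proof.
move=> [I [xi [t [B [P fE Bb]]]]] [J [eta [t' [B' [P' hE Bb']]]]].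
exists (I + J)%type,
  (fun s => match s with inl i => xi i | inr j => eta j end),
  (fun s => match s with inl i => t i | inr j => t' j end),
  (fun s => match s with inl i => B i | inr j => B' j end); split.
- by case=> i; [exact: P | exact: P'].
- by rewrite big_sumType /= fE hE.
- by rewrite big_sumType /= lerD.
Qed.

Lemma scaler_theta_fun c xi t : c *: theta_fun xi t = theta_fun (fun x => c * xi x) t :> (G -> Cplx R).
Proof.
apply/funext => g; rewrite [LHS](_ : _ = c * theta_fun xi t g) //.
have [gt|gt] := pselect (gin g t); first by rewrite !theta_fun_in.
by rewrite !theta_fun_out // mulr0.
Qed.

Lemma smallZ c f b : small_fun f b -> small_fun (c *: f) (cabs c * b).
Proof.
move=> [I [xi [t [B [P fE Bb]]]]].
exists I, (fun i x => c * xi i x), t, (fun i => cabs c * B i); split.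
- move=> i; have [Tt cx B0 xB] := P i; split=> //.
  + by apply: econtM => //; exact: econt_cst.
  + by rewrite mulr_ge0 // cabs_ge0.
  + by move=> x xt; rewrite cabsM ler_wpM2l ?cabs_ge0 // xB.
- by rewrite fE scaler_sumr; apply: eq_bigr => i _; rewrite scaler_theta_fun.
- by rewrite -mulr_sumr ler_wpM2l // cabs_ge0.
Qed.

Lemma smallN f b : small_fun f b -> small_fun (- f) b.
Proof. by move=> /(smallZ (-1)); rewrite scaleN1r cabsN cabs1 mul1r. Qed.

Lemma smallB f h b b' : small_fun f b -> small_fun h b' -> small_fun (f - h) (b + b').
Proof. by move=> sf /smallN; exact: smallD. Qed.

Lemma small0 : small_fun 0 0.
Proof.
exists void, (fun _ _ => 0), (fun=> 0), (fun=> 0); split; first by case.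
  by rewrite big_pred0 // => -[].
by rewrite big1.
Qed.

Lemma fsupp_sum (I : Type) (s : seq I) (F : I -> G -> Cplx R) :
  (forall i, fsupp (F i)) -> fsupp (\sum_(i <- s) F i).
Proof.
move=> h; elim: s => [|i s IH]; first by rewrite big_nil; exists void, (fun=> 0).
by rewrite big_cons -[F i]scale1r; exact: fsupp_lin.
Qed.

Lemma fsupp_small f b : small_fun f b -> fsupp f.
Proof.
by move=> [I [xi [t [B [P -> _]]]]]; apply: fsupp_sum => i; exact: fsupp_theta_fun.
Qed.

Lemma convolution0l h : convolution 0 h = 0.
Proof. by apply/funext => k; rewrite /convolution fsbig1 // => p _; rewrite mul0r. Qed.

Lemma convolution0r f : convolution f 0 = 0.
Proof. by apply/funext => k; rewrite /convolution fsbig1 // => p _; rewrite mulr0. Qed.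

Lemma convolutionDl f f' h : fsupp f -> fsupp f' ->
  convolution (f + f') h = convolution f h + convolution f' h.
Proof. by move=> sf sf'; have := convolution_linl T1 1 h sf sf'; rewrite !scale1r. Qed.

Lemma convolutionDr f h h' : fsupp f ->
  convolution f (h + h') = convolution f h + convolution f h'.
Proof. by move=> sf; have := convolution_linr T1 1 h h' sf; rewrite !scale1r. Qed.

Lemma convolutionZl c f h : fsupp f -> convolution (c *: f) h = c *: convolution f h.
Proof.
move=> sf; have s0 : fsupp (0 : G -> Cplx R) by exact: fsupp_small small0.
by have := convolution_linl T1 c h sf s0; rewrite convolution0l !addr0.
Qed.

Lemma convolutionZr c f h : fsupp f -> convolution f (c *: h) = c *: convolution f h.
Proof.
by move=> sf; have := convolution_linr T1 c h 0 sf; rewrite convolution0r !addr0.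
Qed.

Lemma convolution_sum (I J : Type) (r : seq I) (s : seq J) (F : I -> G -> Cplx R)
    (H : J -> G -> Cplx R) : (forall i, fsupp (F i)) ->
  convolution (\sum_(i <- r) F i) (\sum_(j <- s) H j) =
  \sum_(i <- r) \sum_(j <- s) convolution (F i) (H j).
Proof.
move=> sF; elim: r => [|i r IH]; first by rewrite !big_nil convolution0l.
rewrite !big_cons convolutionDl // ?IH; last exact: fsupp_sum.
congr (_ + _); elim: s {IH} => [|j s IH]; first by rewrite !big_nil convolution0r.
by rewrite !big_cons convolutionDr // IH.
Qed.

Lemma small_conv f h b b' : small_fun f b -> small_fun h b' -> 0 <= b ->
  small_fun (convolution f h) (b * b').
Proof.
move=> [I [xi [t [B [P fE Bb]]]]] [J [eta [t' [B' [P' hE Bb']]]]] b0.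
exists (I * J)%type, (fun p x => xi p.1 x * pull (t p.1) (eta p.2) x),
  (fun p => t p.1 ** t' p.2), (fun p => B p.1 * B' p.2); split.
- move=> [i j] /=; have [Tt cx B0 xB] := P i; have [Tt' ce B'0 eB] := P' j; split.
  + exact: isubM.
  + by apply: econtM => //; exact: econt_pull.
  + exact: mulr_ge0.
  + move=> x xt; rewrite cabsM; apply: ler_pM; rewrite ?cabs_ge0 ?xB //.
    exact: pull_bound.
- rewrite fE hE convolution_sum; last by move=> i; exact: fsupp_theta_fun.
  rewrite pair_big /=; apply: eq_bigr => -[i j] _ /=.
  by have [Tt _ _ _] := P i; have [Tt' _ _ _] := P' j; rewrite convolution_theta_fun.
- rewrite -(pair_big xpredT xpredT (fun i j => B i * B' j)) /=.
  rewrite -big_distrlr /=; apply: ler_pM => //.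
    by apply: sumr_ge0 => i _; case: (P i).
  by apply: sumr_ge0 => j _; case: (P' j).
Qed.

Lemma involutionD f h : involution (f + h) = involution f + involution h.
Proof. by apply/funext => g; rewrite /involution /= rmorphD. Qed.

Lemma involutionZ c f : involution (c *: f) = (c^*)%R *: involution f.
Proof. by apply/funext => g; rewrite /involution /= rmorphM. Qed.

Lemma involution_sum (I : Type) (s : seq I) (F : I -> G -> Cplx R) :
  involution (\sum_(i <- s) F i) = \sum_(i <- s) involution (F i).
Proof.
apply: (big_morph (@involution R G)) => [|]; first exact: involutionD.
by apply/funext => g; rewrite /involution /= rmorph0.
Qed.

Lemma small_inv f b : small_fun f b -> small_fun (involution f) b.
Proof.
move=> [I [xi [t [B [P fE Bb]]]]].
exists I, (fun i => pull (t i)^! (fun x => (xi i x)^*%R)), (fun i => (t i)^!), B; split=> //.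
- move=> i; have [Tt cx B0 xB] := P i; split=> //.
  + exact: isubV.
  + by apply: econt_pull => //; [exact: isubV | exact: econt_conj].
  + by move=> x xt; apply: pull_bound => // y yt; rewrite cabsC xB.
- rewrite fE involution_sum; apply: eq_bigr => i _.
  by have [Tt _ _ _] := P i; rewrite involution_theta_fun.
Qed.

Lemma simpleD f h a b : simple_fun f a -> simple_fun h b -> simple_fun (f + h) (a + b).
Proof.
move=> [I [c [t [tT fE aE]]]] [J [d [t' [tT' hE bE]]]].
exists (I + J)%type, (fun s => match s with inl i => c i | inr j => d j end),
  (fun s => match s with inl i => t i | inr j => t' j end); split.
- by case.
- by rewrite big_sumType /= fE hE.
- by rewrite big_sumType /= aE bE.
Qed.

Lemma simpleZ c f a : simple_fun f a -> simple_fun (c *: f) (c *: a).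
Proof.
move=> [I [d [t [tT fE aE]]]]; exists I, (fun i => c * d i), t; split=> //.
  by rewrite fE scaler_sumr; apply: eq_bigr => i _; rewrite scalerA.
by rewrite aE scaler_sumr; apply: eq_bigr => i _; rewrite scalerA.
Qed.

Lemma simpleB f h a b : simple_fun f a -> simple_fun h b -> simple_fun (f - h) (a - b).
Proof. by move=> sf /(simpleZ (-1)); rewrite !scaleN1r; exact: simpleD. Qed.

Lemma simple_chi t : T t -> simple_fun (chi t) t.
Proof.
move=> Tt; exists unit, (fun=> 1), (fun=> t); split=> //.
  by rewrite (big_pred1 tt) ?scale1r // => -[].
by rewrite (big_pred1 tt) ?scale1r // => -[].
Qed.

Lemma simple_conv f h a b : simple_fun f a -> simple_fun h b ->
  simple_fun (convolution f h) (a ** b).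
Proof.
move=> [I [c [t [tT fE aE]]]] [J [d [t' [tT' hE bE]]]].
exists (I * J)%type, (fun p => c p.1 * d p.2), (fun p => t p.1 ** t' p.2); split.
- by move=> [i j]; exact: isubM.
- have sC i : fsupp (c i *: chi (t i)).
    by rewrite scaler_theta_fun; exact: fsupp_theta_fun.
  rewrite fE hE convolution_sum // pair_big /=; apply: eq_bigr => -[i j] _ /=.
  rewrite convolutionZr // convolutionZl; last exact: fsupp_theta_fun.
  by rewrite convolution_chi // scalerA mulrC.
- rewrite aE bE cmul_suml.
  transitivity (\sum_i \sum_j (c i * d j) *: (t i ** t' j)).
    apply: eq_bigr => i _; rewrite cmul_sumr; apply: eq_bigr => j _.
    by rewrite cmulZl cmulZr scalerA.
  by rewrite pair_big.
Qed.

Lemma simple_inv f a : simple_fun f a -> simple_fun (involution f) a^!.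
Proof.
move=> [I [c [t [tT fE aE]]]]; exists I, (fun i => (c i)^*%R), (fun i => (t i)^!); split.
- by move=> i; exact: isubV.
- rewrite fE involution_sum; apply: eq_bigr => i _.
  by rewrite involutionZ involution_chi.
- by rewrite aE adj_sum; apply: eq_bigr => i _; rewrite Defs.adjZ.
Qed.

(** [nrm_combination_le] asks for the same family on both sides, so the two presentations of [f] are
    put on the sum of the index types and padded by 0. *)
Lemma simple_small f a b : simple_fun f a -> small_fun f b -> nrm a <= b.
Proof.
move=> [I [c [t [tT fE aE]]]] [J [xi [t' [B [P fE' Bb]]]]]; apply: le_trans Bb.
pose tt (s : I + J) := match s with inl i => t i | inr j => t' j end.
pose cc (s : I + J) := match s with inl i => c i | inr j => 0 end.
pose xx (s : I + J) : character -> Cplx R := match s with inl i => fun=> 0 | inr j => xi j end.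
pose BB (s : I + J) := match s with inl i => 0 | inr j => B j end.
have := @nrm_combination_le _ _ _ hT T1 TC _ tt cc xx BB.
rewrite !big_sumType /= -aE [X in _ + X]big1 ?addr0; last by move=> j _; rewrite scale0r.
rewrite [X in X + _]big1 // add0r; apply.
- by case=> [i|j]; [exact: tT | case: (P j)].
- by case=> [i|j] //=; case: (P j).
- by case=> [i|j] x xt /=; [rewrite cabs0 | case: (P j) => _ _ _; apply].
- move=> g; rewrite !big_sumType /= [X in _ + X]big1 ?addr0; last by move=> j _; rewrite mul0r.
  rewrite [X in _ = X + _]big1 ?add0r; last first.
    move=> i _; have [gt|gt] := pselect (gin g (t i)); first by rewrite theta_fun_in.
    by rewrite theta_fun_out.
  have := congr1 (fun f => f g) fE'; rewrite fE !fct_sumE => <-.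
  by apply: eq_bigr.
Qed.

Lemma simple_is_small f a : simple_fun f a -> exists2 b, 0 <= b & small_fun f b.
Proof.
move=> [I [c [t [tT fE aE]]]]; exists (\sum_i cabs (c i)).
  by apply: sumr_ge0 => i _; exact: cabs_ge0.
exists I, (fun i _ => c i), t, (fun i => cabs (c i)); split=> //.
- by move=> i; split=> //; [exact: econt_cst | exact: cabs_ge0].
- rewrite fE; apply: eq_bigr => i _; rewrite scaler_theta_fun; congr (theta_fun _ _).
  by apply/funext => x; rewrite mulr1.
Qed.

Definition approximable f := forall e : R, 0 < e ->
  exists f0 a0, simple_fun f0 a0 /\ small_fun (f - f0) e.

(** [xi] is replaced by constants on a partition over whose pieces it varies little; [xi0] is the
    remainder. *)
Lemma approximable_theta_fun xi t : T t -> econt xi -> approximable (theta_fun xi t).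
Proof.
move=> Tt cx d d0.
pose Q e := exists c, forall y, tight_character y -> ev y e -> cabs (xi y - c) <= d.
have [||n [e [eQ eO eS]]] := @tight_partition _ _ _ hT T1 TC Q.
- by move=> x xt; have [p xp pP] := cx x xt d d0; exists p => //; exists (xi x).
- by move=> p q [c cP] Ep Eq; exists c => y yt /(evM _ Ep Eq)[yp _]; exact: cP.
have /choice[c cP] : forall i, exists c, forall y, tight_character y -> ev y (e i) -> cabs (xi y - c) <= d.
  by move=> i; have [_ [c h]] := eQ i; exists c.
have eE i : E (e i) := (eQ i).1.
exists (\sum_i c i *: chi (e i ** t)), (\sum_i c i *: (e i ** t)); split.
  exists 'I_n, c, (fun i => e i ** t); split=> // i.
  exact: (isubM hT (eE i).1 Tt).
pose xi0 x := xi x + \sum_i - c i * ind (e i) x.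
have -> : theta_fun xi t - \sum_i c i *: chi (e i ** t) = theta_fun xi0 t.
  apply/funext => g; rewrite [LHS](_ : _ = theta_fun xi t g - (\sum_i c i *: chi (e i ** t)) g) //.
  rewrite fct_sumE; have [gt|gt] := pselect (gin g t).
    rewrite !theta_fun_in // /xi0 -sumrN; congr (_ + _); apply: eq_bigr => i _.
    rewrite [(_ *: _) g](_ : _ = c i * chi (e i ** t) g) // mulNr; congr (- (_ * _)).
    have [gi|gi] := pselect (ev (rg g) (e i)).
      by rewrite ind1 // /chi theta_fun_in //; apply/(gin_idem_mul T1 TC).
    by rewrite ind0 // /chi theta_fun_out // => /(gin_idem_mul T1 TC _ (eE i) Tt)[].
  rewrite !theta_fun_out // big1 ?subr0 // => i _.
  rewrite [LHS](_ : _ = c i * chi (e i ** t) g) // /chi theta_fun_out ?mulr0 //.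
  by move=> /(gin_idem_mul T1 TC _ (eE i) Tt)[].
apply: small_theta_fun => //; last 1 first.
- move=> x xt; have [i xe] := ev_partition T1 TC xt eE eS.
  rewrite /xi0 (bigD1 i) //= ind1 // mulr1 big1 ?addr0; first exact: cP.
  move=> j ji; rewrite ind0 ?mulr0 // => xj; apply: (ev_orth xj xe); exact: eO.
- apply: econtD => //; apply: econt_sum => i; apply: econtM; first exact: econt_cst.
  exact: econt_ind.
- exact: ltW.
Qed.

Lemma approximableD f h : approximable f -> approximable h -> approximable (f + h).
Proof.
move=> af ah e e0; have e2 : 0 < e / 2 by rewrite divr_gt0.
have [f0 [a0 [sf mf]]] := af _ e2; have [h0 [b0 [sh mh]]] := ah _ e2.
exists (f0 + h0), (a0 + b0); split; first exact: simpleD.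
have -> : f + h - (f0 + h0) = (f - f0) + (h - h0) by rewrite opprD addrACA.
by apply: small_le (smallD mf mh); lra.
Qed.

Lemma approximable_small f b : small_fun f b -> approximable f.
Proof.
move=> [I [xi [t [B [P -> _]]]]]; elim: (index_enum I) => [|i s IH].
  move=> e e0; exists 0, 0; split.
    by exists void, (fun=> 0), (fun=> 0); split=> //; rewrite big_pred0 // => -[].
  by rewrite big_nil subrr; apply: small_le small0; exact: ltW.
rewrite big_cons; apply: approximableD => //.
by have [Tt cx _ _] := P i; exact: approximable_theta_fun.
Qed.

(* a is the image of f under the extension of 1_{theta(t)} |-> t. *)
Definition represents f a := forall e : R, 0 < e ->
  exists f0 a0, [/\ simple_fun f0 a0, small_fun (f - f0) e & nrm (a - a0) <= e].

(** Simple approximations of [f] within 1/(n+1) differ by functions of small auxiliary norm, so by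
    [simple_small] their images form a Cauchy sequence. *)
Lemma represents_ex f : approximable f -> exists a, represents f a.
Proof.
move=> af; pose e n : R := n.+1%:R^-1; have e0 n : 0 < e n by rewrite invr_gt0.
have /choice[p pP] : forall n, exists p : (G -> Cplx R) * A,
    simple_fun p.1 p.2 /\ small_fun (f - p.1) (e n).
  by move=> n; have [f0 [a0 h]] := af _ (e0 n); exists (f0, a0).
have eS d : 0 < d -> exists N, forall n, (N <= n)%N -> e n <= d.
  move=> d0; have [N] := ltr_add_invr d0; rewrite add0r => Nd.
  exists N => n Nn; apply: le_trans (ltW Nd).
  by rewrite lef_pV2 ?posrE // ler_nat ltnS.
have dist n m : nrm ((p n).2 - (p m).2) <= e n + e m.
  have [sn mn] := pP n; have [sm mm] := pP m.
  apply: simple_small (simpleB sn sm) _.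
  have -> : (p n).1 - (p m).1 = (f - (p m).1) - (f - (p n).1).
    by rewrite opprB [RHS]addrC addrA subrK.
  by rewrite (addrC (e n)); exact: smallB.
have [|a aP] := @complete_seq R A (fun n => (p n).2).
  move=> d d0; have d2 : 0 < d / 2 by rewrite divr_gt0.
  have [N NP] := eS _ d2.
  exists N => n Nn; apply: le_trans (dist _ _) _.
  have := NP _ (leqnn N); have := NP _ Nn; lra.
exists a => d d0; have [N NP] := eS _ d0; have [N' NP'] := aP _ d0.
have [sn mn] := pP (maxn N N').
exists (p (maxn N N')).1, (p (maxn N N')).2; split=> //.
  by apply: small_le mn; apply: NP; exact: leq_maxl.
by rewrite nrm_distC; apply: NP'; exact: leq_maxr.
Qed.

Lemma represents_lin c f h a b : represents f a -> represents h b ->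
  represents (c *: f + h) (c *: a + b).
Proof.
move=> ra rb e e0; have c1 : 0 < cabs c + 1 by rewrite ltr_wpDl ?cabs_ge0.
have d0 : 0 < e / (cabs c + 1) by rewrite divr_gt0.
have dE : cabs c * (e / (cabs c + 1)) + e / (cabs c + 1) = e.
  by rewrite -{2}[e / _]mul1r -mulrDl mulrCA mulfV ?mulr1 // gt_eqF.
have [f0 [a0 [sf mf na]]] := ra _ d0; have [h0 [b0 [sh mh nb]]] := rb _ d0.
exists (c *: f0 + h0), (c *: a0 + b0); split.
- by apply: simpleD => //; exact: simpleZ.
- have -> : c *: f + h - (c *: f0 + h0) = c *: (f - f0) + (h - h0).
    by rewrite scalerBr opprD addrACA.
  by rewrite -dE; apply: smallD => //; exact: smallZ.
- have -> : c *: a + b - (c *: a0 + b0) = c *: (a - a0) + (b - b0).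
    by rewrite scalerBr opprD addrACA.
  apply: le_trans (nrmD _ _) _; rewrite nrmZ -[leRHS]dE lerD //.
  by rewrite ler_wpM2l // cabs_ge0.
Qed.

Lemma represents_zero a : represents 0 a -> a = 0.
Proof.
move=> ra; apply: nrm_small_eq0 => e e0.
have e2 : 0 < e / 2 by rewrite divr_gt0.
have [f0 [a0 [sf mf na]]] := ra _ e2.
have := smallN mf; rewrite sub0r opprK => /(simple_small sf) na0.
rewrite -(subrK a0 a); apply: le_trans (nrmD _ _) _; lra.
Qed.

Lemma represents_uniq f a b : represents f a -> represents f b -> a = b.
Proof.
move=> ra rb; have := represents_lin (-1) ra rb.
rewrite !scaleN1r addNr => /represents_zero; rewrite addrC => /subr0_eq ->.
by [].
Qed.

Lemma represents_simple f a : simple_fun f a -> represents f a.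
Proof.
move=> sf e e0; exists f, a; split=> //.
  by rewrite subrr; apply: small_le small0; exact: ltW.
by rewrite subrr nrm0 ltW.
Qed.

Lemma represents_conv f h a b M N : represents f a -> represents h b ->
  0 <= M -> 0 <= N -> small_fun f M -> small_fun h N ->
  represents (convolution f h) (a ** b).
Proof.
move=> ra rb M0 N0 fM hN e e0.
set p := nrm a; set q := nrm b.
have p0 : 0 <= p := nrm_ge0 _; have q0 : 0 <= q := nrm_ge0 _.
(* The errors are d N + (M + d) d for functions and d q + (p + d) d for elements; as d <= 1, both
   are at most d (M + N + p + q + 1). *)
pose d := Num.min 1 (e / (M + N + p + q + 1)).
have d0 : 0 < d by rewrite lt_min ltr01 divr_gt0 //; lra.
have d1 : d <= 1 by rewrite ge_min lexx.
have de : d * (M + N + p + q + 1) <= e by rewrite -ler_pdivlMr; [rewrite ge_min lexx orbT | lra].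
have [f0 [a0 [sf mf na]]] := ra _ d0; have [h0 [b0 [sh mh nb]]] := rb _ d0.
have mf0 : small_fun f0 (M + d).
  have -> : f0 = f - (f - f0) by rewrite opprB addrC subrK.
  exact: smallB.
exists (convolution f0 h0), (a0 ** b0); split; first exact: simple_conv.
- have -> : convolution f h - convolution f0 h0 =
      convolution (f - f0) h + convolution f0 (h - h0).
    have [s1 s0] := (fsupp_small mf, fsupp_small mf0).
    have E1 : convolution f h = convolution (f - f0) h + convolution f0 h.
      by rewrite -convolutionDl // subrK.
    have E2 : convolution f0 h = convolution f0 (h - h0) + convolution f0 h0.
      by rewrite -convolutionDr // subrK.
    by rewrite E1 E2 addrA addrK.
  apply: (@small_le _ (d * N + (M + d) * d)); first nra.
  by apply: smallD; apply: small_conv => //; [exact: ltW | rewrite addr_ge0 // ltW].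
- have -> : a ** b - a0 ** b0 = (a - a0) ** b + a0 ** (b - b0).
    by rewrite cmulBl cmulBr addrA subrK.
  have na0 : nrm a0 <= p + d.
    have -> : a0 = a - (a - a0) by rewrite opprB addrC subrK.
    by apply: le_trans (nrmB _ _) _; rewrite lerD.
  apply: le_trans (nrmD _ _) _.
  have h1 := nrmM (a - a0) b; have h2 := nrmM a0 (b - b0).
  have h3 : nrm (a - a0) * q <= d * q by rewrite ler_wpM2r.
  have h4 : nrm a0 * nrm (b - b0) <= (p + d) * d by apply: ler_pM => //; exact: nrm_ge0.
  rewrite -/q in h1.
  apply: le_trans (lerD (le_trans h1 h3) (le_trans h2 h4)) _; nra.
Qed.

Lemma represents_inv f a : represents f a -> represents (involution f) a^!.
Proof.
move=> ra e e0; have [f0 [a0 [sf mf na]]] := ra e e0.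
exists (involution f0), a0^!; split; first exact: simple_inv.
  have -> : involution f - involution f0 = involution (f - f0).
    by rewrite -[- f0]scaleN1r involutionD involutionZ rmorphN rmorph1 scaleN1r.
  exact: small_inv.
by rewrite -adjB nrm_adj.
Qed.

Lemma small_Cc f b : small_fun f b -> Cc f.
Proof.
move=> [I [xi [t [B [P -> _]]]]]; apply: lspan_sum => i _; apply: lspan_gen.
by have [Tt cx _ _] := P i; exact: bisection_fun_theta_fun.
Qed.

Lemma Cc_small f : Cc f -> exists2 b, 0 <= b & small_fun f b.
Proof.
move: f; apply: lspan_ind.
- by exists 0 => //; exact: small0.
- move=> f h [b b0 sf] [b' b'0 sh]; exists (b + b'); first exact: addr_ge0.
  exact: smallD.
- move=> c f [b b0 sf]; exists (cabs c * b); first by rewrite mulr_ge0 // cabs_ge0.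
  exact: smallZ.
move=> f /(bisection_fun_sum T1 TC)[n [xi [t [P fE]]]].
have /choice[B BP] : forall i, exists b : R, 0 <= b /\
    forall x, tight_character x -> cabs (xi i x) <= b.
  by move=> i; have [b b0 h] := econt_bounded T1 TC (P i).2; exists b.
exists (\sum_i B i); first by apply: sumr_ge0 => i _; case: (BP i).
exists 'I_n, xi, t, B; split=> //.
  by move=> i; have [Tt cx] := P i; have [B0 xB] := BP i.
by apply/funext => g; rewrite fE fct_sumE.
Qed.

Lemma Cc_chi t : T t -> Cc (chi t).
Proof. by move=> Tt; have [b _ /small_Cc] := simple_is_small (simple_chi Tt). Qed.

Definition integral_rep f : A := xget 0 [set a | represents f a].

Lemma integral_repP f : Cc f -> represents f (integral_rep f).
Proof.
move=> /Cc_small[b _ /approximable_small/represents_ex[a ra]].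
by apply: (@xgetPex _ 0 [set a | represents f a]); exists a.
Qed.

Lemma integral_repE f a : represents f a -> integral_rep f = a.
Proof.
move=> ra; apply: represents_uniq (ra).
by apply: (@xgetPex _ 0 [set a | represents f a]); exists a.
Qed.

Lemma integral_rep_chi t : T t -> integral_rep (chi t) = t.
Proof. by move=> Tt; apply/integral_repE/represents_simple/simple_chi. Qed.

Lemma integral_rep_hom : Cc_star_hom integral_rep.
Proof.
split.
- move=> c f h /integral_repP rf /integral_repP rh.
  by apply: integral_repE; exact: represents_lin.
- move=> f h Cf Ch; have [M M0 fM] := Cc_small Cf; have [N N0 hN] := Cc_small Ch.
  apply: integral_repE.
  exact: (represents_conv (integral_repP Cf) (integral_repP Ch) M0 N0 fM hN).
- by move=> f /integral_repP rf; apply/integral_repE/represents_inv.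
Qed.

End Integration.

(** * Arbitrary representations of C_c *)

Section Representations.
Variables (R : realType) (A : unitalCStarAlgType R) (T : set A).
Hypothesis hT : inverse_subsemigroup T.
Hypothesis T1 : T cone.
Hypothesis TC : forall e, T e -> e ** e = e -> T (cone - e).

Local Notation S := (isg_of hT).
Local Notation E := (idem_in T).
Local Notation G := (tight_groupoid S).
Local Notation character := (Defs.character S).
Local Notation econt := (@econt R A T hT).
Local Notation chi := (@chi R A T hT).
Implicit Types (x y : character) (t a : A) (xi eta : character -> Cplx R).
Implicit Types (f h : G -> Cplx R).

Lemma sr_idem (g : G) e : E e -> gin g e -> sr g = rg g.
Proof.
move=> Ee ge; apply: (ev_ext (hT := hT)) => p.
have ee : ev (rg g) e by have := rg_gin ge; rewrite (idem_in_adj hT Ee) Ee.2.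
have pE : E p -> ev (sr g) p <-> ev (rg g) p.
  move=> Ep; rewrite (sr_gin ge Ep) (idem_in_adj hT Ee) -(idem_inC hT Ep Ee) -cmulA Ee.2.
  by split=> [/(evM _ Ep Ee)[]|gp] //; apply/evM.
by split=> xp; apply/pE => //; exact: ev_idem xp.
Qed.

Lemma chi_idem (g : G) e : E e -> gin g cone -> chi e g = ind e (rg g).
Proof.
move=> Ee g1; have Ec : gin g e <-> ev (rg g) e.
  rewrite -{1}[e]cmulx1; split=> [/(gin_idem_mul T1 TC _ Ee T1)[]|ge] //.
  by apply/(gin_idem_mul T1 TC).
have [ge|ge] := pselect (ev (rg g) e).
  by rewrite ind1 // /chi theta_fun_in //; exact/Ec.
by rewrite ind0 // /chi theta_fun_out // => /Ec.
Qed.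

(** The passage from A back to functions. At a tight character x there is a nonzero q below each e_i
    or its complement; multiplying the relation by q turns each e_i into the scalar x(e_i). *)
Lemma idem_combination (I : finType) (c : I -> Cplx R) (e : I -> A) :
  (forall i, E (e i)) -> \sum_i c i *: e i = 0 -> \sum_i c i *: chi (e i) = 0.
Proof.
move=> eE sum0; apply/funext => g; rewrite fct_sumE.
have [g1|g1] := pselect (gin g cone); last first.
  rewrite big1 // => i _; rewrite [LHS](_ : _ = c i * chi (e i) g) // /chi theta_fun_out ?mulr0 //.
  by rewrite -[e i]cmulx1 => /(gin_idem_mul T1 TC _ (eE i) T1)[].
transitivity (\sum_i c i * ind (e i) (rg g)).
  by apply: eq_bigr => i _; rewrite -chi_idem.
set x := rg g; pose f i := if pselect (ev x (e i)) then e i else cone - e i.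
have [|q xq qf] := @ev_meet _ _ _ hT T1 I x f.
  move=> i; rewrite /f; case: pselect => // ne.
  by apply/(tight_compl T1 TC (rg_tight g)).
have q0 : q != 0 by apply/eqP => q0; move: xq; rewrite q0 => /ev0.
have qe i : q ** e i = ind (e i) x *: q.
  have := qf i; rewrite /f; case: pselect => xe; first by rewrite ind1 // scale1r.
  rewrite ind0 // scale0r cmulBr cmulx1 => E1.
  by have := subrr q; rewrite -{2}E1 opprB addrC subrK.
have : (\sum_i c i * ind (e i) x) *: q = 0.
  transitivity (q ** \sum_i c i *: e i); last by rewrite sum0 cmulx0.
  rewrite scaler_suml cmul_sumr; apply: eq_bigr => i _.
  by rewrite cmulZr qe scalerA.
by move=> /eqP; rewrite scaler_eq0 (negbTE q0) orbF => /eqP.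
Qed.

Lemma chi_combination (I : finType) (c : I -> Cplx R) (e : I -> A) p :
  (forall i, E (e i)) -> E p -> \sum_i c i *: e i = p ->
  \sum_i c i *: chi (e i) = chi p.
Proof.
move=> eE Ep sump; apply/eqP; rewrite -subr_eq0; apply/eqP.
have := @idem_combination (I + unit)%type
  (fun s => match s with inl i => c i | inr _ => -1 end)
  (fun s => match s with inl i => e i | inr _ => p end).
rewrite !big_sumType /= !(big_pred1 tt) ?sump; [|by case|by case].
by rewrite !scaleN1r subrr; apply => // -[].
Qed.

Lemma convolution_theta_fun_adj xi t : T t ->
  convolution (theta_fun xi t) (involution (theta_fun xi t)) =
  theta_fun (fun x => (cabs (xi x) ^+ 2)%:K) (t ** t^!) :> (G -> Cplx R).
Proof.
move=> Tt; rewrite involution_theta_fun // convolution_theta_fun //; last exact: isubV.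
have Et := range_idem hT Tt.
apply: theta_fun_ext => x xt; rewrite (idem_in_adj hT Et) Et.2 => xtt.
have [g <- gt] := ginP T1 TC xt Tt xtt.
rewrite (pull_in T1 _ gt) -rg_inv (pull_in T1 _ (gin_inv gt)) sr_inv.
by rewrite mulrC conj_mul_cabs.
Qed.

Lemma econt_sqrt (q : character -> R) :
  econt (fun x => (q x)%:K) -> (forall x, tight_character x -> 0 <= q x) ->
  econt (fun x => (Num.sqrt (q x))%:K).
Proof.
(* The square d^2 comes from the inequality |sqrt a - sqrt b|^2 <= |a - b|. *)
move=> cq q0 x xt d d0; have [p xp pP] := cq x xt (d ^+ 2) (exprn_gt0 2 d0).
exists p => // y yt yp; have := pP y yt yp; rewrite -!rmorphB !cabs_real.
have := q0 x xt; have := q0 y yt.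
rewrite -{2}(sqr_sqrtr (q0 x xt)) -{2}(sqr_sqrtr (q0 y yt)) => _ _.
have := sqrtr_ge0 (q x); have := sqrtr_ge0 (q y).
move: (Num.sqrt (q x)) (Num.sqrt (q y)) => s t t0 s0.
rewrite !ler_norml => /andP[h1 h2]; apply/andP; split; nra.
Qed.

Section Star.
Variables (D : cstarAlgType R) (pi : (G -> Cplx R) -> D).
Hypothesis piH : Cc_star_hom pi.

Lemma Cc0 : Cc (0 : G -> Cplx R). Proof. exact: lspan0. Qed.

Lemma pi_lin c f h : Cc f -> Cc h -> pi (c *: f + h) = c *: pi f + pi h.
Proof. by case: piH => + _ _; apply. Qed.

Lemma pi0 : pi 0 = 0.
Proof.
have := pi_lin 1 Cc0 Cc0; rewrite !scale1r addr0 => E1.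
by apply: (@addrI _ (pi 0)); rewrite -E1 addr0.
Qed.

Lemma piD f h : Cc f -> Cc h -> pi (f + h) = pi f + pi h.
Proof. by move=> Cf Ch; have := pi_lin 1 Cf Ch; rewrite !scale1r. Qed.

Lemma piZ c f : Cc f -> pi (c *: f) = c *: pi f.
Proof. by move=> Cf; have := pi_lin c Cf Cc0; rewrite !addr0 pi0 addr0. Qed.

Lemma pi_sum (I : Type) (s : seq I) (F : I -> G -> Cplx R) :
  (forall i, Cc (F i)) -> pi (\sum_(i <- s) F i) = \sum_(i <- s) pi (F i).
Proof.
move=> CF; elim: s => [|i s IH]; first by rewrite !big_nil pi0.
rewrite !big_cons piD ?IH //.
by apply: lspan_sum => j _; exact: CF.
Qed.

Lemma pi_chiM t t' : T t -> T t' -> pi (chi (t ** t')) = pi (chi t) ** pi (chi t').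
Proof.
move=> Tt Tt'; rewrite -convolution_chi //.
by case: piH => _ + _; apply; apply: Cc_chi.
Qed.

Lemma pi_chiV t : T t -> pi (chi t^!) = (pi (chi t))^!.
Proof.
by move=> Tt; rewrite -involution_chi //; case: piH => _ _; apply; apply: Cc_chi.
Qed.

Lemma pi_idem e : E e -> isproj (pi (chi e)).
Proof.
move=> Ee; split; first by rewrite -pi_chiV ?(idem_in_adj hT Ee) //; exact: Ee.1.
by rewrite -pi_chiM ?Ee.2 //; exact: Ee.1.
Qed.

Lemma Cc_theta_fun xi t : T t -> econt xi -> Cc (theta_fun xi t : G -> Cplx R).
Proof. by move=> Tt cx; apply: lspan_gen; exact: bisection_fun_theta_fun. Qed.

Lemma pi_square xi t : T t -> econt xi ->
  pi (theta_fun xi t) ** (pi (theta_fun xi t))^! =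
  pi (theta_fun (fun x => (cabs (xi x) ^+ 2)%:K) (t ** t^!)).
Proof.
move=> Tt cx; rewrite -convolution_theta_fun_adj //; have Cf := Cc_theta_fun Tt cx.
have Ci : Cc (involution (theta_fun xi t : G -> Cplx R)).
  rewrite involution_theta_fun //; apply: Cc_theta_fun; first exact: isubV.
  by apply: econt_pull => //; [exact: isubV | exact: econt_conj].
by case: piH => _ piM piV; rewrite piM // piV.
Qed.

(* As for star homomorphisms, 0 <= q <= 1 is the real part of the function
   q + i sqrt (1 - q^2) of modulus 1. *)
Lemma pi_real_le1 (q : character -> R) e : E e -> econt (fun x => (q x)%:K) ->
  (forall x, tight_character x -> 0 <= q x <= 1) -> nrm (pi (theta_fun (fun x => (q x)%:K) e)) <= 1.
Proof.
move=> Ee cq q01; pose r x := Num.sqrt (1 - q x ^+ 2).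
have cr : econt (fun x => (r x)%:K).
  apply: econt_sqrt => [|x xt]; last by have := q01 x xt => /andP[? ?]; nra.
  have -> : (fun x => (1 - q x ^+ 2)%:K : Cplx R) = fun x => 1 + (-1) * ((q x)%:K * (q x)%:K).
    by apply/funext => x; rewrite rmorphB rmorph1 rmorphXn /= mulN1r expr2.
  apply: econtD => //; first exact: econt_cst.
  by apply: econtM => //; [exact: econt_cst | exact: econtM].
pose v x : Cplx R := (q x)%:K + 'i * (r x)%:K.
have cv : econt v by apply: econtD => //; apply: econtM => //; exact: econt_cst.
have vC x : (v x)^*%R = (q x)%:K - 'i * (r x)%:K.
  by rewrite rmorphD rmorphM /= conjCi !conj_Creal ?complex_real // mulNr.
have v1 x : tight_character x -> cabs (v x) ^+ 2 = 1.
  move=> xt; apply: (@complexI R); rewrite -conj_mul_cabs vC -subr_sqr exprMn sqrCi mulN1r opprK.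
  rewrite -!rmorphXn -rmorphD /= sqr_sqrtr ?[_ + (1 - _)]addrC ?subrK //.
  by have := q01 x xt => /andP[? ?]; nra.
have Te := Ee.1.
have w2 : pi (theta_fun v e) ** (pi (theta_fun v e))^! = pi (chi e).
  rewrite pi_square // (idem_in_adj hT Ee) Ee.2; congr pi.
  by apply: theta_fun_ext => x xt _; rewrite v1 // rmorph1.
have nw : nrm (pi (theta_fun v e)) <= 1.
  by rewrite -nrm_adj; apply: nrm_isom_le1 (pi_idem Ee); rewrite adjK.
apply: nrm_half_le nw.
have Cv := Cc_theta_fun Te cv; have Cq := Cc_theta_fun Te cq.
have <- : pi (involution (theta_fun v e)) = (pi (theta_fun v e))^! by case: piH => _ _ ->.
have vE : involution (theta_fun v e) = theta_fun (fun x => (v x)^*%R) e :> (G -> Cplx R).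
  rewrite involution_theta_fun // (idem_in_adj hT Ee); apply: theta_fun_ext => x xt xe.
  have [g <- ge] := ginP T1 TC xt Te xe.
  by rewrite pull_in // (sr_idem Ee ge).
rewrite vE -!piD //; last by apply: Cc_theta_fun => //; exact: econt_conj.
congr pi; apply/funext => g; rewrite [LHS](_ : _ = theta_fun v e g + theta_fun (fun x => (v x)^*%R) e g) //.
rewrite [RHS](_ : _ = theta_fun (fun x => (q x)%:K) e g + theta_fun (fun x => (q x)%:K) e g) //.
have [ge|ge] := pselect (gin g e); last by rewrite !theta_fun_out.
by rewrite !theta_fun_in // vC /v addrACA subrr addr0.
Qed.

(** The C*-identity replaces the function by its squared modulus on an idempotent, and division by
    c^2 brings this to the case of [pi_real_le1]; c = B + e admits B = 0. *)
Lemma pi_theta_fun xi t B : T t -> econt xi -> 0 <= B ->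
  (forall x, tight_character x -> cabs (xi x) <= B) -> nrm (pi (theta_fun xi t)) <= B.
Proof.
move=> Tt cx B0 xB; apply/ler_addgt0Pr => e e0; set c := B + e.
have c0 : 0 < c by rewrite ltr_wpDl.
rewrite -ler_sqr ?nnegrE ?nrm_ge0 ?(ltW c0) // -nrm_cstarV pi_square //.
have Et := range_idem hT Tt; pose q x := (cabs (xi x) / c) ^+ 2.
have cq : econt (fun x => (q x)%:K).
  have -> : (fun x => (q x)%:K : Cplx R) = fun x => ((c ^- 2)%:K) * ((xi x)^*%R * xi x).
    apply/funext => x; rewrite conj_mul_cabs -rmorphM /q exprMn exprVn mulrC.
    by [].
  apply: econtM => //; first exact: econt_cst.
  by apply: econtM => //; exact: econt_conj.
have -> : theta_fun (fun x => (cabs (xi x) ^+ 2)%:K) (t ** t^!) =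
    (c ^+ 2)%:K *: theta_fun (fun x => (q x)%:K) (t ** t^!) :> (G -> Cplx R).
  rewrite scaler_theta_fun; congr (theta_fun _ _); apply/funext => x; rewrite -rmorphM /q /= exprMn exprVn.
  by rewrite mulrCA mulfV ?mulr1 // expf_neq0 // gt_eqF.
rewrite piZ; last by apply: Cc_theta_fun => //; exact: Et.1.
rewrite nrmZ cabs_real_ge0 ?sqr_ge0 // ler_piMr ?sqr_ge0 //.
apply: pi_real_le1 => // x xt; rewrite /q sqr_ge0 expr_le1 //= ?divr_ge0 ?cabs_ge0 ?(ltW c0) //.
by rewrite ler_pdivrMr // mul1r; apply: le_trans (xB x xt) _; rewrite lerDl ltW.
Qed.

(** Automatic continuity: every representation is bounded by the auxiliary norm. *)
Lemma pi_small f b : small_fun f b -> nrm (pi f) <= b.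
Proof.
move=> [I [xi [t [B [P -> Bb]]]]]; rewrite pi_sum; last first.
  by move=> i; have [Tt cx _ _] := P i; exact: Cc_theta_fun.
apply: le_trans (nrm_sum _ _ _) _; apply: le_trans Bb; apply: ler_sum => i _.
by have [Tt cx B0 xB] := P i; exact: pi_theta_fun.
Qed.

(** Both sides agree on simple functions, and both errors of a simple approximation are
    controlled. *)
Lemma pi_factor (phi : A -> D) : star_hom phi -> (forall a, nrm (phi a) <= nrm a) ->
  (forall t, T t -> phi t = pi (chi t)) ->
  forall f, Cc f -> phi (integral_rep f) = pi f.
Proof.
move=> phiS phi1 phiT f Cf; apply/subr0_eq/nrm_small_eq0 => e e0.
have e2 : 0 < e / 2 by rewrite divr_gt0.
have [f0 [a0 [sf mf na]]] := integral_repP T1 TC Cf e2.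
have Cf0 : Cc f0 by have [b _ /(small_Cc T1 TC)] := simple_is_small T1 sf.
have phi0 : phi a0 = pi f0.
  have [I [c [t [tT -> ->]]]] := sf.
  rewrite (star_hom_sum phiS) pi_sum; last by move=> i; apply: lspanZ; exact: Cc_chi.
  apply: eq_bigr => i _; rewrite (star_homZ phiS) phiT // piZ //; exact: Cc_chi.
have -> : phi (integral_rep f) - pi f = phi (integral_rep f - a0) - pi (f - f0).
  have -> : pi (f - f0) = pi f - pi f0.
    by rewrite -scaleN1r addrC pi_lin // scaleN1r addrC.
  by rewrite (star_homB phiS) phi0 opprB addrA subrK.
apply: le_trans (nrmB _ _) _; have := phi1 (integral_rep f - a0); have := pi_small mf; lra.
Qed.

End Star.

End Representations.

(** * Closures and corners as targets of the universal property *)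

Section Closure.
Variables (R : realType) (D : cstarAlgType R) (Y : set D).
Hypothesis Ylin : forall c x y, Y x -> Y y -> Y (c *: x + y).
Hypothesis Ymul : forall x y, Y x -> Y y -> Y (x ** y).
Hypothesis Yadj : forall x, Y x -> Y x^!.
Hypothesis Y0 : Y 0.

Lemma closure_starsubalg : closed_starsubalg (closure Y).
Proof.
split; last 1 first.
- exact: subset_closure.
- move=> c x y /closureP_nrm cx /closureP_nrm cy; apply/closureP_nrm => e e0.
  have c1 : 0 < cabs c + 1 by rewrite ltr_wpDl ?cabs_ge0.
  have d0 : 0 < e / (cabs c + 1) by rewrite divr_gt0.
  have dE : cabs c * (e / (cabs c + 1)) + e / (cabs c + 1) = e.
    by rewrite -{2}[e / _]mul1r -mulrDl mulrCA mulfV ?mulr1 // gt_eqF.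
  have [x' Yx' xx'] := cx _ d0; have [y' Yy' yy'] := cy _ d0.
  exists (c *: x' + y'); first exact: Ylin.
  have -> : c *: x + y - (c *: x' + y') = c *: (x - x') + (y - y').
    by rewrite scalerBr opprD addrACA.
  apply: le_trans (nrmD _ _) _; rewrite nrmZ -[leRHS]dE lerD //.
  by rewrite ler_wpM2l // cabs_ge0.
- move=> x y /closureP_nrm cx /closureP_nrm cy; apply/closureP_nrm => e e0.
  set p := nrm x; set q := nrm y.
  have p0 : 0 <= p := nrm_ge0 _; have q0 : 0 <= q := nrm_ge0 _.
  pose d := Num.min 1 (e / (p + q + 1)).
  have d0 : 0 < d by rewrite lt_min ltr01 divr_gt0 //; lra.
  have d1 : d <= 1 by rewrite ge_min lexx.
  have de : d * (p + q + 1) <= e by rewrite -ler_pdivlMr; [rewrite ge_min lexx orbT | lra].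
  have [x' Yx' xx'] := cx _ d0; have [y' Yy' yy'] := cy _ d0.
  exists (x' ** y'); first exact: Ymul.
  have -> : x ** y - x' ** y' = (x - x') ** y + x' ** (y - y').
    by rewrite cmulBl cmulBr addrA subrK.
  have nx' : nrm x' <= p + d.
    have -> : x' = x - (x - x') by rewrite opprB addrC subrK.
    by apply: le_trans (nrmB _ _) _; rewrite lerD.
  apply: le_trans (nrmD _ _) _.
  have h1 := nrmM (x - x') y; have h2 := nrmM x' (y - y').
  have h3 : nrm (x - x') * q <= d * q by rewrite ler_wpM2r.
  have h4 : nrm x' * nrm (y - y') <= (p + d) * d by apply: ler_pM => //; exact: nrm_ge0.
  rewrite -/q in h1.
  apply: le_trans (lerD (le_trans h1 h3) (le_trans h2 h4)) _; nra.
- move=> x /closureP_nrm cx; apply/closureP_nrm => e /cx[x' Yx' xx'].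
  by exists x'^!; [exact: Yadj | rewrite -adjB nrm_adj].
- exact: closed_closure.
Qed.

End Closure.

Section Corner.
Variables (R : realType) (D : cstarAlgType R) (p : D).
Hypothesis pP : isproj p.

Definition corner : set D := [set x | p ** x = x /\ x ** p = x].

Lemma corner_starsubalg : closed_starsubalg corner.
Proof.
split.
- move=> c x y [px xp] [py yp]; split.
    by rewrite cmulDr cmulZr px py.
  by rewrite cmulDl cmulZl xp yp.
- by move=> x y [px xp] [py yp]; split; [rewrite cmulA px | rewrite -cmulA yp].
- by move=> x [px xp]; split; [rewrite -{1}pP.1 -adjM xp | rewrite -{1}pP.1 -adjM px].
- move=> x /closureP_nrm cx; split; apply/subr0_eq/nrm_small_eq0 => e e0.
    have [y [py yp] xy] := cx (e / 2) ltac:(by rewrite divr_gt0).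
    have -> : p ** x - x = p ** (x - y) - (x - y) by rewrite cmulBr py opprB addrA subrK.
    apply: le_trans (nrmB _ _) _; have := nrmM p (x - y).
    have := nrm_proj_le1 pP; have := nrm_ge0 (x - y); have := nrm_ge0 p; nra.
  have [y [py yp] xy] := cx (e / 2) ltac:(by rewrite divr_gt0).
  have -> : x ** p - x = (x - y) ** p - (x - y) by rewrite cmulBl yp opprB addrA subrK.
  apply: le_trans (nrmB _ _) _; have := nrmM (x - y) p.
  have := nrm_proj_le1 pP; have := nrm_ge0 (x - y); have := nrm_ge0 p; nra.
- by split; rewrite ?cmulx0 ?cmul0x.
Qed.

Lemma corner_unit :
  [/\ corner p, forall x, corner x -> p ** x = x & forall x, corner x -> x ** p = x].
Proof. by split=> [|x []|x []] //; split; exact: pP.2. Qed.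

End Corner.

Lemma coset_repM (G : groupType) (H M : set G) (a : G) (C : set G) : subgroup M ->
  Pmonoid H M a -> lcosets M (conj_set a M) C -> M (xget 1%g C).
Proof.
move=> [M1 MM _] Pa [k Mk CE]; have : C (xget 1%g C).
  apply: (xgetPex 1%g); exists k; rewrite -CE; exists 1%g; last by rewrite mulg1.
  by exists 1%g; rewrite ?mulg1 ?mulgV.
rewrite -{1}CE => -[y [m Mm <-] <-]; apply: MM => //; exact: P_conj Pa Mm.
Qed.

(** Lets the universal property be applied with a subalgebra as target: the corner of a
    representation, and the closure of the image of [iota]. *)
Lemma sub_relations (R : realType) (G : groupType) (H M : set G) (D : cstarAlgType R)
    (X : set D) (p : D) (hX : closed_starsubalg X)
    (hp : [/\ X p, forall x, X x -> p ** x = x & forall x, X x -> x ** p = x])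
    (s u : G -> D) :
  subgroup H -> subgroup M ->
  (forall a, Pmonoid H M a -> finite_index (conj_set a M) M) ->
  (forall a, Pmonoid H M a -> X (s a)) -> (forall m, M m -> X (u m)) ->
  (forall a, Pmonoid H M a -> (s a)^! ** s a = p) ->
  (forall m, M m -> (u m)^! ** u m = p /\ u m ** (u m)^! = p) ->
  (forall a b, Pmonoid H M a -> Pmonoid H M b -> s a ** s b = s (a * b)%g) ->
  (forall m n, M m -> M n -> u m ** u n = u (m * n)%g) ->
  (forall a m, Pmonoid H M a -> M m -> s a ** u m = u (a * m * a^-1)%g ** s a) ->
  (forall a, Pmonoid H M a ->
    \sum_(C <- fset_set (lcosets M (conj_set a M)))
      (u (xget 1%g C) ** (s a ** (s a)^!) ** (u (xget 1%g C))^!) = p) ->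
  relations H M (usubalg_in hX hp \o s) (usubalg_in hX hp \o u).
Proof.
move=> subH subM fin Xs Xu ss uu sM uM su sS.
have vs a : Pmonoid H M a -> usubalg_val (usubalg_in hX hp (s a)) = s a.
  by move=> Pa; apply: usubalg_inK; exact: Xs.
have vu m : M m -> usubalg_val (usubalg_in hX hp (u m)) = u m.
  by move=> Mm; apply: usubalg_inK; exact: Xu.
have vM (x y : usubalg hX hp) : usubalg_val (x ** y) = usubalg_val x ** usubalg_val y by [].
have vV (x : usubalg hX hp) : usubalg_val x^! = (usubalg_val x)^! by [].
have v1 := usubalg_val_one hX hp.
split=> /=.
- by move=> a Pa; apply: usubalg_val_inj; rewrite vM vV v1 vs // ss.
- by move=> m Mm; have [h1 h2] := uu m Mm; split; apply: usubalg_val_inj;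
    rewrite vM vV v1 vu // ?h1 ?h2.
- move=> a b Pa Pb; apply: usubalg_val_inj; rewrite vM !vs ?sM //; exact: P_mul.
- by move=> m n Mm Mn; apply: usubalg_val_inj; rewrite vM !vu ?uM //; exact: M_mul.
- move=> a m Pa Mm; have Mc := P_conj Pa Mm.
  by apply: usubalg_val_inj; rewrite !vM vs // !vu // su.
- move=> a Pa; apply: usubalg_val_inj; rewrite v1; apply: etrans (sS a Pa).
  have finC : finite_set (lcosets M (conj_set a M)) by case: (fin a Pa).
  rewrite fsbig_finite // (star_hom_sum (usubalg_val_hom hX hp)).
  rewrite big_seq [RHS]big_seq; apply: eq_bigr => C; rewrite in_fset_set // inE => CL.
  have MC : M (xget 1%g C) by exact: coset_repM subM Pa CL.
  by rewrite /range_proj !vM !vV vu // vs.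
Qed.

(** * The universal property and the full norm *)

Section UniversalAlgebra.
Variables (R : realType) (G : groupType) (H M : set G).
Hypothesis subH : subgroup H.
Hypothesis subM : subgroup M.
Hypothesis Mindex : forall a : G, Pmonoid H M a -> finite_index (conj_set a M) M.
Variables (A : unitalCStarAlgType R) (s u : G -> A).
Hypothesis Auniv : is_universal H M s u.

Local Notation P := (Pmonoid H M).
Local Notation T := (Tset H M s u).

Hypothesis hT : inverse_subsemigroup T.
Hypothesis T1 : T cone.
Hypothesis TC : forall e, T e -> e ** e = e -> T (cone - e).

Local Notation S := (isg_of hT).
Local Notation chi := (@chi R A T hT).
Local Notation iota := (@integral_rep R A T hT).

(** The universal property gives [phi] on the generators. Agreement with [pi] extends to F by
    linearity, since linear relations between idempotents hold between their functions, and then to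
    products in T. The norm of the corner is inherited from [D], so [phi] is contractive although
    its target may lack a unit. *)
Lemma representation_factors (D : cstarAlgType R)
    (pi : (tight_groupoid S -> Cplx R) -> D) : Cc_star_hom pi ->
  exists phi : A -> D, [/\ star_hom phi, forall a, nrm (phi a) <= nrm a &
    forall t, T t -> phi t = pi (chi t)].
Proof.
move=> piH; set p := pi (chi cone); have [rel _] := Auniv.
have Ts a : P a -> T (s a) by exact: (T_s subH subM rel).
have Tu m : M m -> T (u m) by exact: (T_u subH subM rel).
have pM t t' : T t -> T t' -> pi (chi (t ** t')) = pi (chi t) ** pi (chi t').
  exact: (pi_chiM T1 TC piH).
have pV t : T t -> pi (chi t^!) = (pi (chi t))^! by exact: (pi_chiV T1 TC piH).
have pP : isproj p := pi_idem T1 TC piH (idem_in1 T1).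
have hp := corner_unit pP; have hX := corner_starsubalg pP.
have Xt t : T t -> corner p (pi (chi t)).
  by move=> Tt; split; rewrite /p -pM // ?cmul1x ?cmulx1.
have TV t : T t -> T t^! by exact: (isubV hT).
have [_ /(_ (usubalg hX hp) (usubalg_in hX hp \o (fun a => pi (chi (s a))))
   (usubalg_in hX hp \o (fun m => pi (chi (u m)))))] := Auniv.
case=> [|phi [[phiS phi1 phis phiu] _]].
  apply: sub_relations => //.
  - by move=> a Pa; apply/Xt/Ts.
  - by move=> m Mm; apply/Xt/Tu.
  - move=> a Pa; have Tsa := Ts _ Pa.
    by rewrite -pV // -pM ?(rel_isometry rel) //; exact: TV.
  - move=> m Mm; have [h1 h2] := rel_unitary rel Mm; have Tm := Tu _ Mm.
    by split; rewrite -pV // -pM ?h1 ?h2 //; exact: TV.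
  - by move=> a b Pa Pb; rewrite -pM ?(rel_ss rel) //; exact: Ts.
  - by move=> m n Mm Mn; rewrite -pM ?(rel_uu rel) //; exact: Tu.
  - move=> a m Pa Mm; have Mc := P_conj Pa Mm.
    by rewrite -!pM ?(rel_su rel) //; do ?[exact: Ts|exact: Tu].
  - move=> a Pa; have finC : finite_set (lcosets M (conj_set a M)) by case: (Mindex Pa).
    have := rel_sum rel Pa; rewrite fsbig_finite //= => S1.
    set r := fset_set _ in S1 *; pose e (i : 'I_(size r)) := u (xget 1%g (nth set0 r i)) **
      range_proj s a ** (u (xget 1%g (nth set0 r i)))^!.
    have Mr i : (i < size r)%N -> M (xget 1%g (nth set0 r i)).
      move=> ir; have := mem_nth set0 ir; rewrite in_fset_set // inE => CL.
      exact: coset_repM subM Pa CL.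
    have eE i : idem_in T (e i).
      have Fe := F_translate rel (Mr i (ltn_ord i)) Pa.
      by split; [exact: (F_T subH subM rel Fe) | exact: Fe.1.2].
    (* The summation relation involves only idempotents of T, so [chi_combination] turns it into an
       identity of functions, to which [pi] applies. *)
    have eC : \sum_i chi (e i) = chi cone.
      transitivity (\sum_i (1 : Cplx R) *: chi (e i)).
        by apply: eq_bigr => i _; rewrite scale1r.
      apply: (chi_combination hT T1 TC (c := fun=> 1) eE (idem_in1 T1)).
      rewrite -S1 (big_nth set0) big_mkord; apply: eq_bigr => i _.
      by rewrite scale1r.
    rewrite -/p /p -eC (pi_sum piH); last by move=> i; apply: Cc_chi => //; case: (eE i).
    rewrite (big_nth set0) big_mkord; apply: eq_bigr => i _.
    have Mi := Mr i (ltn_ord i); have [Tsa Tui] := (Ts _ Pa, Tu _ Mi).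
    have h0 := TV _ Tsa; have h1 := isubM hT Tsa h0; have h2 := isubM hT Tui h1.
    by rewrite /e /range_proj (pM _ _ h2 (TV _ Tui)) (pM _ _ Tui h1) (pM _ _ Tsa h0) !pV.
exists (@usubalg_val _ _ _ _ hX hp \o phi).
have vS := usubalg_val_hom hX hp.
have fS : star_hom (@usubalg_val _ _ _ _ hX hp \o phi).
  case: phiS vS => l1 m1 v1 [l2 m2 v2]; split.
  - by move=> c x y; rewrite /= l1 l2.
  - by move=> x y; rewrite /= m1 m2.
  - by move=> x; rewrite /= v1 v2.
split=> //.
  by move=> a /=; rewrite usubalg_nrm; exact: star_hom_contractive.
set f := _ \o phi in fS *.
have fs a : P a -> f (s a) = pi (chi (s a)).
  by move=> Pa; rewrite /f /= phis //= usubalg_inK //; apply/Xt/Ts.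
have fu m : M m -> f (u m) = pi (chi (u m)).
  by move=> Mm; rewrite /f /= phiu //= usubalg_inK //; apply/Xt/Tu.
have fF e : Fset H M s u e -> f e = pi (chi e).
  move=> Fe; have [_ [n [c [w [wX eE]]]]] := Fe.
  have Fw i : Fset H M s u (w i) by have [k Mk [b Pb <-]] := wX i; exact: (F_translate rel Mk Pb).
  have idF q : Fset H M s u q -> idem_in T q.
    by move=> Fq; split; [exact: (F_T subH subM rel Fq) | exact: Fq.1.2].
  have wE i := idF _ (Fw i).
  rewrite -(chi_combination hT T1 TC wE (idF _ Fe) (esym eE)) eE (star_hom_sum fS).
  rewrite (pi_sum piH); last by move=> i; apply: lspanZ; apply: Cc_chi => //; case: (wE i).
  apply: eq_bigr => i _; rewrite (star_homZ fS) (piZ piH); last by apply: Cc_chi => //; case: (wE i).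
  congr (_ *: _); have [k Mk [b Pb <-]] := wX i.
  have [Tsb Tuk] := (Ts _ Pb, Tu _ Mk); have h0 := TV _ Tsb; have h1 := isubM hT Tsb h0.
  have h2 := isubM hT Tuk h1; rewrite /range_proj.
  rewrite (pM _ _ h2 (TV _ Tuk)) (pM _ _ Tuk h1) (pM _ _ Tsb h0) !pV //.
  by rewrite !(star_homM fS) !(star_homV fS) fs // fu.
move=> t [m [m' [a [a' [e [Mm Mm' Pa Pa' [Fe ->]]]]]]].
have Te := F_T subH subM rel Fe.
rewrite !(star_homM fS) (star_homV fS) !fs // !fu // fF //.
have [Tsa Tsa' Tum Tum'] := And4 (Ts _ Pa) (Ts _ Pa') (Tu _ Mm) (Tu _ Mm').
have M2 := isubM hT; have h0 := TV _ Tsa; have h1 := M2 _ _ h0 Tum.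
have h2 := M2 _ _ h1 Te; have h3 := M2 _ _ h2 Tum'.
by rewrite (pM _ _ h3 Tsa') (pM _ _ h2 Tum') (pM _ _ h1 Te) (pM _ _ h0 Tum) pV.
Qed.

Lemma integral_rep_dense : closure (iota @` @Cc R (tight_groupoid S)) = setT.
Proof.
have [rel univ] := Auniv; have [il im iv] := integral_rep_hom hT T1 TC.
pose Y := iota @` @Cc R (tight_groupoid S); have iC t : T t -> Y t.
  by move=> Tt; exists (chi t); [exact: Cc_chi | exact: integral_rep_chi].
have Ysub : closed_starsubalg (closure Y).
  apply: closure_starsubalg.
  - move=> c _ _ [f Cf <-] [h Ch <-]; exists (c *: f + h); last exact: il.
    by apply: lspanD => //; exact: lspanZ.
  - move=> _ _ [f Cf <-] [h Ch <-]; exists (convolution f h); last exact: im.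
    have [b b0 sf] := Cc_small T1 TC Cf; have [b' b'0 sh] := Cc_small T1 TC Ch.
    exact: (small_Cc T1 TC (small_conv T1 TC sf sh b0)).
  - move=> _ [f Cf <-]; exists (involution f); last exact: iv.
    have [b b0 sf] := Cc_small T1 TC Cf.
    exact: (small_Cc T1 TC (small_inv T1 TC sf)).
  - exact: (iC 0 (isub0 hT)).
have clT t : T t -> closure Y t by move=> /iC; exact: subset_closure.
have Yone : [/\ closure Y cone, forall x, closure Y x -> cone ** x = x &
    forall x, closure Y x -> x ** cone = x].
  by split=> [|x _|x _]; [exact: clT | rewrite cmul1x | rewrite cmulx1].
have [|phi [[phiS phi1 phis phiu] _]] := univ (usubalg Ysub Yone)
    (usubalg_in Ysub Yone \o s) (usubalg_in Ysub Yone \o u).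
  apply: sub_relations => //.
  - by move=> a Pa; apply/clT/(T_s subH subM rel).
  - by move=> m Mm; apply/clT/(T_u subH subM rel).
  - exact: (rel_isometry rel).
  - exact: (rel_unitary rel).
  - exact: (rel_ss rel).
  - exact: (rel_uu rel).
  - exact: (rel_su rel).
  - move=> a Pa; have finC : finite_set (lcosets M (conj_set a M)) by case: (Mindex Pa).
    by have := rel_sum rel Pa; rewrite fsbig_finite.
(* By uniqueness, [phi] followed by the inclusion is the identity of [A]; hence every element of [A]
   lies in the closure. *)
have [phi0 [_ uniq]] := univ A s u rel.
have E1 : phi0 = @usubalg_val _ _ _ _ Ysub Yone \o phi.
  apply: uniq; split.
  - case: phiS => l1 m1 v1; split.
    + by move=> c x y; rewrite /= l1.
    + by move=> x y; rewrite /= m1.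
    + by move=> x; rewrite /= v1.
  - by rewrite /= phi1 usubalg_val_one.
  - by move=> a Pa; rewrite /= phis //= usubalg_inK //; apply/clT/(T_s subH subM rel).
  - by move=> m Mm; rewrite /= phiu //= usubalg_inK //; apply/clT/(T_u subH subM rel).
have E2 : phi0 = id by apply: uniq.
apply/seteqP; split=> // a _.
have aE : a = usubalg_val (phi a) by rewrite -[LHS]/(id a) -E2 E1.
by rewrite aE; exact: usubalg_valP.
Qed.

Lemma groupoid_cstar_integral_rep : is_groupoid_cstar (tight_groupoid S) A.
Proof.
have iH := integral_rep_hom hT T1 TC.
exists iota; split=> //; first exact: integral_rep_dense.
move=> f Cf; split.
  move=> _ [D [pi [piH ->]]]; have [phi [phiS phi1 phiT]] := representation_factors piH.
  by rewrite -(pi_factor T1 TC piH phiS phi1 phiT Cf) !nrmE lecR.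
(* The supremum is attained, by [iota] itself. *)
by move=> r; apply; exists A, iota.
Qed.

End UniversalAlgebra.

Theorem proposition4p8 (R : realType) (G : groupType) (N H M : set G)
  (GNH : semidirect_product N H)
  (MN : normal_in M N)
  (HPPV : H = [set (a * b^-1)%g | a in Pmonoid H M & b in Pmonoid H M])
  (HPVP : H = [set (a^-1 * b)%g | a in Pmonoid H M & b in Pmonoid H M])
  (Mindex : forall a : G, Pmonoid H M a -> finite_index (conj_set a M) M)
  (Mcap : \bigcap_(a in Pmonoid H M) conj_set a M = [set 1%g])
  (A : unitalCStarAlgType R) (s u : G -> A)
  (Auniv : is_universal H M s u) :
  exists hT : inverse_subsemigroup (Tset H M s u),
  exists2 B : cstarAlgType R,
    is_groupoid_cstar (tight_groupoid (isg_of hT)) B &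
    cstar_isomorphic A B.
Proof.
have [rel _] := Auniv.
have subH : subgroup H by case: GNH.
have subM : subgroup M by case: MN.
pose hT := T_inverse_subsemigroup subH subM HPPV HPVP Mindex rel.
have T1 := F_T subH subM rel (F_cone subH subM rel).
have TC e : Tset H M s u e -> e ** e = e -> Tset H M s u (cone - e).
  move=> Te ee; apply: (F_T subH subM rel); apply: (F_compl subH subM rel).
  exact: (T_idem subH subM HPPV HPVP Mindex rel).
exists hT, A; first exact: groupoid_cstar_integral_rep.
by exists id; [split | exists id].
Qed.
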